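(* Let $\Theta\subset\mathbb{R}^d$ be a compact set, let $p_0$ be any probability density on $\mathbb{R}^d$, and let $\sigma>0$. Then there exists a unique $G_\sigma\in\mathcal{P}(\Theta)$ such that $p_\sigma=\phi_\sigma\ast G_\sigma$ solves the minimization problem $$\min_{p\in\mathcal{M}_\sigma(\Theta)} D_{\mathrm{KL}}(p_0\,\|\,p).$$ Furthermore, let $Y_1,Y_2,\ldots$ be i.i.d. samples from $p_0$ and, for each $n$, let $\widehat{G}_{n,\sigma}$ be any maximizer of $G\mapsto\sum_{i=1}^n\log(\phi_\sigma\ast G)(Y_i)$ over $G\in\mathcal{P}(\Theta)$. Then for each $r\in[1,\infty)$, $$W_r(\widehat{G}_{n,\sigma},G_\sigma)\to 0\quad\text{almost surely as } n\to\infty.$$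
   Context: $\mathcal{P}(\Theta)$ is the set of all probability measures supported on $\Theta$. $\phi_\sigma$ is the density of the Gaussian $\mathcal{N}(0,\sigma^2 I_d)$ on $\mathbb{R}^d$. For $G\in\mathcal{P}(\Theta)$, $(\phi_\sigma\ast G)(x)=\int_\Theta\phi_\sigma(x-\theta)\,dG(\theta)$, and $\mathcal{M}_\sigma(\Theta)=\{\phi_\sigma\ast G: G\in\mathcal{P}(\Theta)\}$. The Kullback–Leibler divergence is $D_{\mathrm{KL}}(p_0\|p)=\int_{\mathbb{R}^d}p_0\log\frac{p_0}{p}$. For $P,Q\in\mathcal{P}(\Theta)$, $W_r(P,Q)=\big(\inf_{\gamma\in\Gamma(P,Q)}\int_{\Theta\times\Theta}|x-y|^r\,d\gamma(x,y)\big)^{1/r}$, where $\Gamma(P,Q)$ is the set of couplings of $P$ and $Q$. The measure $\widehat{G}_{n,\sigma}$ is called the nonparametric maximum likelihood estimator (NPMLE).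
   Formalization: If D_KL(p_0||p)=+∞ for all p in M_σ(Θ) (e.g. p_0 Cauchy), every G in P(Θ) is a minimizer and uniqueness fails once Θ has two points; so uniqueness and the a.s. convergence are stated only when the minimum is finite. Θ is assumed nonempty. *)

(* Defs.v *)
From HB Require Import structures.
From mathcomp Require Import all_boot all_order all_algebra.
From mathcomp Require Import finmap.
From mathcomp Require Import all_classical all_reals all_analysis.

Set Implicit Arguments.
Unset Strict Implicit.
Unset Printing Implicit Defensive.

Import Order.TTheory GRing.Theory Num.Theory.
Import numFieldTopology.Exports numFieldNormedType.Exports.

Local Open Scope classical_set_scope.
Local Open Scope ring_scope.

Definition rV_display : measure_display.
Proof. exact. Qed.

(* R^d is 'rV[R]_d, with the Borel sigma-algebra of its topology *)
Section borel_rV.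
Context (R : realType) (d : nat).

Let borel : set (set 'rV[R]_d) := <<s [set U | open U] >>.

Let borel0 : borel set0.
Proof. exact: sigma_algebra0. Qed.

Let borelC A : borel A -> borel (~` A).
Proof. exact: sigma_algebraC. Qed.

Let borel_bigcup (F : (set 'rV[R]_d)^nat) :
  (forall i, borel (F i)) -> borel (\bigcup_i F i).
Proof. exact: sigma_algebra_bigcup. Qed.

HB.instance Definition _ := @isMeasurable.Build rV_display 'rV[R]_d
  borel borel0 borelC borel_bigcup.

End borel_rV.

Section measurable_rV.
Context (R : realType).

Lemma open_measurable_rV d (U : set 'rV[R]_d) : open U -> measurable U.
Proof. exact: sub_sigma_algebra. Qed.

Lemma measurable_coord d (i : 'I_d) :
  measurable_fun [set: 'rV[R]_d] (fun x : 'rV[R]_d => x ord0 i).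
Proof.
apply: (measurability _ (measurable_realfun.RGenOpens.measurableE R)).
move=> _ [_ [a [b ->]]] <-; rewrite setTI.
apply: open_measurable_rV; apply: open_comp; last exact: interval_open.
by move=> x _; exact: coord_continuous.
Qed.

Let box d (k : 'rV[rat]_d * rat) : set 'rV[R]_d :=
  [set x | forall i, `|ratr (k.1 ord0 i) - x ord0 i| < ratr k.2].

Let open_bigcup_box d (U : set 'rV[R]_d) : open U ->
  U = \bigcup_(k in [set k | box k `<=` U]) box k.
Proof.
move=> oU; apply/seteqP; split; last by move=> x [k]; apply.
move=> x Ux; have /nbhs_ballP[e /= e0 xeU] : nbhs x U by exact: open_nbhs_nbhs.
have /rat_in_itvoo[r /itvP re] : 0 < e / 2 by rewrite divr_gt0.
have r0 : 0 < ratr r :> R by rewrite re.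
have /choice[q qx] i : exists q : rat, `|ratr q - x ord0 i| < ratr r.
  have /rat_in_itvoo[q /itvP qxr] : x ord0 i < x ord0 i + ratr r by rewrite ltrDl.
  by exists q; rewrite gtr0_norm ?subr_gt0 ?qxr// ltrBlDl qxr.
exists (\row_i q i, r) => /=; last by move=> i /=; rewrite mxE.
move=> y /= ky; apply: xeU; split => // i j; rewrite ord1 /ball/=.
have := ky j; rewrite mxE => qy; have qxj := qx j.
rewrite (le_lt_trans (ler_distD (ratr (q j)) _ _))// (splitr e).
by rewrite distrC ltrD// (lt_le_trans _ (ltW _ : ratr r <= e / 2)) ?re.
Qed.

Lemma measurable_rVP d' (T : measurableType d') d (f : T -> 'rV[R]_d) :
  (forall i, measurable_fun setT (fun t => f t ord0 i)) ->
  measurable_fun setT f.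
Proof.
move=> mf; apply: (measurability [set U : set 'rV[R]_d | open U] (erefl _)) => _ [U /= oU <-].
rewrite setTI (open_bigcup_box oU) preimage_bigcup bigcup_mkcond.
apply: countable_bigcupT_measurable => [|k]; first exact: countableP.
case: ifPn => // _.
rewrite (_ : _ @^-1` _ = \bigcap_(i in [set: 'I_d])
   ((fun t => f t ord0 i) @^-1`
      `]ratr (k.1 ord0 i) - ratr k.2, ratr (k.1 ord0 i) + ratr k.2[)).
  apply: fin_bigcap_measurable => // i _.
  by rewrite -[X in measurable X]setTI; exact: mf.
apply/seteqP; split => t /= ft i; first move=> _.
  by rewrite /= in_itv/= -ltr_distlC; exact: ft.
by have := ft i Logic.I; rewrite /= in_itv/= -ltr_distlC.
Qed.

Definition cons_rV d (z : R * 'rV[R]_d) : 'rV[R]_d.+1 :=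
  \row_i (if unlift ord0 i is Some j then z.2 ord0 j else z.1).

Let uncons_rV d (x : 'rV[R]_d.+1) : R * 'rV[R]_d :=
  (x ord0 ord0, \row_j x ord0 (lift ord0 j)).

Let cons_rVK d : cancel (@cons_rV d) (@uncons_rV d).
Proof.
move=> [t x]; congr pair; first by rewrite mxE unlift_none.
by apply/rowP => j; rewrite !mxE liftK.
Qed.

Lemma measurable_cons_rV d : measurable_fun setT (@cons_rV d).
Proof.
apply: measurable_rVP => i.
under [X in measurable_fun _ X]eq_fun do rewrite mxE.
case: unliftP => [j _|_] //=.
  by apply: (measurableT_comp (measurable_coord j)).
exact: measurable_fst.
Qed.

Let measurable_uncons_rV d : measurable_fun setT (@uncons_rV d).
Proof.
apply/measurable_fun_pairP; split; first exact: measurable_coord.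
apply: measurable_rVP => i /=.
under [X in measurable_fun _ X]eq_fun do rewrite mxE.
exact: measurable_coord.
Qed.

Section push_cons.
Context d (m : {sigma_finite_measure set 'rV[R]_d -> \bar R}).

Definition lebesgue_cons : set 'rV[R]_d.+1 -> \bar R :=
  pushforward (lebesgue_measure \x m)%E (@cons_rV d).

Let mpre A : measurable A -> measurable (@cons_rV d @^-1` A).
Proof.
by move=> mA; rewrite -[X in measurable X]setTI; exact: measurable_cons_rV.
Qed.

Let mu0 : lebesgue_cons set0 = 0%E.
Proof. by rewrite /lebesgue_cons /pushforward preimage_set0 measure0. Qed.

Let mu_ge0 A : (0 <= lebesgue_cons A)%E.
Proof. exact: (measure_ge0 (lebesgue_measure \x m)%E). Qed.

Let mu_sigma_additive : semi_sigma_additive lebesgue_cons.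
Proof.
move=> F mF tF mUF; rewrite /lebesgue_cons /pushforward preimage_bigcup.
apply: measure_semi_sigma_additive => [n||]; first exact: mpre.
- apply/trivIsetP => /= i j _ _ ij; rewrite -preimage_setI.
  by move/trivIsetP : tF => /(_ _ _ _ _ ij) ->//; rewrite preimage_set0.
- by rewrite -preimage_bigcup; exact: mpre.
Qed.

HB.instance Definition _ := isMeasure.Build _ _ _ lebesgue_cons
  mu0 mu_ge0 mu_sigma_additive.

Let mu_sigma_finite : sigma_finite setT lebesgue_cons.
Proof.
have /sigma_finiteP[F [FT ndF Foo]] := sigma_finiteT (@lebesgue_measure R).
have /sigma_finiteP[G [GT ndG Goo]] := sigma_finiteT m.
exists (fun n => @uncons_rV d @^-1` (F n `*` G n)).
  apply/esym; rewrite -preimage_bigcup -subTset => x _ /=.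
  have [k _ Fk] : (\bigcup_n F n) (uncons_rV x).1 by rewrite -FT.
  have [l _ Gl] : (\bigcup_n G n) (uncons_rV x).2 by rewrite -GT.
  exists (maxn k l) => //; split.
    by move: Fk; exact/subsetPset/ndF/leq_maxl.
  by move: Gl; exact/subsetPset/ndG/leq_maxr.
move=> n; have [mF Fn] := Foo n; have [mG Gn] := Goo n; split.
  rewrite -[X in measurable X]setTI; apply: measurable_uncons_rV => //.
  exact: measurableX.
rewrite /lebesgue_cons /pushforward -comp_preimage.
have -> : @uncons_rV d \o @cons_rV d = id by apply/funext; exact: cons_rVK.
by rewrite preimage_id product_measure1E// lte_mul_pinfty// ge0_fin_numE.
Qed.

HB.instance Definition _ := Measure_isSigmaFinite.Build _ _ _ lebesgue_cons
  mu_sigma_finite.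

End push_cons.

Fixpoint lebesgue_rV d : {sigma_finite_measure set 'rV[R]_d -> \bar R} :=
  match d with
  | 0 => \d_(0 : 'rV[R]_0)
  | d.+1 => lebesgue_cons (lebesgue_rV d)
  end.

Let measurable_box d (A : 'I_d -> set R) : (forall i, measurable (A i)) ->
  measurable [set x : 'rV[R]_d | forall i, A i (x ord0 i)].
Proof.
move=> mA.
rewrite (_ : mkset _ = \bigcap_(i in [set: 'I_d])
   ((fun x : 'rV[R]_d => x ord0 i) @^-1` A i)).
  apply: fin_bigcap_measurable => // i _.
  by rewrite -[X in measurable X]setTI; exact: measurable_coord.
by apply/seteqP; split => x /= Ax i; [move=> _|]; exact: Ax.
Qed.

Lemma lebesgue_rV_box d (A : 'I_d -> set R) : (forall i, measurable (A i)) ->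
  lebesgue_rV d [set x | forall i, A i (x ord0 i)] =
  (\prod_(i < d) lebesgue_measure (A i))%E.
Proof.
elim: d A => [|d IH] A mA /=.
  by rewrite big_ord0 diracE mem_set// => -[].
rewrite big_ord_recl -(IH (fun j => A (lift ord0 j)))//.
rewrite -product_measure1E; [|exact: mA|exact: (measurable_box (fun j => mA (lift ord0 j)))].
rewrite /lebesgue_cons /pushforward; congr (_ \x _)%E.
apply/seteqP; split => [[t x] /= Ax|[t x] [/= At Ax] i].
  split=> [|j] /=; first by have := Ax ord0; rewrite mxE unlift_none.
  by have := Ax (lift ord0 j); rewrite mxE liftK.
by rewrite mxE; case: unliftP => [j ->|->]; [exact: Ax|].
Qed.

End measurable_rV.

Section mixture.
Context (R : realType) (d : nat).
Local Notation E := 'rV[R]_d.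

(* Euclidean norm; the library norm on matrices is the sup norm *)
Definition enorm (x : E) : R := Num.sqrt (\sum_i x ord0 i ^+ 2).

Definition gaussian_density (sigma : R) (x : E) : R :=
  (Num.sqrt (2 * pi * sigma ^+ 2)) ^- d *
  expR (- (enorm x ^+ 2 / (2 * sigma ^+ 2))).

Definition is_density (p : E -> R) : Prop :=
  [/\ measurable_fun setT p, forall x, 0 <= p x &
      (\int[lebesgue_rV R d]_x (p x)%:E = 1)%E].

Definition supported_on (Theta : set E) (G : probability E R) : Prop :=
  G Theta = 1%E.

Definition gaussian_mixture (Theta : set E) (sigma : R) (G : probability E R)
    (x : E) : R :=
  \int[G]_(t in Theta) gaussian_density sigma (x - t).

Definition gaussian_mixtures (Theta : set E) (sigma : R) : set (E -> R) :=
  [set gaussian_mixture Theta sigma G | G in supported_on Theta].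

(* In \bar R, 0^-1 = +oo, lne 0 = -oo and 0 * -oo = 0, so the integrand is 0
   where p0 = 0 and +oo where p0 > 0 = p. *)
Definition KL (p0 p : E -> R) : \bar R :=
  (\int[lebesgue_rV R d]_x ((p0 x)%:E * lne ((p0 x)%:E / (p x)%:E)))%E.

Definition is_KL_minimizer (Theta : set E) (sigma : R) (p0 : E -> R)
    (G : probability E R) : Prop :=
  supported_on Theta G /\
  forall p, gaussian_mixtures Theta sigma p ->
    (KL p0 (gaussian_mixture Theta sigma G) <= KL p0 p)%E.

Definition is_NPMLE (Theta : set E) (sigma : R) (n : nat) (y : 'I_n -> E)
    (G : probability E R) : Prop :=
  supported_on Theta G /\
  forall G' : probability E R, supported_on Theta G' ->
    \sum_(i < n) ln (gaussian_mixture Theta sigma G' (y i)) <=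
    \sum_(i < n) ln (gaussian_mixture Theta sigma G (y i)).

Definition couplings (P Q : probability E R) : set (probability (E * E)%type R) :=
  [set g | forall A, measurable A ->
     g (A `*` setT) = P A /\ g (setT `*` A) = Q A].

Definition wasserstein (Theta : set E) (r : R) (P Q : probability E R) :
    \bar R :=
  poweR (ereal_inf [set \int[g]_(z in Theta `*` Theta)
                          (enorm (z.1 - z.2) `^ r)%:E
                   | g in couplings P Q])%E r^-1.

End mixture.

Section iid.
Context (R : realType) d (T : measurableType d) (P : probability T R)
  d' (U : measurableType d').

Definition mutually_independent (Y : nat -> {RV P >-> U}) : Prop :=
  forall (J : {fset nat}) (B : nat -> set U), (forall i, measurable (B i)) ->
    P (\bigcap_(i in [set` J]) Y i @^-1` B i) =
    (\prod_(i <- J) P (Y i @^-1` B i))%E.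

End iid.

Definition iid_from (R : realType) (d : nat) d' (T : measurableType d')
    (P : probability T R) (p0 : 'rV[R]_d -> R)
    (Y : nat -> {RV P >-> 'rV[R]_d}) : Prop :=
  mutually_independent Y /\
  forall i B, measurable B ->
    distribution P (Y i) B = (\int[lebesgue_rV R d]_(x in B) (p0 x)%:E)%E.

(* Main.v *)
Require Import Defs.
From HB Require Import structures.
From mathcomp Require Import all_boot all_order all_algebra.
From mathcomp Require Import finmap.
From mathcomp Require Import all_classical all_reals all_analysis.
From mathcomp Require Import measurable_realfun.
From mathcomp Require Import ring lra.

Set Implicit Arguments.
Unset Strict Implicit.
Unset Printing Implicit Defensive.

Import Order.TTheory GRing.Theory Num.Theory.
Import numFieldTopology.Exports numFieldNormedType.Exports.

Local Open Scope classical_set_scope.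
Local Open Scope ring_scope.

(** Every law on [Theta] is the image of the uniform law on [[0, 1]] under a map
    [skorokhod Theta m] determined by the masses [m] that it gives to a fixed
    countable family of nested cells of R^d. Such mass systems are compact for
    pointwise convergence, and if two of them are close on short words, then
    their maps are close off a set of small probability. Mixtures are therefore
    continuous in [m], and pairing the two maps gives a coupling that bounds
    the Wasserstein distance.

    When some divergence is finite, Young's inequality gives p0 a second moment,
    so the log-ratio of two mixtures, which grows at most linearly, is integrable;
    the divergence is then continuous in [m], and a minimizer exists. By strict
    concavity of the logarithm, two minimizing mixtures agree on a set of positive
    Lebesgue measure; up to a Gaussian factor they are Laplace transforms, hence
    entire in each coordinate, so they agree everywhere and the mixing laws
    coincide.

    For consistency, a law of large numbers for countably many envelopes of
    log-ratios holds almost surely. On that event, every ultrafilter limit of the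
    estimators does at least as well as the minimizer, hence equals it. *)

(** * Integrals of bounded functions *)

(** Heavy tails of p0 are the obstacle. They can make every divergence +oo, and then every law on
    Theta is a minimizer; hence uniqueness and consistency are claimed for a finite minimum.
    Finiteness pays for itself: mixtures decay like a Gaussian, so a finite divergence forces a
    second moment, which makes the squares of log-ratios of linear growth integrable, as a law of
    large numbers based on variances requires. Driving all laws by one uniform variable lets a
    single estimate, two maps close off a small event, serve both the mixtures and the Wasserstein
    distance. The price is that cells have boundaries: a pointwise limit of cell masses still yields
    a map into Theta, but it need not be the system of cell masses of the law of that map. Several
    mass systems may thus represent one law, so uniqueness is stated for image laws, never for mass
    systems. Ultrafilters stand in for subsequences, both in extracting a minimizer and in refuting
    consistency. *)

Section real_integral.
Context d (T : measurableType d) (R : realType).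

Lemma bounded_integrable (mu : {finite_measure set T -> \bar R}) (f : T -> R) (B : R) :
  measurable_fun setT f -> (forall x, `|f x| <= B) ->
  mu.-integrable setT (EFin \o f).
Proof.
move=> mf fB; apply/integrableP; split; first exact/measurable_EFinP.
apply: (@le_lt_trans _ _ (\int[mu]_x B%:E)%E); last first.
  by rewrite integral_cst// lte_mul_pinfty// ?fin_num_fun_lty// lee_fin
    (le_trans (normr_ge0 (f point))).
apply: ge0_le_integral => //=.
  by apply/measurable_EFinP; exact: measurableT_comp.
by move=> x _; rewrite lee_fin.
Qed.

Lemma cvg_Rintegral (mu : {measure set T -> \bar R}) (f_ : nat -> T -> R) (f g : T -> R) :
  (forall n, measurable_fun setT (f_ n)) ->
  (forall x, f_ ^~ x @ \oo --> f x) ->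
  mu.-integrable setT (EFin \o g) ->
  (forall n x, `|f_ n x| <= g x) ->
  (\int[mu]_x f_ n x) @[n --> \oo] --> \int[mu]_x f x.
Proof.
move=> mf_ f_f ig f_g.
have mf : measurable_fun setT f.
  by apply: measurable_fun_cvg => [n|x _]; [exact: mf_|exact: f_f].
have [||||If _ cvgI] := @dominated_convergence _ _ _ mu setT measurableT
  (fun n => EFin \o f_ n) (EFin \o f) (EFin \o g) _ _ _ ig.
- by move=> n; exact/measurable_EFinP.
- exact/measurable_EFinP.
- by apply: aeW => x _ /=; apply: cvg_EFin; [exact: nearW|exact: f_f].
- by apply: aeW => x n _ /=; rewrite lee_fin.
apply: (@fine_cvg R _ _ _ (fun n => \int[mu]_x (f_ n x)%:E)%E).
rewrite /Rintegral fineK //.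
exact: integrable_fin_num.
Qed.

Lemma cvg_bounded_Rintegral (mu : {finite_measure set T -> \bar R})
    (f_ : nat -> T -> R) (f : T -> R) (B : R) :
  (forall n, measurable_fun setT (f_ n)) ->
  (forall x, f_ ^~ x @ \oo --> f x) ->
  (forall n x, `|f_ n x| <= B) ->
  (\int[mu]_x f_ n x) @[n --> \oo] --> \int[mu]_x f x.
Proof.
move=> mf_ f_f f_B; apply: (@cvg_Rintegral mu f_ f (cst B)) => //.
apply: (@bounded_integrable mu (cst B) `|B|) => //.
Qed.

Lemma normr_Rintegral_le (P : probability T R) (f : T -> R) (B : R) :
  measurable_fun setT f -> (forall x, `|f x| <= B) -> `|\int[P]_x f x| <= B.
Proof.
move=> mf fB; have intf := bounded_integrable P mf fB.
apply: le_trans (le_normr_Rintegral _ intf) _ => //.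
have -> : B = \int[P]_x (cst B x).
  rewrite Rintegral_cst// -[LHS]mulr1; congr (_ * _).
  exact: (congr1 fine (esym (probability_setT P))).
apply: le_Rintegral => //; first exact: integrable_norm.
exact: finite_measure_integrable_cst.
Qed.

(** Recentering at the midpoint of a and b turns the two bounds into one bound on a norm. All bounds
    on mixtures below reduce to bounds on their integrands this way. *)
Lemma Rintegral_between (P : probability T R) (f : T -> R) (a b : R) :
  measurable_fun setT f -> (forall x, a <= f x <= b) -> a <= \int[P]_x f x <= b.
Proof.
move=> mf fab; pose c := (a + b) / 2; pose r := (b - a) / 2.
have fr x : `|f x - c| <= r.
  by rewrite ler_distlC /c /r; have /andP[] := fab x; lra.
have mfc : measurable_fun setT (fun x => f x - c) by exact: measurable_funB.
have := normr_Rintegral_le P mfc fr.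
rewrite RintegralB//; last 2 first.
- apply: (bounded_integrable P mf (B := r + `|c|)) => x.
  by rewrite -[f x](subrK c) (le_trans (ler_normD _ _))// lerD2r.
- exact: finite_measure_integrable_cst.
rewrite (_ : \int[P]_x cst c x = c); last first.
  rewrite Rintegral_cst// -[RHS]mulr1; congr (_ * _).
  exact: (congr1 fine (probability_setT P)).
by rewrite ler_distl /c /r; set I := Rintegral _ _ _; lra.
Qed.

End real_integral.

Lemma series_exp_coeff_le_expR (R : realType) (x : R) n :
  `|series (exp_coeff x) n| <= expR `|x|.
Proof.
apply: le_trans (_ : series (exp_coeff `|x|) n <= _).
  rewrite /series/= (le_trans (ler_norm_sum _ _ _))// ler_sum// => i _.
  by rewrite /exp_coeff/= normrM normrX normfV normr_nat.
rewrite /expR; apply: nondecreasing_cvgn_le; last exact: is_cvg_series_exp_coeff.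
apply: nondecreasing_series => i _ _.
exact: exp_coeff_ge0.
Qed.

Lemma cvg_sumr (R : realType) T (F : set_system T) {FF : Filter F} I (s : seq I)
    (f : I -> T -> R) (l : I -> R) :
  (forall i, f i x @[x --> F] --> l i) ->
  \sum_(i <- s) f i x @[x --> F] --> \sum_(i <- s) l i.
Proof.
move=> fl; elim: s => [|i s IH].
  by rewrite big_nil; under eq_fun do rewrite big_nil; exact: cvg_cst.
by rewrite big_cons; under eq_fun do rewrite big_cons; exact: cvgD.
Qed.

(** * Uniqueness of Laplace transforms *)

Section expR_sub1_quotient.
Context (R : realType).
Implicit Types t y : R.

(** The right inequality is the left one at -y, multiplied by exp(y). The form [+ -1] fits closure
    under sums, [laplace_multiplierD]. *)
Lemma expR_sub1_le y : y <= expR y + -1 <= y * expR y.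
Proof.
have := expR_ge1Dx y; have := expR_ge1Dx (- y); have := expRxMexpNx_1 y.
have := expR_gt0 y; set a := expR y; set b := expR (- y) => a0 ab h1 h2.
apply/andP; split; first lra.
by nra.
Qed.

Lemma expR_sub1_quotient_itv t (k : nat) :
  t <= (expR (t * k.+1%:R^-1) + -1) * k.+1%:R <= t * expR (t * k.+1%:R^-1).
Proof.
have k0 : 0 < k.+1%:R :> R by [].
have /andP[h1 h2] := expR_sub1_le (t * k.+1%:R^-1).
have tk : t = t * k.+1%:R^-1 * k.+1%:R by rewrite mulfVK ?gt_eqF.
apply/andP; split; first by rewrite {1}tk ler_wpM2r.
by rewrite {2}tk mulrAC ler_wpM2r.
Qed.

Lemma expR_sub1_quotient_le t (k : nat) :
  `|(expR (t * k.+1%:R^-1) + -1) * k.+1%:R| <= `|t| * expR `|t|.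
Proof.
have /andP[h1 h2] := expR_sub1_quotient_itv t k.
have e1 : 1 <= expR `|t| by rewrite -[leLHS]expR0 ler_expR.
have : expR (t * k.+1%:R^-1) <= expR `|t|.
  rewrite ler_expR (le_trans (ler_norm _))// normrM ler_piMr//.
  by rewrite ger0_norm// invf_le1// ler1n.
have := expR_gt0 (t * k.+1%:R^-1) => e0 e2.
have tt := ler_norm t; have tN : - t <= `|t| by rewrite -normrN ler_norm.
have t0 := normr_ge0 t.
rewrite ler_norml; apply/andP; split; last first.
  apply: le_trans h2 _; apply: le_trans (_ : `|t| * expR (t * k.+1%:R^-1) <= _).
    by rewrite ler_pM2r.
  by rewrite ler_wpM2l.
by nra.
Qed.

Lemma expR_sub1_quotient_cvg t :
  (expR (t * k.+1%:R^-1) + -1) * k.+1%:R @[k --> \oo] --> t.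
Proof.
apply: (@squeeze_cvgr _ _ _ _ (cst t) (fun k => t * expR (t * k.+1%:R^-1))).
- by apply: nearW => k; exact: expR_sub1_quotient_itv.
- exact: cvg_cst.
- rewrite -[X in _ --> X]mulr1; apply: cvgM; first exact: cvg_cst.
  rewrite -[X in _ --> X]expR0; apply: continuous_cvg; first exact: continuous_expR.
  rewrite -[X in _ --> X](mulr0 t); apply: cvgM; first exact: cvg_cst.
  exact: cvg_harmonic.
Qed.

(** A step function as a limit of exponentials of exponentials. The inner exponent is at most -k
    when t <= a and at least k eventually when t > a; the term -k decides the boundary case t =
    a. *)
Lemma expR_expR_step t (a : R) :
  expR (-1 * expR (k%:R ^+ 2 * (t + - a) + - k%:R)) @[k --> \oo] -->
  ((t <= a)%R%:R : R).
Proof.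
have [ta|at_] := leP t a.
- apply: (@squeeze_cvgr _ _ _ _ (fun k => 1 - expR (- k%:R)) (cst 1)).
  + apply: nearW => k; rewrite expR_le1 mulN1r oppr_le0 expR_ge0 andbT.
    rewrite (le_trans _ (expR_ge1Dx _))// lerD2l lerN2 ler_expR.
    by rewrite gerDr mulr_ge0_le0 ?sqr_ge0// subr_le0.
  + rewrite -[X in _ --> X]subr0; apply: cvgB; first exact: cvg_cst.
    exact: cvgn_expR.
  + exact: cvg_cst.
- apply: (@squeeze_cvgr _ _ _ _ (cst 0) (fun k => expR (- k%:R))).
  + near=> k; rewrite expR_ge0 /= ler_expR mulN1r lerN2.
    apply: le_trans (_ : k%:R ^+ 2 * (t - a) - k%:R <= _); last first.
      by rewrite (le_trans _ (expR_ge1Dx _))// lerDr.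
    (* This gives k^2 (t - a) - k >= k. *)
    have : 2 <= k%:R * (t - a).
      by rewrite -ler_pdivrMr ?subr_gt0//; near: k; exact: nbhs_infty_ger.
    have : 0 <= k%:R :> R by [].
    by nra.
  + exact: cvg_cst.
  + exact: cvgn_expR.
Unshelve. all: by end_near. Qed.

End expR_sub1_quotient.

Section laplace.
Context (R : realType) (n : nat).
Local Notation E := 'rV[R]_n.

Definition dotrV (x y : E) : R := \sum_i x ord0 i * y ord0 i.

Lemma measurable_dotrV (x : E) : measurable_fun setT (dotrV x).
Proof.
rewrite /dotrV; apply: measurable_sum => i.
by apply: measurable_funM => //; exact: measurable_coord.
Qed.

(** Linear forms and exponentials are unbounded on the whole space, but [h1] and [h2] take values in
    a cube, so bounds there ensure integrability. *)
Definition bounded_on_cube (D : R) (v : E -> R) :=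
  exists B : R, forall x : E, (forall i, `|x ord0 i| <= D) -> `|v x| <= B.

Lemma bounded_on_cube_dot (D : R) (y : E) : bounded_on_cube D (dotrV y).
Proof.
exists (\sum_i `|y ord0 i| * D) => x xD.
rewrite (le_trans (ler_norm_sum _ _ _))// ler_sum// => i _.
by rewrite normrM ler_wpM2l.
Qed.

Lemma bounded_on_cube_expR (D : R) (v : E -> R) : bounded_on_cube D v ->
  bounded_on_cube D (fun x => expR (v x)).
Proof.
move=> [B vB]; exists (expR B) => x xD; rewrite ger0_norm ?expR_ge0// ler_expR.
by rewrite (le_trans (ler_norm _))// vB.
Qed.

Context d1 (T1 : measurableType d1) (P1 : probability T1 R) (h1 : T1 -> E)
  d2 (T2 : measurableType d2) (P2 : probability T2 R) (h2 : T2 -> E) (D : R).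
Hypotheses (mh1 : measurable_fun setT h1) (mh2 : measurable_fun setT h2).
Hypotheses (h1D : forall u i, `|h1 u ord0 i| <= D)
           (h2D : forall u i, `|h2 u ord0 i| <= D).

Definition same_laplace (f : E -> R) := forall x : E,
  \int[P1]_u (f (h1 u) * expR (dotrV x (h1 u))) =
  \int[P2]_u (f (h2 u) * expR (dotrV x (h2 u))).

Definition tame (v : E -> R) := measurable_fun setT v /\ bounded_on_cube D v.

(* Multiplication by [v] preserves equality of Laplace transforms. Such [v] form
   an algebra closed under bounded pointwise limits and containing the
   exponentials [t |-> expR (dotrV y t)], hence all indicators of Borel sets. *)
Definition laplace_multiplier (v : E -> R) := tame v /\
  forall f, tame f -> same_laplace f -> same_laplace (fun t => f t * v t).

Lemma tameM f g : tame f -> tame g -> tame (fun t => f t * g t).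
Proof.
move=> [mf [B fB]] [mg [C gC]]; split; first exact: measurable_funM.
exists (B * C) => x xD; rewrite normrM.
by rewrite ler_pM// ?fB// gC.
Qed.

Lemma tameD f g : tame f -> tame g -> tame (fun t => f t + g t).
Proof.
move=> [mf [B fB]] [mg [C gC]]; split; first exact: measurable_funD.
exists (B + C) => x xD.
by rewrite (le_trans (ler_normD _ _))// lerD// ?fB// gC.
Qed.

Lemma tame_cst c : tame (cst c).
Proof. by split => //; exists `|c|. Qed.

Lemma tame_expR v : tame v -> tame (fun x => expR (v x)).
Proof.
move=> [mv bv]; split; last exact: bounded_on_cube_expR.
exact: measurableT_comp.
Qed.

Lemma tame_expR_dot x : tame (fun t => expR (dotrV x t)).
Proof.
apply: tame_expR; split; first exact: measurable_dotrV.
exact: bounded_on_cube_dot.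
Qed.

Let integrable1 f : tame f -> P1.-integrable setT (EFin \o (fun u => f (h1 u))).
Proof.
move=> [mf [B fB]]; apply: (@bounded_integrable _ _ _ P1 _ B).
  exact: measurableT_comp.
by move=> u; exact: fB.
Qed.

Let integrable2 f : tame f -> P2.-integrable setT (EFin \o (fun u => f (h2 u))).
Proof.
move=> [mf [B fB]]; apply: (@bounded_integrable _ _ _ P2 _ B).
  exact: measurableT_comp.
by move=> u; exact: fB.
Qed.

Lemma same_laplaceD f g : tame f -> tame g ->
  same_laplace f -> same_laplace g -> same_laplace (fun t => f t + g t).
Proof.
move=> tf tg fl gl x.
under eq_Rintegral do rewrite mulrDl.
under [RHS]eq_Rintegral do rewrite mulrDl.
rewrite RintegralD//; last 2 first.
- exact: (integrable1 (tameM tf (tame_expR_dot x))).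
- exact: (integrable1 (tameM tg (tame_expR_dot x))).
rewrite RintegralD ?fl ?gl//.
- exact: (integrable2 (tameM tf (tame_expR_dot x))).
- exact: (integrable2 (tameM tg (tame_expR_dot x))).
Qed.

Lemma same_laplaceZ c f : tame f ->
  same_laplace f -> same_laplace (fun t => f t * c).
Proof.
move=> tf fl x.
under eq_Rintegral do rewrite mulrAC.
under [RHS]eq_Rintegral do rewrite mulrAC.
rewrite RintegralZr//; last exact: (integrable1 (tameM tf (tame_expR_dot x))).
rewrite RintegralZr//; last exact: (integrable2 (tameM tf (tame_expR_dot x))).
by rewrite fl.
Qed.

Lemma laplace_multiplier_cst c : laplace_multiplier (cst c).
Proof.
by split; [exact: tame_cst|move=> f tf fl; exact: same_laplaceZ].
Qed.

Lemma laplace_multiplierM v w : laplace_multiplier v -> laplace_multiplier w ->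
  laplace_multiplier (fun t => v t * w t).
Proof.
move=> [tv vl] [tw wl]; split; first exact: tameM.
move=> f tf fl x.
under eq_Rintegral do rewrite mulrA.
under [RHS]eq_Rintegral do rewrite mulrA.
exact: (wl _ (tameM tf tv) (vl _ tf fl) x).
Qed.

Lemma laplace_multiplierD v w : laplace_multiplier v -> laplace_multiplier w ->
  laplace_multiplier (fun t => v t + w t).
Proof.
move=> [tv vl] [tw wl]; split; first exact: tameD.
move=> f tf fl x.
under eq_Rintegral do rewrite mulrDr.
under [RHS]eq_Rintegral do rewrite mulrDr.
exact: (same_laplaceD (tameM tf tv) (tameM tf tw) (vl _ tf fl) (wl _ tf fl) x).
Qed.

Lemma laplace_multiplier_sum I (s : seq I) (v : I -> E -> R) :
  (forall i, laplace_multiplier (v i)) ->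
  laplace_multiplier (fun t => \sum_(i <- s) v i t).
Proof.
move=> vl; elim: s => [|i s IH].
  rewrite (_ : (fun _ => _) = cst 0); first exact: laplace_multiplier_cst.
  by apply/funext => t; rewrite big_nil.
rewrite (_ : (fun _ => _) = fun t => v i t + \sum_(j <- s) v j t).
  exact: laplace_multiplierD.
by apply/funext => t; rewrite big_cons.
Qed.

Lemma laplace_multiplierX v k : laplace_multiplier v ->
  laplace_multiplier (fun t => v t ^+ k).
Proof.
move=> vl; elim: k => [|k IH]; first exact: laplace_multiplier_cst.
rewrite (_ : (fun _ => _) = fun t => v t * v t ^+ k).
  exact: laplace_multiplierM.
by apply/funext => t; rewrite exprS.
Qed.

(** Dominated convergence under both laws, then uniqueness of the limit. *)
Lemma laplace_multiplier_cvg (v_ : nat -> E -> R) (v : E -> R) (B : R) :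
  (forall k, laplace_multiplier (v_ k)) ->
  (forall k (x : E), (forall i, `|x ord0 i| <= D) -> `|v_ k x| <= B) ->
  measurable_fun setT v ->
  (forall x : E, (forall i, `|x ord0 i| <= D) -> v_ ^~ x @ \oo --> v x) ->
  laplace_multiplier v.
Proof.
move=> v_l v_B mv v_v.
have vB (x : E) : (forall i, `|x ord0 i| <= D) -> `|v x| <= B.
  by move=> xD; apply: cvgr_to_le (cvg_norm (v_v x xD)) _; apply: nearW => k; exact: v_B.
have tv : tame v by split => //; exists B.
split=> // f tf fl x.
have [C fC] := (tameM tf (tame_expR_dot x)).2.
have key d (T : measurableType d) (P : probability T R) (h : T -> E) :
    measurable_fun setT h -> (forall u i, `|h u ord0 i| <= D) ->
    \int[P]_u (f (h u) * v_ k (h u) * expR (dotrV x (h u))) @[k --> \oo] -->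
    \int[P]_u (f (h u) * v (h u) * expR (dotrV x (h u))).
  move=> mh hD; apply: (@cvg_bounded_Rintegral _ _ _ P _ _ (C * B)).
  - move=> k.
    exact: (measurableT_comp (tameM (tameM tf (v_l k).1) (tame_expR_dot x)).1 mh).
  - move=> u; rewrite [X in _ --> X]mulrAC.
    under eq_fun do rewrite mulrAC.
    by apply: cvgM; [exact: cvg_cst|apply: v_v => i; exact: hD].
  - by move=> k u; rewrite mulrAC normrM ler_pM// ?fC ?v_B.
have := key _ _ P1 h1 mh1 h1D; under eq_fun do rewrite (v_l _).2//.
by move=> /cvg_unique; apply => //; exact: key.
Qed.

Lemma laplace_multiplier_expR v : laplace_multiplier v ->
  laplace_multiplier (fun t => expR (v t)).
Proof.
move=> vl; have [mv [B vB]] := vl.1.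
apply: (@laplace_multiplier_cvg
  (fun k t => series (exp_coeff (v t)) k) _ (expR B)).
- move=> k; rewrite /series/=; apply: laplace_multiplier_sum => i.
  rewrite /exp_coeff/=; apply: laplace_multiplierM; first exact: laplace_multiplierX.
  exact: laplace_multiplier_cst.
- move=> k x xD; rewrite (le_trans (series_exp_coeff_le_expR _ _))// ler_expR.
  exact: vB.
- exact: measurableT_comp.
- by move=> x _; exact: is_cvg_series_exp_coeff.
Qed.

(** Multiplying by exp(<y, t>) translates the transform from x to y + x; [same_laplace] quantifies
    over all x. *)
Lemma laplace_multiplier_expR_dot y :
  laplace_multiplier (fun t => expR (dotrV y t)).
Proof.
split; first exact: tame_expR_dot.
move=> f tf fl x; rewrite [LHS](_ : _ = 
  \int[P1]_u (f (h1 u) * expR (dotrV (y + x) (h1 u)))); last first.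
  apply: eq_Rintegral => u _; rewrite -mulrA -expRD; congr (_ * expR _).
  by rewrite /dotrV -big_split; apply: eq_bigr => i _; rewrite !mxE mulrDl.
rewrite fl; apply: eq_Rintegral => u _; rewrite -mulrA -expRD.
congr (_ * expR _); rewrite /dotrV -big_split.
by apply: eq_bigr => i _; rewrite !mxE mulrDl.
Qed.

(** A coordinate is the limit of difference quotients of exponentials, dominated on the cube. This
    is differentiation of the transform in direction i. *)
Lemma laplace_multiplier_coord i : laplace_multiplier (fun t => t ord0 i).
Proof.
have key k : laplace_multiplier
    (fun t : E => (expR (t ord0 i * k.+1%:R^-1) + (-1)) * k.+1%:R).
  apply: laplace_multiplierM; last exact: laplace_multiplier_cst.
  apply: laplace_multiplierD; last exact: laplace_multiplier_cst.
  rewrite (_ : (fun _ => _) = fun t => expR (dotrV (k.+1%:R^-1 *: delta_mx ord0 i) t)).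
    exact: laplace_multiplier_expR_dot.
  apply/funext => t; congr expR; rewrite /dotrV (bigD1 i)//= big1 ?addr0.
    by rewrite !mxE !eqxx mulr1 mulrC.
  by move=> j /negbTE ji; rewrite !mxE ji andbF mulr0 mul0r.
apply: (laplace_multiplier_cvg key (B := D * expR D)).
- move=> k x xD; have tD := xD i; have D0 : 0 <= D := le_trans (normr_ge0 _) tD.
  rewrite (le_trans (expR_sub1_quotient_le _ _))//.
  by rewrite ler_pM ?expR_ge0 ?ler_expR.
- exact: measurable_coord.
- by move=> x _; exact: expR_sub1_quotient_cvg.
Qed.

Lemma laplace_multiplier_halfspace i (a : R) :
  laplace_multiplier (\1_[set t : E | t ord0 i <= a]).
Proof.
have key k : laplace_multiplier (fun t : E =>
   expR (-1 * expR (k%:R ^+ 2 * (t ord0 i + - a) + - k%:R))).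
  apply: laplace_multiplier_expR; apply: laplace_multiplierM.
    exact: laplace_multiplier_cst.
  apply: laplace_multiplier_expR; apply: laplace_multiplierD.
    apply: laplace_multiplierM; first exact: laplace_multiplier_cst.
    apply: laplace_multiplierD; last exact: laplace_multiplier_cst.
    exact: laplace_multiplier_coord.
  exact: laplace_multiplier_cst.
apply: (laplace_multiplier_cvg key (B := 1)).
- by move=> k x _; rewrite ger0_norm ?expR_ge0// expR_le1 mulN1r oppr_le0 expR_ge0.
- apply: measurable_indic.
  rewrite (_ : [set _ | _] = (fun t : E => t ord0 i) @^-1` `]-oo, a]).
    by rewrite -[X in measurable X]setTI; exact: measurable_coord.
  by apply/seteqP; split => x /=; rewrite in_itv.
- move=> x _; rewrite indicE (_ : (x \in _) = (x ord0 i <= a)).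
    exact: expR_expR_step.
  by apply/idP/idP; [rewrite inE|move=> xa; rewrite inE].
Qed.

(** The sets whose indicator is a multiplier form a sigma-algebra: products give intersections,
    bounded limits give countable unions. It contains the half-spaces, hence every Borel set. *)
Lemma laplace_multiplier_indic (A : set E) : measurable A ->
  laplace_multiplier (\1_A).
Proof.
pose S : set (set E) := [set A | measurable A /\ laplace_multiplier (\1_A)].
have S0 : S set0.
  split => //; rewrite (_ : \1_set0 = cst 0); first exact: laplace_multiplier_cst.
  by apply/funext => x; rewrite /indic in_set0.
have SC B : S B -> S (~` B).
  move=> [mB SB]; split; first exact: measurableC.
  rewrite (_ : \1_(~` B) = fun t => cst 1 t + \1_B t * cst (-1) t).
    apply: laplace_multiplierD; first exact: laplace_multiplier_cst.
    by apply: laplace_multiplierM => //; exact: laplace_multiplier_cst.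
  apply/funext => x; rewrite /indic in_setC /=; case: (_ \in _) => /=; lra.
have SI B C : S B -> S C -> S (B `&` C).
  move=> [mB SB] [mC SC']; split; first exact: measurableI.
  by rewrite indicI; exact: laplace_multiplierM.
have Sbigcup (F : (set E)^nat) : (forall i, S (F i)) -> S (\bigcup_i F i).
  move=> SF; split; first by apply: bigcup_measurable => k _; exact: (SF k).1.
  have SU k : S (\big[setU/set0]_(i < k) F i).
    apply: (big_ind S S0) => [B C SB SC'|i _]; last exact: SF.
    by rewrite -[_ `|` _]setCK setCU; apply/SC/SI; exact: SC.
  apply: (@laplace_multiplier_cvg (fun k => \1_(\big[setU/set0]_(i < k) F i)) _ 1).
  - by move=> k; exact: (SU k).2.
  - by move=> k x _; rewrite /indic ger0_norm//; case: (_ \in _).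
  - by apply: measurable_indic; apply: bigcup_measurable => k _; exact: (SF k).1.
  - move=> x _; have [[k _ Fkx]|nFx] := pselect ((\bigcup_i F i) x).
      apply: cvg_near_cst; exists k.+1 => // m /= km; rewrite /indic !mem_set//.
        by exists k.
      by rewrite -bigcup_mkord; exists k.
    apply: cvg_near_cst; apply: nearW => m; rewrite /indic !memNset//.
    by rewrite -bigcup_mkord => -[k _ Fkx]; apply: nFx; exists k.
move=> mA.
(* Equipping E with the sigma-algebra S reduces the inclusion of Borel sets in S to measurability of
   the identity, which is checked coordinate by coordinate. *)
have key : measurable_fun [set: g_sigma_algebraType S] (id : g_sigma_algebraType S -> E).
  apply: measurable_rVP => i.
  apply: (measurability _ (measurable_realfun.RGenOInfty.measurableE R)).
  move=> _ [_ [a ->]] <-; rewrite setTI.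
  apply: sub_sigma_algebra.
  rewrite (_ : _ @^-1` _ = ~` [set t : E | t ord0 i <= a]).
    apply: SC; split; last exact: laplace_multiplier_halfspace.
    rewrite (_ : [set _ | _] = (fun t : E => t ord0 i) @^-1` `]-oo, a]).
      by rewrite -[X in measurable X]setTI; exact: measurable_coord.
    by apply/seteqP; split => x /=; rewrite in_itv.
  by apply/seteqP; split => x /=; rewrite in_itv/= andbT ltNge => /negP.
suff : <<s S >> A.
  by rewrite sigma_algebra_id => [[]//|]; split => // B SB; rewrite setTD; exact: SC.
by have := key measurableT _ mA; rewrite setTI preimage_id.
Qed.

(** The multiplier exp(c |t|^2) cancels the weight; multiplying by an indicator as well and taking
    the transform at 0 leaves the probability of A. The case c = 0 is the plain Laplace transform,
    and the weight is a Gaussian factor for mixtures. *)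
Lemma laplace_unique (c : R) :
  same_laplace (fun t => expR (- (c * \sum_i t ord0 i ^+ 2))) ->
  forall A, measurable A -> P1 (h1 @^-1` A) = P2 (h2 @^-1` A).
Proof.
move=> cl A mA; pose q (t : E) := c * \sum_i t ord0 i ^+ 2.
have ql : laplace_multiplier q.
  apply: laplace_multiplierM; first exact: laplace_multiplier_cst.
  apply: laplace_multiplier_sum => i; apply: laplace_multiplierX.
  exact: laplace_multiplier_coord.
have tq : tame (fun t => expR (- q t)).
  apply: tame_expR; rewrite (_ : (fun _ => _) = fun t => (-1) * q t).
    by apply: tameM; [exact: tame_cst|exact: ql.1].
  by apply/funext => t; rewrite mulN1r.
have := (laplace_multiplierM (laplace_multiplier_expR ql) (laplace_multiplier_indic mA)).2
  _ tq cl 0.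
have key d (T : measurableType d) (P : probability T R) (h : T -> E) :
    measurable_fun setT h -> \int[P]_u (expR (- q (h u)) * (expR (q (h u)) * \1_A (h u)) *
       expR (dotrV 0 (h u))) = fine (P (h @^-1` A)).
  move=> mh; rewrite (_ : (fun _ => _) = (fun u => \1_(h @^-1` A) u)); last first.
    apply/funext => u; rewrite /dotrV big1 => [|i _]; last by rewrite mxE mul0r.
    by rewrite expR0 mulr1 mulrA -expRD addNr expR0 mul1r.
  rewrite /Rintegral integral_indic ?setIT//.
  by rewrite -[X in measurable X]setTI; exact: mh.
rewrite (key _ _ P1)// (key _ _ P2)// => E12.
have mA1 : measurable (h1 @^-1` A) by rewrite -[X in measurable X]setTI; exact: mh1.
have mA2 : measurable (h2 @^-1` A) by rewrite -[X in measurable X]setTI; exact: mh2.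
by rewrite -[LHS]fineK ?fin_num_measure// E12 fineK// fin_num_measure.
Qed.

End laplace.

(** * Binary codes of points *)

Section codes.
Context (R : realType) (n : nat).
Local Notation E := 'rV[R]_n.

(* The thresholds [l / (k + 1) - k] are dense in [R]: the code of [x] lists, last
   bit first, on which side of countably many coordinate hyperplanes [x] lies. *)
Definition threshold (k l : nat) : R := l%:R / k.+1%:R - k%:R.

Definition code_bit (j : nat) (x : E) : bool :=
  if (choice.unpickle j : option ('I_n * (nat * nat))) is Some (i, (k, l)) then
    x ord0 i < threshold k l
  else false.

Fixpoint code (k : nat) (x : E) : seq bool :=
  if k is k'.+1 then code_bit k' x :: code k' x else [::].

Lemma size_code k x : size (code k x) = k.
Proof. by elim: k => //= k ->. Qed.

Lemma code_bit_inj k x y j : code k x = code k y -> (j < k)%N ->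
  code_bit j x = code_bit j y.
Proof.
elim: k => // k IH [bk ck]; rewrite ltnS leq_eqVlt => /predU1P[->//|].
exact: IH.
Qed.

Lemma code_leq j k x y : (j <= k)%N -> code k x = code k y -> code j x = code j y.
Proof.
elim: k => [|k IH]; first by rewrite leqn0 => /eqP ->.
by rewrite leq_eqVlt => /predU1P[->//|jk] [_]; exact: IH.
Qed.

(** The thresholds of level k0 lie 1 / (k0 + 1) < e apart and, since k0 > D, cover the cube. If two
    coordinates differ by more than e, the first threshold above the smaller one separates them. *)
Lemma code_separates (D e : R) : 0 < e -> exists k, forall x y : E,
  (forall i, `|x ord0 i| <= D) -> (forall i, `|y ord0 i| <= D) ->
  code k x = code k y -> forall i, `|x ord0 i - y ord0 i| <= e.
Proof.
move=> e0; pose k0 := maxn (Num.truncn D).+1 (Num.truncn e^-1).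
have k0D : D < k0%:R.
  by rewrite (lt_le_trans (truncnS_gt D))// ler_nat leq_max leqnn.
have k0e : k0.+1%:R^-1 < e.
  rewrite invf_plt ?posrE// (lt_le_trans (truncnS_gt _))// ler_nat ltnS.
  by rewrite leq_max leqnn orbT.
(* The index l used below is at most 2 k0 (k0 + 1) + 1, because u_i + k0 <= 2 k0. *)
pose L := (k0 * 2 * k0.+1).+1.
exists (\max_(i < n) \max_(l < L.+1) (choice.pickle (i, (k0, val l))).+1) => x y xD yD cxy.
suff key (u v : E) : (forall i, `|u ord0 i| <= D) ->
    code (\max_(i < n) \max_(l < L.+1) (choice.pickle (i, (k0, val l))).+1) u =
    code (\max_(i < n) \max_(l < L.+1) (choice.pickle (i, (k0, val l))).+1) v ->
    forall i, v ord0 i <= u ord0 i + e.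
  by move=> i; rewrite ler_distl lerBlDr (key x y xD cxy) (key y x yD (esym cxy)).
move=> {x y xD yD cxy} uD cuv i; rewrite leNgt; apply/negP => uv.
have uk : - k0%:R < u ord0 i < k0%:R.
  by rewrite -ltr_norml (le_lt_trans (uD i)).
have uk0 : 0 <= (u ord0 i + k0%:R) * k0.+1%:R.
  by rewrite mulr_ge0// -lerBlDr sub0r ltW//; case/andP: uk.
pose l := (Num.truncn ((u ord0 i + k0%:R) * k0.+1%:R)).+1.
have /andP[l1 l2] := truncn_itv uk0; rewrite -/l in l2.
have ul : u ord0 i < threshold k0 l.
  by rewrite /threshold ltrBrDr ltr_pdivlMr.
have lv : threshold k0 l <= v ord0 i.
  rewrite /threshold lerBlDr ler_pdivrMr// /l -natr1.
  apply: le_trans (_ : (u ord0 i + k0%:R) * k0.+1%:R + 1 <= _); first by rewrite lerD2r.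
  rewrite -[X in _ + X](@mulVf _ k0.+1%:R) ?gt_eqF// -mulrDl ler_wpM2r// addrAC lerD2r.
  by rewrite ltW// (lt_trans _ uv)// ltrD2l.
have lL : (l < L.+1)%N.
  rewrite ltnS /l /L ltnS -(ler_nat R) (le_trans l1)// natrM ler_wpM2r//.
  by rewrite natrM mulr_natr mulr2n lerD2r; case/andP: uk => _ /ltW.
have := @code_bit_inj _ u v (choice.pickle (i, (k0, l))) cuv.
have -> : (choice.pickle (i, (k0, l)) <
    \max_(i < n) \max_(l < L.+1) (choice.pickle (i, (k0, val l))).+1)%N.
  apply: leq_trans (leq_bigmax i).
  exact: (leq_bigmax (Ordinal lL)).
rewrite /code_bit choice.pickleK => /(_ isT); rewrite ul => /esym.
by rewrite ltNge lv.
Qed.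

End codes.

Section countable_valued.
Context d (T : measurableType d) (C : countType).
Implicit Type g : T -> C.

Lemma measurable_countable_preimage g : (forall c, measurable (g @^-1` [set c])) ->
  forall A : set C, measurable (g @^-1` A).
Proof.
move=> mg A; rewrite (_ : _ @^-1` _ = \bigcup_(c in A) (g @^-1` [set c])).
  rewrite bigcup_mkcond; apply: countable_bigcupT_measurable; first exact: countableP.
  by move=> c; case: ifPn.
by apply/seteqP; split => [t At|t [c Ac /= ->]]//; exists (g t).
Qed.

Lemma measurable_fun_countable d' (U : measurableType d') g (F : C -> U) :
  (forall c, measurable (g @^-1` [set c])) -> measurable_fun setT (F \o g).
Proof.
move=> mg _ B mB; rewrite setTI comp_preimage.
exact: measurable_countable_preimage.
Qed.

End countable_valued.

(** Both integrals split along level sets, numbered by [pickle], into the same series; numbers that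
    encode no value contribute 0. *)
Lemma Rintegral_countable_eq (R : realType) (C : countType)
    d1 (T1 : measurableType d1) (P1 : {measure set T1 -> \bar R}) (g1 : T1 -> C)
    d2 (T2 : measurableType d2) (P2 : {measure set T2 -> \bar R}) (g2 : T2 -> C)
    (F : C -> R) :
  (forall c, measurable (g1 @^-1` [set c])) ->
  (forall c, measurable (g2 @^-1` [set c])) ->
  (forall c, P1 (g1 @^-1` [set c]) = P2 (g2 @^-1` [set c])) ->
  (forall c, 0 <= F c) ->
  \int[P1]_u F (g1 u) = \int[P2]_u F (g2 u).
Proof.
move=> mg1 mg2 P12 F0.
have key d (T : measurableType d) (P : {measure set T -> \bar R}) (g : T -> C) :
    (forall c, measurable (g @^-1` [set c])) -> 
    (\int[P]_u (F (g u))%:E = \sum_(k <oo)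
      oapp (fun c => (F c)%:E * P (g @^-1` [set c])) 0 (@choice.pickle_inv C k))%E.
  move=> mg; pose A k := [set u | @choice.pickle_inv C k = Some (g u)].
  have mA k : measurable (A k).
    rewrite /A; case: (@choice.pickle_inv C k) => [c|].
      rewrite (_ : [set _ | _] = g @^-1` [set c])//.
      by apply/seteqP; split => u /= [->].
    by rewrite (_ : [set _ | _] = set0)//; apply/seteqP; split.
  have bA : \bigcup_k A k = setT.
    apply/seteqP; split => // u _; exists (choice.pickle (g u)) => //.
    exact: choice.pickleK_inv.
  rewrite -bA ge0_integral_bigcup//; last 3 first.
  - by apply/measurable_EFinP; apply: measurable_funTS; exact: measurable_fun_countable.
  - by move=> u _; rewrite lee_fin.
  - apply/trivIsetP => i j _ _ ij; apply/seteqP; split => // u [/= iu ju].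
    move/eqP : ij; apply.
    have := @choice.pickle_invK C i; rewrite iu /=.
    by have := @choice.pickle_invK C j; rewrite ju /= => <- <-.
  apply: eq_eseriesr => k _; have := mA k; rewrite /A.
  case: (@choice.pickle_inv C k) => [c|] /= mAk.
    rewrite (eq_integral (fun=> (F c)%:E)); last by move=> u; rewrite inE => -[->].
    rewrite integral_cst//; congr (_ * P _)%E.
    by apply/seteqP; split => u /= [->].
  by rewrite (_ : [set _ | _] = set0) ?integral_set0//; apply/seteqP; split.
rewrite /Rintegral (key _ _ P1)// (key _ _ P2)//; congr fine.
by apply: eq_eseriesr => k _; case: (@choice.pickle_inv C k) => //= c; rewrite P12.
Qed.

(** * Laws on a compact set as images of the uniform law *)

Lemma measure_bigsetU_le d (T : measurableType d) (R : realType)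
    (mu : {measure set T -> \bar R}) I (s : seq I) (F : I -> set T) :
  (forall i, measurable (F i)) ->
  (mu (\big[setU/set0]_(i <- s) F i) <= \sum_(i <- s) mu (F i))%E.
Proof.
move=> mF; elim: s => [|i s IH]; first by rewrite !big_nil measure0.
rewrite !big_cons (le_trans (measureU2 _ _ _))//; last exact: leeD2l.
exact: bigsetU_measurable.
Qed.

(** * The uniform law on the unit interval *)

Section unit_interval.
Context (R : realType).

Definition unit_prob : probability (measurableTypeR R) R := uniform_prob (@ltr01 R).

(** The uniform law is a measure on the whole line. Clipping puts every u into [0, 1[, so facts
    about paths hold for all u; the values it changes have probability 0. *)
Definition clip01 (u : R) : R := if 0 <= u < 1 then u else 0.

Lemma clip01_itv u : 0 <= clip01 u < 1.
Proof. by rewrite /clip01; case: ifPn => // _; rewrite lexx ltr01. Qed.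

Lemma measurable_clip01 : measurable_fun setT clip01.
Proof.
apply: measurable_fun_ifT => //.
by apply: measurable_and; [exact: measurable_fun_ler|exact: measurable_fun_ltr].
Qed.

Lemma measurable_clip01_itv (a b : R) : measurable [set u | a <= clip01 u < b].
Proof.
rewrite (_ : [set _ | _] = clip01 @^-1` `[a, b[).
  by rewrite -[X in measurable X]setTI; exact: measurable_clip01.
by apply/seteqP; split => u /=; rewrite in_itv.
Qed.

Lemma unit_probE (A : set R) : measurable A ->
  unit_prob A = lebesgue_measure (A `&` `[0, 1]).
Proof.
move=> mA; transitivity (\int[lebesgue_measure]_(x in A) (uniform_pdf 0 1 x)%:E)%E => //.
rewrite integral_uniform_pdf.
rewrite (eq_integral (fun=> 1%E)) ?integral_cst ?mul1e//; first exact: measurableI.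
move=> u; rewrite inE => -[_ /=]; rewrite in_itv/= => u01.
by rewrite /uniform_pdf u01 subr0 invr1.
Qed.

Lemma unit_prob_clip_le (a b : R) : a <= b ->
  (unit_prob [set u | (a <= clip01 u < b)%R] <= (b - a)%:E)%E.
Proof.
move=> ab; have mA := measurable_clip01_itv a b; rewrite unit_probE//.
(* Within [0, 1], clipping moves only the point 1, hence the extra singleton. *)
apply: le_trans (_ : lebesgue_measure (`[a, b[ `|` [set 1%R]) <= _)%E.
  apply: le_measure; rewrite ?inE.
  - exact: measurableI.
  - exact: measurableU.
  - move=> u [/=]; rewrite /clip01 !in_itv/= => + /andP[u0 u1].
    rewrite u0 /=; case: ltP => [_|u1']; first by left.
    by move=> _; right; apply/eqP; rewrite eq_le u1.
apply: le_trans (measureU2 _ _ _) _ => //.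
rewrite [X in (_ + X)%E]lebesgue_measure_set1 adde0.
rewrite [X in (X <= _)%E]lebesgue_measure_itv/= lte_fin.
by case: ltP => // _; rewrite ?EFinB// lee_fin subr_ge0.
Qed.

Lemma unit_prob_clip (a b : R) : 0 <= a -> a <= b -> b <= 1 ->
  unit_prob [set u | a <= clip01 u < b] = (b - a)%:E.
Proof.
move=> a0 ab b1; apply/eqP; rewrite eq_le unit_prob_clip_le//=.
have mA := measurable_clip01_itv a b; rewrite unit_probE//.
apply: le_trans (_ : lebesgue_measure `[a, b[ <= _)%E.
  rewrite lebesgue_measure_itv/= lte_fin.
  by case: ltP => [_|ba]; rewrite -?EFinB// lee_fin subr_le0.
apply: le_measure; rewrite ?inE//; first exact: measurableI.
move=> u /=; rewrite !in_itv/= => /andP[au ub].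
have u0 := le_trans a0 au; have u1 := lt_le_trans ub b1.
by rewrite /clip01 u0 u1/= au ub (ltW u1).
Qed.

End unit_interval.

(** * Mass systems, their paths and their maps *)

Section mass_system.
Context (R : realType) (n : nat).
Local Notation E := 'rV[R]_n.
Context (Theta : set E).

(* The masses given by a law carried by [Theta] to the cells [code (size w) @^-1` [set w]]. *)
Definition mass_system (m : seq bool -> R) :=
  [/\ m [::] = 1, forall w, 0 <= m w,
      forall w, m w = m (false :: w) + m (true :: w) &
      forall w, 0 < m w -> exists2 x, Theta x & code (size w) x = w].

(* The word [w] owns the interval [[left_end m w, left_end m w + m w[]; the
   interval of [w] is cut into those of [false :: w] and [true :: w]. *)
Fixpoint left_end (m : seq bool -> R) (w : seq bool) : R :=
  if w is b :: w' then left_end m w' + (if b then m (false :: w') else 0) else 0.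

Fixpoint path_word (m : seq bool -> R) (k : nat) (u : R) : seq bool :=
  if k is k'.+1 then
    let w := path_word m k' u in
    (left_end m w + m (false :: w) <= clip01 u) :: w
  else [::].

Lemma size_path_word m k u : size (path_word m k u) = k.
Proof. by elim: k => //= k ->. Qed.

Lemma measurable_path_word m k w : measurable (path_word m k @^-1` [set w]).
Proof.
elim: k w => [|k IH] w /=.
  case: w => [|b w]; last by rewrite (_ : _ @^-1` _ = set0)//; apply/seteqP; split.
  by rewrite (_ : _ @^-1` _ = setT)//; apply/seteqP; split.
case: w => [|b w]; first by rewrite (_ : _ @^-1` _ = set0)//; apply/seteqP; split.
rewrite (_ : _ @^-1` _ = (path_word m k @^-1` [set w]) `&`
    ((fun u => left_end m w + m (false :: w) <= clip01 u) @^-1` [set b])).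
  apply: measurableI; first exact: IH.
  rewrite -[X in measurable X]setTI; apply: measurable_fun_ler => //.
  exact: measurable_clip01.
by apply/seteqP; split => u /= => [[<- <-]//|[-> ->]].
Qed.

(** Each letter adds at most one mass to the left end, so the error grows linearly with the
    length. *)
Lemma left_end_close m1 m2 (dl : R) w :
  (forall v, (size v <= size w)%N -> `|m1 v - m2 v| <= dl) ->
  `|left_end m1 w - left_end m2 w| <= (size w)%:R * dl.
Proof.
elim: w => [|b w IH] mw /=; first by rewrite subrr normr0 mul0r.
have dl0 : 0 <= dl by apply: le_trans (mw [::] _).
rewrite opprD addrACA (le_trans (ler_normD _ _))// -natr1 mulrDl mul1r lerD//.
  by apply: IH => v vw; rewrite mw// ltnW.
by case: b mw => mw; [exact: mw|rewrite subrr normr0].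
Qed.

Section one_mass_system.
Context (m : seq bool -> R) (mm : mass_system m).

Lemma path_word_itv k u : let w := path_word m k u in
  left_end m w <= clip01 u < left_end m w + m w.
Proof.
have [m0 m1 mD _] := mm.
elim: k => [|k] /=; first by rewrite m0 add0r clip01_itv.
set w := path_word m k u; rewrite (mD w) => /andP[h1 h2].
case: (leP (left_end m w + m (false :: w))) => h /=; last by rewrite addr0 h h1.
by rewrite h -addrA.
Qed.

Lemma itv_path_word w u : left_end m w <= clip01 u < left_end m w + m w ->
  path_word m (size w) u = w.
Proof.
have [_ m1 mD _] := mm.
elim: w => //= b w IH /andP[h1 h2].
rewrite IH; last first.
  rewrite (mD w) (le_trans _ h1) /=; last by rewrite lerDl; case: b {h1 h2}.
  rewrite (lt_le_trans h2)// -addrA lerD2l.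
  by case: b {h1 h2} => //; rewrite add0r lerDl.
congr cons; case: b h1 h2 => [h1 _|]; first exact/idP.
by rewrite addr0 => _; rewrite leNgt => ->.
Qed.

Lemma path_word_preimage w :
  path_word m (size w) @^-1` [set w] =
  [set u | left_end m w <= clip01 u < left_end m w + m w].
Proof.
apply/seteqP; split => u /=; last exact: itv_path_word.
by move=> wu; have := path_word_itv (size w) u; rewrite wu.
Qed.

Lemma left_end_ge0 w : 0 <= left_end m w.
Proof.
have [_ m1 _ _] := mm.
by elim: w => //= b w IH; rewrite addr_ge0//; case: b.
Qed.

Lemma right_end_le1 w : left_end m w + m w <= 1.
Proof.
have [m0 m1 mD _] := mm.
elim: w => [|b w IH] /=; first by rewrite m0 add0r.
apply: le_trans IH; rewrite (mD w) -addrA lerD2l.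
by case: b => //; rewrite add0r lerDl.
Qed.

Lemma unit_prob_path_word w :
  unit_prob R (path_word m (size w) @^-1` [set w]) = (m w)%:E.
Proof.
have [_ m1 _ _] := mm.
rewrite path_word_preimage unit_prob_clip ?left_end_ge0 ?right_end_le1 ?lerDl//.
by rewrite addrAC subrr add0r.
Qed.

(** The interval of the path contains [clip01 u], so the word has positive mass and the last clause
    of [mass_system] applies. *)
Lemma path_word_nonempty k u :
  exists2 x, Theta x & code k x = path_word m k u.
Proof.
have [_ _ _ mT] := mm.
have := path_word_itv k u => /= /andP[h1 h2].
have [|x Tx] := mT (path_word m k u).
  by have := le_lt_trans h1 h2; rewrite ltrDl.
by rewrite size_path_word; exists x.
Qed.

End one_mass_system.

Lemma measurable_path_word_neq m1 m2 j :
  measurable [set u | path_word m1 j u != path_word m2 j u].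
Proof.
rewrite (_ : [set _ | _] = (fun u => (path_word m1 j u, path_word m2 j u)) @^-1`
  [set p | p.1 != p.2])//.
apply: measurable_countable_preimage => -[v1 v2].
rewrite (_ : _ @^-1` _ = path_word m1 j @^-1` [set v1] `&` path_word m2 j @^-1` [set v2]).
  by apply: measurableI; exact: measurable_path_word.
by apply/seteqP; split => u /= [-> ->].
Qed.

(** Two paths that agree down to depth k part at the next step only if [clip01 u] lies between their
    two splitting points, which are at most (k + 1) dl apart. Summing over the words of length k
    adds 2^k (k + 1) to the constant. *)
Lemma unit_prob_path_word_neq k : exists C : R, forall m1 m2 (dl : R),
  mass_system m1 -> mass_system m2 ->
  (forall w, (size w <= k)%N -> `|m1 w - m2 w| <= dl) ->
  (unit_prob R [set u | path_word m1 k u != path_word m2 k u] <= (C * dl)%:E)%E.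
Proof.
elim: k => [|k [C IH]].
  exists 0 => m1 m2 dl _ _ _; rewrite (_ : [set _ | _] = set0) ?measure0 ?mul0r//.
  by apply/seteqP; split => u /=.
exists (C + \sum_(w : k.-tuple bool) (k.+1)%:R) => m1 m2 dl mm1 mm2 m12.
pose c m w := left_end m w + m (false :: w).
pose B (w : k.-tuple bool) :=
  [set u | Num.min (c m1 w) (c m2 w) <= clip01 u < Num.max (c m1 w) (c m2 w)].
have mB w : measurable (B w) by exact: measurable_clip01_itv.
have mN := @measurable_path_word_neq m1 m2.
have mBig : measurable (\big[setU/set0]_(w : k.-tuple bool) B w).
  exact: bigsetU_measurable.
apply: (@le_trans _ _ (unit_prob R ([set u | path_word m1 k u != path_word m2 k u] `|`
   \big[setU/set0]_(w : k.-tuple bool) B w))).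
  have mU := measurableU _ _ (mN k) mBig.
  apply: le_measure; [by rewrite inE; exact: mN|by rewrite inE|].
  move=> u /=; have [e12|] := eqVneq (path_word m1 k u) (path_word m2 k u); last by left.
  rewrite eqseq_cons e12 eqxx andbT => N12; right.
  have sw : size (path_word m2 k u) == k by rewrite size_path_word.
  rewrite -bigcup_pred; exists (Tuple sw) => //=.
  rewrite /B /c /= -e12 {2 4}e12; move: N12; rewrite e12.
  set a := _ + _; set b := _ + _ => N12.
  rewrite ge_min lt_max; move: N12.
  by case: (leP a) => ha; case: (leP b) => hb //= _; rewrite ?orbT.
apply: (le_trans (measureU2 (unit_prob R) (mN k) mBig)).
rewrite mulrDl EFinD leeD//.
  by apply: IH => // w wk; apply: m12; rewrite leqW.
apply: (le_trans (measure_bigsetU_le (unit_prob R) _ mB)).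
apply: (@le_trans _ _ (\sum_(w : k.-tuple bool) (k.+1%:R * dl)%:E)%E).
  apply: lee_sum => w _; apply: le_trans (unit_prob_clip_le _) _.
    by rewrite ge_min le_max lexx.
  rewrite lee_fin.
  have -> : Num.max (c m1 w) (c m2 w) - Num.min (c m1 w) (c m2 w) = `|c m1 w - c m2 w|.
    by case: (leP (c m1 w)) => h; [rewrite distrC ger0_norm|rewrite gtr0_norm];
      rewrite ?subr_ge0 ?subr_gt0.
  rewrite /c opprD addrACA (le_trans (ler_normD _ _))// -natr1 mulrDl mul1r lerD//.
    have := @left_end_close m1 m2 dl w; rewrite size_tuple; apply => v vw.
    by apply: m12; rewrite leqW.
  by apply: m12; rewrite /= size_tuple.
by rewrite sumEFin lee_fin mulr_suml.
Qed.

Section skorokhod.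
Context (Theta_compact : compact Theta) (Theta_nonempty : Theta !=set0).

(** When the cell of w misses Theta, the default is a point of Theta, so that approximants always
    stay in Theta. *)
Definition cell_point (w : seq bool) : E :=
  xget (xget 0 Theta) [set x | Theta x /\ code (size w) x = w].

Definition skorokhod (m : seq bool -> R) (u : R) : E :=
  \row_i limn (fun k => cell_point (path_word m k u) ord0 i).

Lemma Theta_closed : closed Theta.
Proof. by apply: compact_closed => //; exact: norm_hausdorff. Qed.

Lemma measurable_Theta : measurable Theta.
Proof.
rewrite -(setCK Theta); apply: measurableC; apply: open_measurable_rV.
by rewrite openC; exact: Theta_closed.
Qed.

Lemma Theta_bounded : exists D : R, forall x, Theta x -> forall i, `|x ord0 i| <= D.
Proof.
have [M [_ MT]] := compact_bounded Theta_compact.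
exists (M + 1) => x Tx i; apply: le_trans (_ : `|x| <= _).
  by rewrite /Num.norm/= mx_normrE; apply: le_bigmax (ord0, i).
by apply: MT => //; rewrite ltrDl.
Qed.

Lemma cell_point_Theta w : Theta (cell_point w).
Proof.
rewrite /cell_point; case: xgetP => [x _ [] //|_].
by apply: xgetPex; case: Theta_nonempty => x; exists x.
Qed.

Lemma code_cell_point m k u : mass_system m ->
  code k (cell_point (path_word m k u)) = path_word m k u.
Proof.
move=> mm; have [x Tx xk] := path_word_nonempty mm k u.
rewrite /cell_point; case: xgetP => [y _ []|/(_ x)]; rewrite size_path_word//.
by case.
Qed.

Lemma code_path_word_leq m j k u (x : E) : (j <= k)%N ->
  code k x = path_word m k u -> code j x = path_word m j u.
Proof.
elim: k => [|k IH]; first by rewrite leqn0 => /eqP ->.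
by rewrite leq_eqVlt => /predU1P[->//|jk] [_]; exact: IH.
Qed.

Lemma code_path_word_close (e : R) : 0 < e -> exists k, forall m x u,
  mass_system m -> Theta x -> code k x = path_word m k u ->
  forall i, `|x ord0 i - cell_point (path_word m k u) ord0 i| <= e.
Proof.
move=> e0; have [D DT] := Theta_bounded; have [k kP] := @code_separates R n D e e0.
exists k => m x u mm Tx xu i; apply: kP; first exact: DT.
  by apply: DT; exact: cell_point_Theta.
by rewrite xu code_cell_point.
Qed.

(** Representatives of deeper cells on the same path share the earlier bits, so by [code_separates]
    they form a Cauchy sequence. *)
Lemma cvg_skorokhod m u i : mass_system m ->
  cell_point (path_word m k u) ord0 i @[k --> \oo] --> skorokhod m u ord0 i.
Proof.
move=> mm; rewrite mxE; apply: cauchy_cvg; apply: cauchy_exP => e /= e0.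
have [k kP] := @code_path_word_close _ (divr_gt0 e0 (ltr0n _ 2)).
exists (cell_point (path_word m k u) ord0 i); exists k => // j /= kj.
rewrite /ball/= distrC (le_lt_trans (kP m _ u mm _ _ i))//.
- exact: cell_point_Theta.
- by apply: code_path_word_leq kj _; exact: code_cell_point.
- by rewrite ltr_pdivrMr// ltr_pMr// ltr1n.
Qed.

Lemma skorokhod_close (e : R) : 0 < e -> exists k, forall m u i, mass_system m ->
  `|skorokhod m u ord0 i - cell_point (path_word m k u) ord0 i| <= e.
Proof.
move=> e0; have [k kP] := @code_path_word_close _ e0; exists k => m u i mm.
set c := cell_point (path_word m k u) ord0 i.
have cv : `|cell_point (path_word m j u) ord0 i - c| @[j --> \oo] -->
    `|skorokhod m u ord0 i - c|.
  by apply: cvg_norm; apply: cvgB; [exact: cvg_skorokhod|exact: cvg_cst].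
apply: cvgr_to_le cv _; exists k => // j /= kj.
apply: kP => //; first exact: cell_point_Theta.
by apply: code_path_word_leq kj _; exact: code_cell_point.
Qed.

Lemma skorokhod_Theta m u : mass_system m -> Theta (skorokhod m u).
Proof.
move=> mm; apply: Theta_closed.
move=> B /nbhs_ballP[e /= e0 eB]; have [k kP] := @skorokhod_close _ (divr_gt0 e0 (ltr0n _ 2)).
exists (cell_point (path_word m k u)); split; first exact: cell_point_Theta.
apply: eB; split => // i j; rewrite ord1 /ball/= (le_lt_trans (kP _ _ _ _))//.
by rewrite ltr_pdivrMr// ltr_pMr// ltr1n.
Qed.

Lemma measurable_skorokhod m : mass_system m ->
  measurable_fun [set: measurableTypeR R] (skorokhod m).
Proof.
move=> mm; apply: measurable_rVP => i.
apply: (@measurable_fun_cvg _ _ _ _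
  (fun k u => cell_point (path_word m k u) ord0 i)) => [k|u _].
  apply: (@measurable_fun_countable _ (measurableTypeR R) _ _ _ (path_word m k)
    (fun w => cell_point w ord0 i)).
  exact: measurable_path_word.
exact: cvg_skorokhod.
Qed.

(** Where the paths agree down to depth k, both maps are within e / 2 of the same cell point. The
    depth comes from [skorokhod_close] and does not depend on the mass systems. *)
Lemma skorokhod_unif_close (e : R) : 0 < e -> exists k, exists2 dl : R, 0 < dl &
  forall m1 m2, mass_system m1 -> mass_system m2 ->
  (forall w, (size w <= k)%N -> `|m1 w - m2 w| <= dl) ->
  exists2 B, measurable B /\ (unit_prob R B <= e%:E)%E &
    forall u, ~ B u -> forall i, `|skorokhod m1 u ord0 i - skorokhod m2 u ord0 i| <= e.
Proof.
move=> e0; have [k kP] := @skorokhod_close _ (divr_gt0 e0 (ltr0n _ 2)).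
have [C CP] := unit_prob_path_word_neq k.
(* With this choice C dl <= e, whatever the sign of C. *)
exists k, (e / (`|C| + 1)); first by rewrite divr_gt0// ltr_wpDl.
move=> m1 m2 mm1 mm2 m12.
exists [set u | path_word m1 k u != path_word m2 k u]; first split.
- exact: measurable_path_word_neq.
- apply: le_trans (CP _ _ _ mm1 mm2 m12) _; rewrite lee_fin mulrCA ler_piMr//; first exact: ltW.
  rewrite ler_pdivrMr ?mul1r ?ltr_wpDl//.
  by rewrite (le_trans (ler_norm _))// lerDl.
- move=> u /= /negP; rewrite negbK => /eqP e12 i.
  rewrite (le_trans (ler_distD (cell_point (path_word m1 k u) ord0 i) _ _))//.
  rewrite [leRHS]splitr lerD ?kP// distrC e12; exact: kP.
Qed.

End skorokhod.
End mass_system.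

(** * Every law on Theta is represented by its cell masses *)

Section representation.
Context (R : realType) (n : nat).
Local Notation E := 'rV[R]_n.
Context (Theta : set E) (Theta_compact : compact Theta) (Theta_nonempty : Theta !=set0).

Lemma measurable_code k w : measurable (@code R n k @^-1` [set w]).
Proof.
elim: k w => [|k IH] w /=.
  case: w => [|b w]; last by rewrite (_ : _ @^-1` _ = set0)//; apply/seteqP; split.
  by rewrite (_ : _ @^-1` _ = setT)//; apply/seteqP; split.
case: w => [|b w]; first by rewrite (_ : _ @^-1` _ = set0)//; apply/seteqP; split.
rewrite (_ : _ @^-1` _ = (code k @^-1` [set w]) `&` (code_bit k @^-1` [set b])).
  apply: measurableI; first exact: IH.
  rewrite -[X in measurable X]setTI; rewrite /code_bit.
  have : measurable_fun setT (@code_bit R n k).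
    rewrite /code_bit; case: (choice.unpickle k) => [[i [j l]]|]; last exact: measurable_cst.
    by apply: measurable_fun_ltr => //; exact: measurable_coord.
  exact.
by apply/seteqP; split => u /= => [[<- <-]//|[-> ->]].
Qed.

Section one_random_vector.
Context d (T : measurableType d) (P : probability T R) (h : T -> E).
Hypotheses (mh : measurable_fun setT h) (hT : forall t, Theta (h t)).

Definition cell_mass (w : seq bool) : R :=
  fine (P ((fun t => code (size w) (h t)) @^-1` [set w])).

Let mcell k w : measurable ((fun t => code k (h t)) @^-1` [set w]).
Proof.
rewrite (_ : _ @^-1` _ = h @^-1` (code k @^-1` [set w]))//.
by rewrite -[X in measurable X]setTI; apply: mh => //; exact: measurable_code.
Qed.

Let cell_massE w : (cell_mass w)%:E = P ((fun t => code (size w) (h t)) @^-1` [set w]).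
Proof. by rewrite fineK// fin_num_measure. Qed.

Lemma mass_system_cell_mass : mass_system Theta cell_mass.
Proof.
split.
- apply/EFin_inj; rewrite cell_massE /= (_ : _ @^-1` _ = setT) ?probability_setT//.
  by apply/seteqP; split.
- by move=> w; rewrite -lee_fin cell_massE.
- move=> w; apply/EFin_inj; rewrite EFinD !cell_massE -measureU;
    [|exact: (mcell (size w).+1)|exact: (mcell (size w).+1)|]; last first.
    by apply/seteqP; split => // t /= [[-> _] []].
  congr (P _); apply/seteqP; split => t /=.
    by move=> ->; case: (code_bit _ _); [right|left].
  by move=> [|] [].
- move=> w w0; apply: contrapT => H.
  suff : cell_mass w = 0 by move=> w0'; rewrite w0' ltxx in w0.
  apply/EFin_inj; rewrite cell_massE (_ : _ @^-1` _ = set0) ?measure0//.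
  by apply/seteqP; split => // t /= tw; apply: H; exists (h t).
Qed.

Let mm := mass_system_cell_mass.

Lemma cell_mass_law w k : P ((fun t => code k (h t)) @^-1` [set w]) =
  unit_prob R (path_word cell_mass k @^-1` [set w]).
Proof.
have [<-|wk] := eqVneq (size w) k.
  by rewrite (unit_prob_path_word mm) cell_massE.
rewrite (_ : _ @^-1` _ = set0); last first.
  by apply/seteqP; split => // t /= tw; move: wk; rewrite -tw size_code eqxx.
rewrite (_ : path_word _ _ @^-1` _ = set0) ?measure0//.
by apply/seteqP; split => // t /= tw; move: wk; rewrite -tw size_path_word eqxx.
Qed.

Lemma cvg_cell_point_code t i :
  cell_point Theta (code k (h t)) ord0 i @[k --> \oo] --> h t ord0 i.
Proof.
have [D DT] := Theta_bounded Theta_compact.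
apply/cvgrPdist_le => e e0; have [k kP] := @code_separates R n D e e0.
exists k => // j /= kj.
have codej : code j (cell_point Theta (code j (h t))) = code j (h t).
  rewrite /cell_point; case: xgetP => [y _ []|/(_ (h t))]; rewrite size_code//.
  by case.
apply: kP; [exact: DT|by apply: DT; exact: cell_point_Theta|].
by apply: (code_leq kj); rewrite codej.
Qed.

(** At each depth the discretizations of h and of the map have equal laws, since words have equal
    probabilities. Their Laplace transforms agree, the limits agree by dominated convergence, and
    uniqueness with c = 0 concludes. *)
Lemma cell_mass_representation A : measurable A ->
  P (h @^-1` A) = unit_prob R (skorokhod Theta cell_mass @^-1` A).
Proof.
have [D DT] := Theta_bounded Theta_compact.
have sT u := skorokhod_Theta Theta_compact Theta_nonempty u mm.
move=> mA; apply: (@laplace_unique R n _ T P h _ (measurableTypeR R) (unit_prob R)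
  (skorokhod Theta cell_mass) D _ _ _ _ 0) => //.
- exact: measurable_skorokhod.
- by move=> t i; exact: DT.
- by move=> t i; exact: DT.
move=> x.
under eq_Rintegral do rewrite mul0r oppr0 expR0 mul1r.
under [RHS]eq_Rintegral do rewrite mul0r oppr0 expR0 mul1r.
have [B eB] := bounded_on_cube_expR (bounded_on_cube_dot D x).
have PU k : \int[P]_t expR (dotrV x (cell_point Theta (code k (h t)))) =
    \int[unit_prob R]_u expR (dotrV x (cell_point Theta (path_word cell_mass k u))).
  apply: (@Rintegral_countable_eq _ _ _ _ P _ _ (measurableTypeR R) (unit_prob R) _
    (fun w => expR (dotrV x (cell_point Theta w)))).
  - by move=> w; exact: mcell.
  - by move=> w; exact: measurable_path_word.
  - by move=> w; exact: cell_mass_law.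
  - by move=> w; exact: expR_ge0.
have c1 : \int[P]_t expR (dotrV x (cell_point Theta (code k (h t)))) @[k --> \oo] -->
    \int[P]_t expR (dotrV x (h t)).
  apply: (@cvg_bounded_Rintegral _ _ _ P _ _ B).
  - move=> k; apply: (@measurable_fun_countable _ _ _ _ _ (fun t => code k (h t))
      (fun w => expR (dotrV x (cell_point Theta w)))).
    by move=> w; exact: mcell.
  - move=> t; apply: continuous_cvg; first exact: continuous_expR.
    apply: cvg_sumr => i; apply: cvgM; first exact: cvg_cst.
    exact: cvg_cell_point_code.
  - by move=> k t; apply: eB => i; apply: DT; exact: cell_point_Theta.
have c2 : \int[unit_prob R]_u expR (dotrV x (cell_point Theta (path_word cell_mass k u)))
    @[k --> \oo] --> \int[unit_prob R]_t expR (dotrV x (skorokhod Theta cell_mass t)).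
  apply: (@cvg_bounded_Rintegral _ _ _ (unit_prob R) _ _ B).
  - move=> k; apply: (@measurable_fun_countable _ (measurableTypeR R) _ _ _
      (path_word cell_mass k) (fun w => expR (dotrV x (cell_point Theta w)))).
    by move=> w; exact: measurable_path_word.
  - move=> t; apply: continuous_cvg; first exact: continuous_expR.
    apply: cvg_sumr => i; apply: cvgM; first exact: cvg_cst.
    exact: cvg_skorokhod.
  - by move=> k t; apply: eB => i; apply: DT; exact: cell_point_Theta.
by move: c1; under eq_fun do rewrite PU; move=> /cvg_unique; apply => //; exact: c2.
Qed.

End one_random_vector.

Lemma supported_representation (G : probability E R) : supported_on Theta G ->
  exists2 m, mass_system Theta m & forall A, measurable A ->
    G A = unit_prob R (skorokhod Theta m @^-1` A).
Proof.
move=> GT; have [th Tth] := Theta_nonempty.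
have mT := measurable_Theta Theta_compact.
(* The representation wants a vector with all its values in Theta; r agrees with the identity off a
   G-null set. *)
pose r (x : E) := if x \in Theta then x else th.
have mr : measurable_fun setT r.
  apply: measurable_fun_ifT => //.
  by apply: (measurable_fun_bool true); rewrite setTI (_ : _ @^-1` _ = Theta)//;
    apply/seteqP; split => x /=; [exact: set_mem|exact: mem_set].
have rT x : Theta (r x) by rewrite /r; case: ifPn => //; rewrite inE.
exists (cell_mass G r); first exact: mass_system_cell_mass.
move=> A mA; rewrite -cell_mass_representation//.
have mrA : measurable (r @^-1` A) by rewrite -[X in measurable X]setTI; exact: mr.
have GTA B : measurable B -> G B = G (B `&` Theta).
  move=> mB; rewrite [LHS](measureDI G mB mT) [X in (X + _)%E](_ : _ = 0%E) ?add0e//.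
  apply: (@subset_measure0 _ _ _ G _ (~` Theta)) => //; first exact: measurableD.
    exact: measurableC.
  by apply: (etrans (probability_setC G mT)); rewrite [X in (_ - X)%E]GT subee.
rewrite GTA// [RHS]GTA//; congr (G _); apply/seteqP; split => x /=.
  by move=> [Ax Tx]; rewrite /r mem_set.
by rewrite /r => -[+ Tx]; rewrite mem_set.
Qed.

End representation.

(** * An identity theorem for separately entire functions *)

(** Since (m + i)! >= m! i!, the tail of the series is dominated term by term by |z|^m / m! times
    the series of exp(|z|). *)
Lemma expR_taylor_le (R : realType) (z : R) m :
  `|expR z - series (exp_coeff z) m| <= exp_coeff `|z| m * expR `|z|.
Proof.
have cv : `|series (exp_coeff z) k - series (exp_coeff z) m| @[k --> \oo] -->
    `|expR z - series (exp_coeff z) m|.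
  apply: cvg_norm; apply: cvgB; last exact: cvg_cst.
  exact: is_cvg_series_exp_coeff.
apply: cvgr_to_le cv _; exists m => // k /= mk; rewrite sub_series mk.
rewrite (le_trans (ler_norm_sum _ _ _))//.
apply: (@le_trans _ _ (exp_coeff `|z| m * series (exp_coeff `|z|) (k - m)%N)).
  rewrite /series/= mulr_sumr -{1}[m]add0n big_addn ler_sum// => i _.
  rewrite /exp_coeff/= normrM normrX normfV normr_nat mulrACA -exprD addnC.
  rewrite ler_wpM2l ?exprn_ge0// -invfM lef_pV2 ?posrE ?mulr_gt0 ?ltr0n ?fact_gt0//.
  rewrite -natrM ler_nat -(bin_fact (leq_addr i m)) addKn leq_pmull//.
  by rewrite bin_gt0 leq_addr.
rewrite ler_wpM2l ?exp_coeff_ge0// (le_trans (ler_norm _))//.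
by rewrite -[in leRHS](normr_id z) series_exp_coeff_le_expR.
Qed.

Section entire_type.
Context (R : realType).

(* Functions with a globally convergent expansion of exponential type at every
   point, remainder estimate included. *)
Definition entire_type (D : R) (f : R -> R) := forall c, exists a : nat -> R,
  exists2 A : R, 0 <= A & forall m s,
    `|f (c + s) - \sum_(k < m) a k * s ^+ k| <=
    A * (exp_coeff (D * `|s|) m * expR (D * `|s|)).

Lemma entire_typeB (D : R) (f g : R -> R) : entire_type D f -> entire_type D g ->
  entire_type D (fun t => f t - g t).
Proof.
move=> fD gD c; have [a [A A0 fa]] := fD c; have [b [B B0 gb]] := gD c.
exists (fun k => a k - b k); exists (A + B); first exact: addr_ge0.
move=> m s; under eq_bigr do rewrite mulrBl.
rewrite sumrB opprD addrACA -opprD (le_trans (ler_normB _ _))// mulrDl lerD//.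
Qed.

(** The factor exp(s v) is expanded under the integral around the center c. The coefficients are
    moments of v weighted by w exp(c v), and the Taylor remainder is bounded uniformly because v
    is. *)
Lemma entire_type_Rintegral d (T : measurableType d) (P : probability T R)
    (w v : T -> R) (B D : R) :
  measurable_fun setT w -> measurable_fun setT v ->
  (forall u, `|w u| <= B) -> (forall u, `|v u| <= D) ->
  entire_type D (fun t => \int[P]_u (w u * expR (t * v u))).
Proof.
move=> mw mv wB vD c.
have D0 : 0 <= D := le_trans (normr_ge0 _) (vD point).
have B0 : 0 <= B := le_trans (normr_ge0 _) (wB point).
have mwc : measurable_fun setT (fun u => w u * expR (c * v u)).
  by apply: measurable_funM => //; apply: measurableT_comp => //; exact: measurable_funM.
have wcB u : `|w u * expR (c * v u)| <= B * expR (`|c| * D).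
  rewrite normrM ler_pM// ger0_norm ?expR_ge0// ler_expR.
  by rewrite (le_trans (ler_norm _))// normrM ler_wpM2l.
pose a k := \int[P]_u (w u * expR (c * v u) * (v u ^+ k / k`!%:R)).
exists a, (B * expR (`|c| * D)); first by rewrite mulr_ge0 ?expR_ge0.
move=> m s.
have iwX k : P.-integrable setT (EFin \o (fun u => w u * expR (c * v u) * (v u ^+ k / k`!%:R))).
  apply: (@bounded_integrable _ _ _ P _ (B * expR (`|c| * D) * (D ^+ k / k`!%:R))).
    apply: measurable_funM => //; apply: measurable_funM => //.
    exact: measurable_funX.
  move=> u; rewrite normrM ler_pM// normrM normfV normr_nat ler_wpM2r ?invr_ge0//.
  by rewrite normrX lerXn2r ?nnegrE.
have mws : measurable_fun setT (fun u => w u * expR ((c + s) * v u)).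
  by apply: measurable_funM => //; apply: measurableT_comp => //; exact: measurable_funM.
have iws : P.-integrable setT (EFin \o (fun u => w u * expR ((c + s) * v u))).
  apply: (@bounded_integrable _ _ _ P _ (B * expR (`|c + s| * D))) => // u.
  rewrite normrM ler_pM// ger0_norm ?expR_ge0// ler_expR.
  by rewrite (le_trans (ler_norm _))// normrM ler_wpM2l.
have iS k : P.-integrable setT (EFin \o
    (fun u => w u * expR (c * v u) * series (exp_coeff (s * v u)) k)).
  apply: (@bounded_integrable _ _ _ P _ (B * expR (`|c| * D) * expR (`|s| * D))).
    apply: measurable_funM => //; apply: measurable_sum => i.
    by apply: measurable_funM => //; apply: measurable_funX; exact: measurable_funM.
  move=> u; rewrite normrM ler_pM// (le_trans (series_exp_coeff_le_expR _ _))//.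
  by rewrite ler_expR normrM ler_wpM2l.
have -> : \sum_(k < m) a k * s ^+ k =
    \int[P]_u (w u * expR (c * v u) * series (exp_coeff (s * v u)) m).
  elim: m => [|m IH].
    rewrite big_ord0 /series/=; under eq_Rintegral do rewrite big_geq// mulr0.
    by rewrite /Rintegral integral0.
  rewrite big_ord_recr/= IH /a -RintegralZr// -RintegralD//; last first.
    exact: (integrableZr measurableT (s ^+ m) (iwX m)).
  apply: eq_Rintegral => u _; rewrite seriesSr mulrDr; congr (_ + _).
  by rewrite /exp_coeff/= exprMn; ring.
rewrite -RintegralB//.
have mdiff : measurable_fun setT (fun u => w u * expR ((c + s) * v u) -
    w u * expR (c * v u) * series (exp_coeff (s * v u)) m).
  apply: measurable_funB => //; apply: measurable_funM => //.
  apply: measurable_sum => i.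
  by apply: measurable_funM => //; apply: measurable_funX; exact: measurable_funM.
have diffB u : `|w u * expR ((c + s) * v u) -
    w u * expR (c * v u) * series (exp_coeff (s * v u)) m| <=
    B * expR (`|c| * D) * (exp_coeff (D * `|s|) m * expR (D * `|s|)).
  rewrite mulrDl expRD mulrA -mulrBr normrM ler_pM//.
  apply: (le_trans (expR_taylor_le _ _)).
  have sv : `|s * v u| <= D * `|s| by rewrite normrM mulrC ler_wpM2r.
  rewrite ler_pM ?exp_coeff_ge0 ?expR_ge0 ?ler_expR//.
  by rewrite /exp_coeff/= ler_wpM2r ?invr_ge0// lerXn2r ?nnegrE// mulr_ge0.
exact: normr_Rintegral_le.
Qed.

(** The remainder estimate reaches any distance from c, so one center with vanishing coefficients
    settles the whole line, with no continuation along discs. *)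
Lemma entire_type_zero_cvg (D : R) (f : R -> R) c (a : nat -> R) (A : R) : 0 <= A ->
  (forall m s, `|f (c + s) - \sum_(k < m) a k * s ^+ k| <=
    A * (exp_coeff (D * `|s|) m * expR (D * `|s|))) ->
  (forall k, a k = 0) -> forall x, f x = 0.
Proof.
move=> A0 fa a0 x; apply/eqP; rewrite -normr_le0.
have cv : A * (exp_coeff (D * `|x - c|) m * expR (D * `|x - c|)) @[m --> \oo] -->
    A * (0 * expR (D * `|x - c|)).
  by apply: cvgM; [exact: cvg_cst|apply: cvgM; [exact: cvg_exp_coeff|exact: cvg_cst]].
rewrite mul0r mulr0 in cv; apply: cvgr_to_ge cv _; apply: nearW => m.
apply: le_trans (fa m (x - c)); rewrite big1 ?subr0 ?subrKC//.
by move=> i _; rewrite a0 mul0r.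
Qed.

(** An uncountable zero set has a limit point, and zeros accumulating there annihilate the
    coefficients one after the other. *)
Lemma entire_type_eq0 (D : R) (f : R -> R) (S : set R) : 0 <= D -> entire_type D f ->
  (forall x, S x -> f x = 0) -> ~ countable S -> forall x, f x = 0.
Proof.
move=> D0 fD S0 nS.
(* Without limit points, S would meet each [-N, N] in a finite set and be countable. *)
have [c Sc] : exists c, limit_point S c.
  apply: contrapT => nc; apply: nS.
  have -> : S = \bigcup_N (S `&` `[- N%:R, N%:R]).
    apply/seteqP; split => [x Sx|x [N _ []]//].
    exists (Num.truncn `|x|).+1 => //; split => //=.
    by rewrite in_itv/= -ler_norml ltW// truncnS_gt.
  apply: bigcup_countable => // N _; apply: finite_set_countable.
  apply: contrapT => inf.
  have [|c Nc] := @infinite_bounded_limit_point_nonempty R (S `&` `[- N%:R, N%:R]) inf.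
    exists N%:R; split => // M NM x [_ /=]; rewrite in_itv/= -ler_norml => xN.
    exact: le_trans xN (ltW NM).
  apply: nc; exists c => U cU; have [y [? [? _] ?]] := Nc U cU; by exists y; split.
have [a [A A0 fa]] := fD c; apply: (entire_type_zero_cvg A0 fa) => k.
elim/ltn_ind: k => m IH; apply/eqP; rewrite -normr_le0 leNgt; apply/negP => am.
(* At distance s <= 1 the remainder of order m + 1 is at most C s^(m+1). A zero at distance s < |a
   m| / (C + 1) would give |a m| s^m <= C s^(m+1) < |a m| s^m. *)
pose C := A * (D ^+ m.+1 * expR D).
have C0 : 0 <= C.
  by apply: mulr_ge0 => //; apply: mulr_ge0; [exact: exprn_ge0|exact: expR_ge0].
have e0 : 0 < Num.min 1 (`|a m| / (C + 1)).
  by rewrite lt_min ltr01 divr_gt0// ltr_wpDl.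
have [y [yc Sy]] := Sc _ (nbhsx_ballx c _ e0).
rewrite /ball/= lt_min => /andP[y1 y2].
have := fa m.+1 (y - c); rewrite subrKC S0// sub0r normrN big_ord_recr/=.
rewrite big1 ?add0r; last by move=> i _; rewrite IH// mul0r.
have s0 : 0 < `|y - c| by rewrite normr_gt0 subr_eq0.
move: y1 y2; rewrite distrC => y1 y2; move: s0 y1 y2; set s := `|y - c| => s0 s1 sa.
rewrite normrM normrX -/s; apply/negP; rewrite -ltNge.
apply: le_lt_trans (_ : C * s * s ^+ m < _); last first.
  rewrite ltr_pM2r ?exprn_gt0//; move: sa; rewrite ltr_pdivlMr ?ltr_wpDl// => sa.
  by rewrite (le_lt_trans _ sa)// mulrC ler_wpM2l ?ltW// ltrDl.
rewrite /C -mulrA -exprS mulrAC -!mulrA ler_wpM2l// /exp_coeff/= exprMn -!mulrA.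
rewrite ler_wpM2l ?exprn_ge0// [leRHS]mulrC.
have s0' := ltW s0; rewrite ler_wpM2l ?exprn_ge0//.
rewrite -[leRHS]mulr1 ler_pM ?invr_ge0 ?expR_ge0//.
  by rewrite ler_expR ler_piMr// ltW.
by rewrite invf_le1 ?ltr0n ?fact_gt0// ler1n fact_gt0.
Qed.

End entire_type.

Section separately_entire.
Context (R : realType).

(* Weaker than joint analyticity, but enough for an induction on the dimension
   through Fubini's theorem. *)
Definition separately_entire n (D : R) (f : 'rV[R]_n -> R) :=
  forall (x : 'rV[R]_n) (i : 'I_n),
    entire_type D (fun t => f (\row_j (if j == i then t else x ord0 j))).

(** Induction on the dimension. Let S be the set of first coordinates whose slice of the zero set is
    not null. By Fubini S is not null, hence uncountable; the induction hypothesis makes f vanish on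
    the slices over S, and each line in the first direction then has uncountably many zeros. *)
Lemma separately_entire_eq0 n (D : R) (f : 'rV[R]_n -> R) : 0 <= D ->
  measurable_fun setT f -> separately_entire D f ->
  lebesgue_rV R n (f @^-1` [set 0]) != 0%E -> forall x, f x = 0.
Proof.
move=> D0; elim: n f => [|n IH] f mf fD f0 x.
  move: f0; rewrite /= diracE; case: (boolP (_ \in _)) => [|_]; last by rewrite eqxx.
  by rewrite inE /= => f0 _; rewrite -f0; congr f; apply/rowP => -[].
have mZ : measurable (f @^-1` [set 0]).
  by rewrite -[X in measurable X]setTI; exact: mf.
have mfc : measurable_fun setT (f \o @cons_rV R n).
  by apply: measurableT_comp => //; exact: measurable_cons_rV.
have mZc : measurable ((f \o @cons_rV R n) @^-1` [set 0]).
  by rewrite -[X in measurable X]setTI; exact: mfc.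
pose Z t := xsection ((f \o @cons_rV R n) @^-1` [set 0]) t.
pose S := [set t | lebesgue_rV R n (Z t) != 0%E].
have mS : measurable_fun setT (fun t => lebesgue_rV R n (Z t)).
  exact: measurable_fun_xsection.
have S0 : ~ countable S.
  move=> cS; move/eqP : f0; apply.
  rewrite /= /lebesgue_cons /pushforward /product_measure1.
  rewrite (ae_eq_integral (cst 0%E)) ?integral0//.
  exists S; split.
  - rewrite (_ : S = ~` ((fun t => lebesgue_rV R n (Z t)) @^-1` [set 0%E])).
      apply: measurableC; rewrite -[X in measurable X]setTI; exact: mS.
    by apply/seteqP; split => t /= /eqP.
  - exact: countable_lebesgue_measure0.
  - move=> t /= tS; rewrite /S /=; apply/eqP => Z0; apply: tS => _.
    by rewrite Z0.
have fS (y : 'rV[R]_n) t : f (cons_rV (t, y)) = 0.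
  apply: (@entire_type_eq0 _ D (fun t => f (cons_rV (t, y))) S) => //.
    have := fD (cons_rV (0, y)) ord0; congr entire_type; apply/funext => s.
    congr f; apply/rowP => j; rewrite !mxE; case: unliftP => [k ->|->]; last by rewrite eqxx.
    by [].
  move=> s; rewrite /S/= => Zs.
  apply: (IH (fun y => f (cons_rV (s, y)))).
  - by apply: measurableT_comp mfc _; exact: measurable_pair1.
  - move=> z i; have := fD (cons_rV (s, z)) (lift ord0 i); congr entire_type.
    apply/funext => u; congr f; apply/rowP => j; rewrite !mxE.
    case: unliftP => [k ->|->]; last by rewrite (negbTE (neq_lift _ _)).
    by rewrite !mxE (inj_eq (@lift_inj _ _)).
  - by move: Zs; rewrite /Z xsectionE.
have -> : x = cons_rV (x ord0 ord0, \row_j x ord0 (lift ord0 j)).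
  by apply/rowP => j; rewrite !mxE; case: unliftP => [k ->|->]//; rewrite mxE.
exact: fS.
Qed.

End separately_entire.

(** * Gaussian densities *)

Section gaussian.
Context (R : realType) (n : nat).
Local Notation E := 'rV[R]_n.
Implicit Types x t : E.

Lemma enormE x : enorm x ^+ 2 = \sum_i x ord0 i ^+ 2.
Proof. by rewrite sqr_sqrtr// sumr_ge0// => i _; exact: sqr_ge0. Qed.

Lemma enorm_ge0 x : 0 <= enorm x.
Proof. exact: sqrtr_ge0. Qed.

Lemma coord_le_enorm x i : `|x ord0 i| <= enorm x.
Proof.
rewrite -sqrtr_sqr; apply: ler_wsqrtr; rewrite (bigD1 i)//= lerDl sumr_ge0// => j _.
exact: sqr_ge0.
Qed.

Lemma measurable_enorm : measurable_fun setT (@enorm R n).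
Proof.
apply: measurableT_comp; first exact: continuous_measurable_fun (@sqrt_continuous R).
apply: measurable_sum => i.
by apply: measurable_funX; exact: measurable_coord.
Qed.

Context (sigma : R) (sigma_gt0 : 0 < sigma).

Let s2 := 2 * sigma ^+ 2.

Let s2_gt0 : 0 < s2.
Proof. by rewrite mulr_gt0// exprn_gt0. Qed.

Definition gaussian_peak : R := (Num.sqrt (2 * pi * sigma ^+ 2)) ^- n.

Lemma gaussian_peak_gt0 : 0 < gaussian_peak.
Proof.
by rewrite invr_gt0 exprn_gt0// sqrtr_gt0 mulr_gt0 ?exprn_gt0// mulr_gt0// pi_gt0.
Qed.

Lemma gaussian_densityE x : gaussian_density sigma x =
  gaussian_peak * expR (- (enorm x ^+ 2 / s2)).
Proof. by []. Qed.

Lemma gaussian_density_gt0 x : 0 < gaussian_density sigma x.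
Proof. by rewrite gaussian_densityE mulr_gt0 ?expR_gt0 ?gaussian_peak_gt0. Qed.

Lemma gaussian_density_le_peak x : gaussian_density sigma x <= gaussian_peak.
Proof.
rewrite gaussian_densityE ler_piMr ?(ltW gaussian_peak_gt0)// expR_le1 oppr_le0.
by rewrite divr_ge0 ?(ltW s2_gt0)// sqr_ge0.
Qed.

Lemma measurable_gaussian_density : measurable_fun setT (@gaussian_density R n sigma).
Proof.
apply: measurable_funM => //; apply: measurableT_comp => //.
apply: measurableT_comp => //; apply: measurable_funM => //.
by apply: measurable_funX; exact: measurable_enorm.
Qed.

Section shifts.
Context (D : R) (D0 : 0 <= D).

Let K := n%:R * D ^+ 2.

Lemma enorm_sqr_le t : (forall i, `|t ord0 i| <= D) -> enorm t ^+ 2 <= K.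
Proof.
move=> tD; rewrite enormE /K.
rewrite mulrC mulr_natr -[in leRHS](card_ord n) -sumr_const ler_sum// => i _.
by rewrite -real_normK ?num_real// lerXn2r ?nnegrE.
Qed.

(** From |x - t|^2 <= 2 |x|^2 + 2 |t|^2. *)
Lemma gaussian_density_ge x t : (forall i, `|t ord0 i| <= D) ->
  gaussian_peak * expR (- ((2 * enorm x ^+ 2 + 2 * K) / s2)) <=
  gaussian_density sigma (x - t).
Proof.
move=> tD; rewrite gaussian_densityE ler_pM2l ?gaussian_peak_gt0// ler_expR lerN2.
rewrite ler_pM2r ?invr_gt0//.
apply: le_trans (_ : 2 * enorm x ^+ 2 + 2 * enorm t ^+ 2 <= _).
  rewrite !enormE !mulr_sumr -big_split/= ler_sum// => i _; rewrite !mxE.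
  by have := sqr_ge0 (x ord0 i + t ord0 i); nra.
by rewrite lerD2l ler_pM2l// enorm_sqr_le.
Qed.

(** From |x - t|^2 >= |x|^2 / 2 - |t|^2; the gap is half of |x - 2 t|^2. *)
Lemma gaussian_density_le x t : (forall i, `|t ord0 i| <= D) ->
  gaussian_density sigma (x - t) <=
  gaussian_peak * expR (- ((enorm x ^+ 2 / 2 - K) / s2)).
Proof.
move=> tD; rewrite gaussian_densityE ler_pM2l ?gaussian_peak_gt0// ler_expR lerN2.
rewrite ler_pM2r ?invr_gt0//.
apply: le_trans (_ : enorm x ^+ 2 / 2 - enorm t ^+ 2 <= _).
  by rewrite lerD2l lerN2 enorm_sqr_le.
rewrite !enormE mulr_suml -sumrB ler_sum// => i _; rewrite !mxE.
by have := sqr_ge0 (x ord0 i - 2 * t ord0 i); nra.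
Qed.

(** Bounds the log-ratio of two Gaussian densities with centers in the cube, hence of two mixtures.
    It is [enorm_shift] at e = 2 D, divided by 2 sigma^2. *)
Definition shift_bound x : R := n%:R * (4 * D) * (enorm x + D) / s2.

Lemma shift_bound_ge0 x : 0 <= shift_bound x.
Proof.
by rewrite /shift_bound divr_ge0 ?(ltW s2_gt0)// mulr_ge0 ?mulr_ge0// addr_ge0// enorm_ge0.
Qed.

Lemma enorm_shift (e : R) x t1 t2 :
  (forall i, `|t1 ord0 i| <= D) -> (forall i, `|t2 ord0 i| <= D) ->
  (forall i, `|t1 ord0 i - t2 ord0 i| <= e) ->
  `|enorm (x - t1) ^+ 2 - enorm (x - t2) ^+ 2| <= n%:R * e * (2 * (enorm x + D)).
Proof.
move=> t1D t2D e12; rewrite !enormE -sumrB (le_trans (ler_norm_sum _ _ _))//.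
have -> : n%:R * e * (2 * (enorm x + D)) = \sum_(i < n) e * (2 * (enorm x + D)).
  by rewrite sumr_const card_ord -mulrA mulr_natl.
apply: ler_sum => i _; rewrite !mxE subr_sqr normrM.
rewrite (_ : _ - t1 _ _ - _ = - (t1 ord0 i - t2 ord0 i)); last by ring.
rewrite normrN ler_pM//.
rewrite (_ : _ + _ = x ord0 i *+ 2 - (t1 ord0 i + t2 ord0 i)); last by ring.
rewrite (le_trans (ler_normB _ _))//.
have h := coord_le_enorm x i; have h1 := t1D i; have h2 := t2D i.
have h12 := ler_normD (t1 ord0 i) (t2 ord0 i).
by rewrite normrMn mulr2n; lra.
Qed.

Lemma gaussian_density_shift x t1 t2 :
  (forall i, `|t1 ord0 i| <= D) -> (forall i, `|t2 ord0 i| <= D) ->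
  gaussian_density sigma (x - t1) <=
  gaussian_density sigma (x - t2) * expR (shift_bound x).
Proof.
move=> t1D t2D; rewrite !gaussian_densityE -mulrA ler_pM2l ?gaussian_peak_gt0//.
rewrite -expRD ler_expR /shift_bound -mulNr -[X in _ <= X + _]mulNr -mulrDl ler_pM2r ?invr_gt0//.
have := @enorm_shift (2 * D) x t2 t1 t2D t1D.
have -> : n%:R * (2 * D) * (2 * (enorm x + D)) = n%:R * (4 * D) * (enorm x + D) by ring.
move=> H; rewrite -lerBlDl opprK addrC (le_trans (ler_norm _)) ?H// => i.
by rewrite (le_trans (ler_normB _ _))// mulrDl mul1r lerD.
Qed.

Lemma gaussian_density_close (e M : R) x t1 t2 : 0 <= e -> enorm x <= M ->
  (forall i, `|t1 ord0 i| <= D) -> (forall i, `|t2 ord0 i| <= D) ->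
  (forall i, `|t1 ord0 i - t2 ord0 i| <= e) ->
  `|gaussian_density sigma (x - t1) - gaussian_density sigma (x - t2)| <=
  gaussian_peak * (n%:R * (2 * (M + D)) / s2) * e.
Proof.
move=> e0 xM t1D t2D e12.
have key (a b : R) : 0 <= a -> 0 <= b -> expR (- a) - expR (- b) <= `|a - b|.
  move=> a0 b0; have [ab|ba] := leP a b; last first.
    by rewrite (@le_trans _ _ 0)// subr_le0 ler_expR lerN2 ltW.
  apply: (@le_trans _ _ (expR (- a) * (b - a))).
    have := expR_ge1Dx (a - b); have := expR_gt0 (- a).
    have -> : expR (- b) = expR (- a) * expR (a - b) by rewrite -expRD; congr expR; ring.
    by nra.
  rewrite distrC ger0_norm ?subr_ge0// ler_piMl ?subr_ge0//.
  by rewrite expR_le1 oppr_le0.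
rewrite !gaussian_densityE -mulrBr normrM gtr0_norm ?gaussian_peak_gt0//.
rewrite -[leRHS]mulrA ler_pM2l ?gaussian_peak_gt0//.
set a := _ / s2; set b := _ / s2.
have ab : `|a - b| <= n%:R * (2 * (M + D)) / s2 * e.
  rewrite /a /b -mulrBl normrM [X in _ * X]gtr0_norm ?invr_gt0// mulrAC.
  rewrite ler_pM2r ?invr_gt0// (le_trans (enorm_shift _ _ _ e12))//.
  by rewrite mulrAC ler_wpM2r// ler_wpM2l// ler_pM2l// lerD2r.
have a0 : 0 <= a by rewrite divr_ge0 ?(ltW s2_gt0)// sqr_ge0.
have b0 : 0 <= b by rewrite divr_ge0 ?(ltW s2_gt0)// sqr_ge0.
rewrite ler_norml (le_trans (key _ _ a0 b0) ab) andbT lerNl opprB.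
by rewrite (le_trans (key _ _ b0 a0))// distrC.
Qed.

End shifts.

End gaussian.

(** Up to its peak value, the integrand is the normal density of variance 1 / (2 c). *)
Lemma lebesgue_gaussian_lty (R : realType) (c : R) : 0 < c ->
  (\int[lebesgue_measure]_x (expR (- (c * x ^+ 2)))%:E < +oo)%E.
Proof.
move=> c0; pose s : R := Num.sqrt (2 * c)^-1.
have c2 : 0 < (2 * c)^-1 by rewrite invr_gt0 mulr_gt0.
have s0 : s != 0 by rewrite gt_eqF// sqrtr_gt0.
have p0 := normal_peak_gt0 s0.
have H x : (expR (- (c * x ^+ 2)))%:E =
    ((normal_peak s)^-1%:E * (normal_pdf 0 s x)%:E)%E.
  have -> : normal_pdf 0 s x = normal_peak s * normal_fun 0 s x by rewrite normal_pdfE.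
  rewrite -EFinM [in RHS]mulrA mulVf ?gt_eqF// mul1r /normal_fun.
  congr (expR _)%:E; rewrite subr0 /s sqr_sqrtr ?(ltW c2)//.
  by rewrite -mulr_natr mulNr; field; rewrite gt_eqF.
under eq_integral do rewrite H.
rewrite ge0_integralZl//; last 3 first.
- by apply/measurable_EFinP; exact: measurable_normal_pdf.
- by move=> x _; rewrite lee_fin normal_pdf_ge0.
- by rewrite lee_fin invr_ge0 ltW.
by rewrite integral_normal_pdf// mule1 ltry.
Qed.

Lemma lebesgue_rV_gaussian_lty (R : realType) n (c : R) : 0 < c ->
  (\int[lebesgue_rV R n]_x (expR (- (c * enorm x ^+ 2)))%:E < +oo)%E.
Proof.
move=> c0.
have mexp k : measurable_fun setT (fun x : 'rV[R]_k => (expR (- (c * enorm x ^+ 2)))%:E).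
  apply/measurable_EFinP; apply: measurableT_comp => //; apply: measurableT_comp => //.
  by apply: measurable_funM => //; apply: measurable_funX; exact: measurable_enorm.
elim: n => [|m IH].
  by rewrite /= (integral_dirac _ _ (mexp 0%N)) ?diracT ?mul1e ?ltry.
have mexp1 : measurable_fun setT (fun x : R => (expR (- (c * x ^+ 2)))%:E).
  apply/measurable_EFinP; apply: measurableT_comp => //; apply: measurableT_comp => //.
  by apply: measurable_funM => //; exact: measurable_funX.
have -> : (\int[lebesgue_rV R m.+1]_x (expR (- (c * enorm x ^+ 2)))%:E =
   \int[(lebesgue_measure \x lebesgue_rV R m)%E]_z
     ((expR (- (c * z.1 ^+ 2)))%:E * (expR (- (c * enorm z.2 ^+ 2)))%:E))%E.
  transitivity (\int[pushforward (lebesgue_measure \x lebesgue_rV R m)%E (@cons_rV R m)]_x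
      (expR (- (c * enorm x ^+ 2)))%:E)%E.
    reflexivity.
  rewrite ge0_integral_pushforward//; last 2 first.
  - exact: measurable_cons_rV.
  - exact: mexp.
  apply: eq_integral => z _; rewrite /= -EFinM -expRD; congr (expR _)%:E.
  rewrite -opprD -mulrDr; congr (- (c * _)); rewrite !enormE big_ord_recl mxE unlift_none.
  by congr (_ + _); apply: eq_bigr => i _; rewrite mxE liftK.
rewrite fubini_tonelli1//=; last first.
  apply: emeasurable_funM.
    exact: (measurableT_comp mexp1 measurable_fst).
  exact: (measurableT_comp (mexp m) measurable_snd).
have H (t : R) : fubini_F (lebesgue_rV R m)
     (fun z : measurableTypeR R * 'rV[R]_m =>
       (expR (- (c * z.1 ^+ 2)))%:E * (expR (- (c * enorm z.2 ^+ 2)))%:E)%E t =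
   ((\int[lebesgue_rV R m]_x (expR (- (c * enorm x ^+ 2)))%:E) *
   (expR (- (c * t ^+ 2)))%:E)%E.
  rewrite /fubini_F/= ge0_integralZl//; first exact: muleC.
  exact: mexp.
under eq_integral do rewrite H.
rewrite ge0_integralZl//; last by apply: integral_ge0 => x _; rewrite lee_fin expR_ge0.
apply: lte_mul_pinfty; last exact: lebesgue_gaussian_lty.
- by apply: integral_ge0 => x _; rewrite lee_fin expR_ge0.
- by rewrite ge0_fin_numE//; apply: integral_ge0 => x _; rewrite lee_fin expR_ge0.
Qed.

(** * Gaussian mixtures *)

Lemma ln_sub_le (R : realType) (a b c lb : R) : 0 < a -> 0 < lb -> lb <= b -> 0 <= c ->
  a - b <= c * lb -> ln a - ln b <= c.
Proof.
move=> a0 lb0 lbb c0 abc; have b0 := lt_le_trans lb0 lbb.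
have abb : a / b = 1 + (a - b) / b by field; rewrite gt_eqF.
rewrite -ln_div ?posrE// abb (le_trans (le_ln1Dx _))//.
  by rewrite -subr_gt0 opprK addrC -abb divr_gt0.
by rewrite ler_pdivrMr// (le_trans abc)// ler_wpM2l.
Qed.

Section mixtures.
Context (R : realType) (n : nat).
Local Notation E := 'rV[R]_n.
Context (Theta : set E) (Theta_compact : compact Theta) (Theta_nonempty : Theta !=set0).
Context (sigma : R) (sigma_gt0 : 0 < sigma).
Context (D : R) (D0 : 0 <= D).
Hypothesis ThetaD : forall t, Theta t -> forall i, `|t ord0 i| <= D.

Local Notation h := (skorokhod Theta).
Local Notation mass := (mass_system Theta).
Local Notation phi := (gaussian_density sigma).
Local Notation peak := (gaussian_peak n sigma).
Local Notation bound := (@shift_bound R n sigma D).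

Definition mixture (m : seq bool -> R) (x : E) : R :=
  \int[unit_prob R]_u phi (x - h m u).

Let hD m u i : mass m -> `|h m u ord0 i| <= D.
Proof. by move=> mm; apply: ThetaD; exact: skorokhod_Theta. Qed.

Lemma measurable_mixture_integrand m : mass m ->
  measurable_fun setT (fun z : E * measurableTypeR R => phi (z.1 - h m z.2)).
Proof.
move=> mm; have mg : measurable_fun setT (fun z : E * measurableTypeR R => z.1 - h m z.2).
  apply: measurable_rVP => i; under [X in measurable_fun _ X]eq_fun do rewrite mxE [X in _ + X]mxE.
  apply: measurable_funB.
    exact: (measurableT_comp (measurable_coord i) measurable_fst).
  have mh := measurable_skorokhod Theta_compact Theta_nonempty mm.
  exact: (measurableT_comp (measurableT_comp (measurable_coord i) mh) measurable_snd).
exact: (measurableT_comp (measurable_gaussian_density sigma) mg).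
Qed.

Let mphi m x : mass m ->
  measurable_fun setT (fun u : measurableTypeR R => phi (x - h m u)).
Proof.
by move=> mm; exact: (measurableT_comp (measurable_mixture_integrand mm) (measurable_pair1 x)).
Qed.

Let phi_peak (t : E) : `|phi t| <= peak.
Proof. by rewrite gtr0_norm ?gaussian_density_gt0// gaussian_density_le_peak. Qed.

Lemma mixture_EFin m x : mass m ->
  (mixture m x)%:E = (\int[unit_prob R]_u (phi (x - h m u))%:E)%E.
Proof.
move=> mm; rewrite fineK//; apply: integrable_fin_num => //.
by apply: (bounded_integrable (unit_prob R) (mphi x mm)) => u; exact: phi_peak.
Qed.

Lemma measurable_mixture m : mass m -> measurable_fun setT (mixture m).
Proof.
move=> mm; apply/measurable_EFinP.
rewrite (_ : EFin \o _ = fubini_F (unit_prob R) (fun z : E * measurableTypeR R =>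
    (phi (z.1 - h m z.2))%:E)); last first.
  by apply/funext => x /=; rewrite mixture_EFin.
apply: measurable_fun_fubini_tonelli_F.
  by apply/measurable_EFinP; exact: measurable_mixture_integrand.
by move=> z; rewrite lee_fin ltW// gaussian_density_gt0.
Qed.

Let mixture_between m x (a b : R) : mass m ->
  (forall t : E, (forall i, `|t ord0 i| <= D) -> a <= phi (x - t) <= b) ->
  a <= mixture m x <= b.
Proof.
move=> mm ab; apply: (@Rintegral_between _ _ _ (unit_prob R)); first exact: mphi.
by move=> u; apply: ab => i; exact: hD.
Qed.

Lemma mixture_le m x : mass m ->
  mixture m x <= peak * expR (- ((enorm x ^+ 2 / 2 - n%:R * D ^+ 2) / (2 * sigma ^+ 2))).
Proof.
move=> mm; have /andP[//] : 0 <= mixture m x <=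
  peak * expR (- ((enorm x ^+ 2 / 2 - n%:R * D ^+ 2) / (2 * sigma ^+ 2))).
apply: mixture_between => // t tD.
by rewrite gaussian_density_le// ltW// gaussian_density_gt0.
Qed.

Lemma mixture_ge m x : mass m ->
  peak * expR (- ((2 * enorm x ^+ 2 + 2 * (n%:R * D ^+ 2)) / (2 * sigma ^+ 2))) <=
  mixture m x.
Proof.
move=> mm; have /andP[//] :
  peak * expR (- ((2 * enorm x ^+ 2 + 2 * (n%:R * D ^+ 2)) / (2 * sigma ^+ 2))) <=
  mixture m x <= peak.
apply: mixture_between => // t tD.
by rewrite gaussian_density_ge// gaussian_density_le_peak.
Qed.

Lemma mixture_gt0 m x : mass m -> 0 < mixture m x.
Proof.
move=> mm; apply: lt_le_trans (mixture_ge x mm).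
by rewrite mulr_gt0 ?expR_gt0// gaussian_peak_gt0.
Qed.

(** The bound compares two arbitrary centers, so it is averaged twice: over the law of [m1] with t
    fixed, then over the law of [m2]. *)
Lemma mixture_shift m1 m2 x : mass m1 -> mass m2 ->
  mixture m1 x <= mixture m2 x * expR (bound x).
Proof.
move=> mm1 mm2; rewrite -ler_pdivrMr ?expR_gt0// -expRN.
have /andP[//] : mixture m1 x * expR (- bound x) <= mixture m2 x <= peak.
apply: mixture_between => // t tD; rewrite gaussian_density_le_peak// andbT.
rewrite expRN ler_pdivrMr ?expR_gt0//.
have /andP[//] : 0 <= mixture m1 x <= phi (x - t) * expR (bound x).
apply: mixture_between => // t' t'D.
by rewrite gaussian_density_shift// ltW// gaussian_density_gt0.
Qed.

Lemma ln_mixture_shift m1 m2 x : mass m1 -> mass m2 ->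
  `|ln (mixture m1 x) - ln (mixture m2 x)| <= bound x.
Proof.
move=> mm1 mm2.
have key m3 m4 : mass m3 -> mass m4 -> ln (mixture m3 x) - ln (mixture m4 x) <= bound x.
  move=> mm3 mm4; rewrite lerBlDl -[bound x]expRK -lnM ?posrE ?expR_gt0 ?mixture_gt0//.
  by rewrite ler_ln ?posrE ?mulr_gt0 ?expR_gt0 ?mixture_gt0// mixture_shift.
by rewrite ler_norml key// lerNl opprB key.
Qed.

(** Off the exceptional event the integrands are close by the Lipschitz estimate; on it they differ
    by at most the peak. On a ball, mixtures have a common positive lower bound, so closeness passes
    to logarithms. *)
Lemma ln_mixture_close (M e : R) : 0 <= M -> 0 < e ->
  exists k, exists2 dl : R, 0 < dl &
  forall m1 m2, mass m1 -> mass m2 ->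
  (forall w, (size w <= k)%N -> `|m1 w - m2 w| <= dl) ->
  forall x, enorm x <= M -> ln (mixture m1 x) - ln (mixture m2 x) <= e.
Proof.
move=> M0 e0.
have peak0 := ltW (gaussian_peak_gt0 n sigma_gt0).
pose lb := peak * expR (- ((2 * M ^+ 2 + 2 * (n%:R * D ^+ 2)) / (2 * sigma ^+ 2))).
have lb0 : 0 < lb by rewrite mulr_gt0 ?expR_gt0// gaussian_peak_gt0.
(* Lipschitz constant on the ball plus the contribution of the exceptional event. *)
pose C := peak * (n%:R * (2 * (M + D)) / (2 * sigma ^+ 2)) + peak.
have s20 : 0 < 2 * sigma ^+ 2 by rewrite mulr_gt0// exprn_gt0.
have C0 : 0 < C.
  rewrite ltr_wpDl ?gaussian_peak_gt0// mulr_ge0//.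
  by rewrite divr_ge0 ?(ltW s20)// !mulr_ge0// addr_ge0.
have e10 : 0 < e * lb / C by rewrite divr_gt0// mulr_gt0.
have [k [dl dl0 kP]] := skorokhod_unif_close Theta_compact Theta_nonempty e10.
exists k, dl => // m1 m2 mm1 mm2 m12 x xM.
have [B [mB UB] hB] := kP _ _ mm1 mm2 m12.
set e1 := e * lb / C in e10 UB hB.
have diff : mixture m1 x - mixture m2 x <= C * e1.
    have I1 := bounded_integrable (unit_prob R) (mphi x mm1) (fun u => phi_peak _).
  have I2 := bounded_integrable (unit_prob R) (mphi x mm2) (fun u => phi_peak _).
  have -> : mixture m1 x - mixture m2 x =
      \int[unit_prob R]_u (phi (x - h m1 u) - phi (x - h m2 u)).
    exact: (esym (RintegralB measurableT I1 I2)).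
  have IB : (unit_prob R).-integrable setT (EFin \o (fun u => peak * \1_B u)).
    apply: (@bounded_integrable _ _ _ (unit_prob R) _ peak).
      by apply: measurable_funM => //; exact: measurable_indic.
    move=> u; rewrite normrM gtr0_norm ?gaussian_peak_gt0// ler_piMr//.
    by rewrite indicE; case: (_ \in _); rewrite /= ?normr1 ?normr0.
  pose c1 := peak * (n%:R * (2 * (M + D)) / (2 * sigma ^+ 2)) * e1.
  have c10 : 0 <= c1.
    rewrite /c1 mulr_ge0 ?(ltW e10)// mulr_ge0//.
    by rewrite divr_ge0 ?(ltW s20)// !mulr_ge0// addr_ge0.
  have Icst : (unit_prob R).-integrable setT (EFin \o cst c1).
    exact: finite_measure_integrable_cst.
  have Ic : (unit_prob R).-integrable setT (EFin \o (fun u => c1 + peak * \1_B u)).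
    exact: (integrableD measurableT Icst IB).
  apply: (@le_trans _ _ (\int[unit_prob R]_u (c1 + peak * \1_B u))).
    apply: le_Rintegral; first exact: measurableT.
    - exact: (integrableB measurableT I1 I2).
    - exact: Ic.
    - move=> u _; have [Bu|nBu] := pselect (B u).
        rewrite indicE mem_set// mulr1; apply: (@le_trans _ _ peak).
          apply: le_trans (gaussian_density_le_peak sigma_gt0 (x - h m1 u)).
          by rewrite lerBlDr lerDl ltW// gaussian_density_gt0.
        by rewrite lerDr.
      rewrite indicE memNset// mulr0 addr0 (le_trans (ler_norm _))//.
      by apply: gaussian_density_close => //;
        [exact: ltW|move=> i; exact: hD|move=> i; exact: hD|exact: hB].
  have -> : \int[unit_prob R]_u (c1 + peak * \1_B u) =
      \int[unit_prob R]_u cst c1 u + peak * \int[unit_prob R]_u \1_B u.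
    have iB : (unit_prob R).-integrable setT (EFin \o \1_B).
      apply: (@bounded_integrable _ _ _ (unit_prob R) _ 1); first exact: measurable_indic.
      by move=> u; rewrite indicE; case: (_ \in _); rewrite /= ?normr1 ?normr0.
    rewrite -(RintegralZl peak measurableT iB).
    exact: (RintegralD measurableT Icst IB).
  have -> : \int[unit_prob R]_u cst c1 u = c1.
    rewrite Rintegral_cst// -[RHS]mulr1; congr (_ * _).
    exact: (congr1 fine (probability_setT (unit_prob R))).
  rewrite /C mulrDl lerD// ler_pM2l ?gaussian_peak_gt0//.
  rewrite /Rintegral integral_indic// setIT -lee_fin fineK//.
  exact: fin_num_measure.
have m2lb : lb <= mixture m2 x.
  apply: le_trans (mixture_ge x mm2); rewrite ler_pM2l ?gaussian_peak_gt0//.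
  rewrite ler_expR lerN2 ler_pM2r ?invr_gt0// lerD2r ler_pM2l//.
  by rewrite lerXn2r ?nnegrE// enorm_ge0.
apply: (ln_sub_le _ lb0 m2lb (ltW e0)); first exact: mixture_gt0.
by rewrite (le_trans diff)// /e1 mulrC divfK ?gt_eqF.
Qed.

End mixtures.

(** * Compactness and mixing laws *)

Lemma ultra_fmap T U (f : T -> U) (F : set_system T) :
  UltraFilter F -> UltraFilter (f @ F).
Proof.
move=> UF; have PF : ProperFilter F by exact: ultra_proper.
split; first exact: fmap_proper_filter.
move=> G GF sFG; apply/seteqP; split => // A GA.
have [//|nA] := in_ultra_setVsetC (f @^-1` A) UF.
have GnA : G (~` A) by apply: sFG; exact: nA.
by have [x []] := filter_ex (filterI GA GnA).
Qed.

Section compactness.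
Context (R : realType) (n : nat).
Local Notation E := 'rV[R]_n.
Context (Theta : set E).

Fixpoint words_upto (k : nat) : seq (seq bool) :=
  if k is k'.+1 then
    [::] :: map (cons true) (words_upto k') ++ map (cons false) (words_upto k')
  else [:: [::]].

Lemma mem_words_upto k w : (size w <= k)%N -> w \in words_upto k.
Proof.
elim: k w => [|k IH] [|b w] //=.
rewrite ltnS => /IH wk; rewrite inE mem_cat.
by case: b; rewrite (map_f (cons _) wk) ?orbT.
Qed.

Lemma filter_all_in T (F : set_system T) {FF : Filter F} (I : eqType) (s : seq I)
    (Q : I -> T -> Prop) :
  (forall i, \forall x \near F, Q i x) -> \forall x \near F, forall i, i \in s -> Q i x.
Proof.
move=> FQ; elim: s => [|i s IH]; first by apply: nearW => x i; rewrite in_nil.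
apply: filterS2 (FQ i) IH => x Qi Qs j; rewrite inE => /predU1P[->//|]; exact: Qs.
Qed.

Lemma mass_system_le1 m w : mass_system Theta m -> m w <= 1.
Proof.
move=> mm; apply: le_trans (right_end_le1 mm w).
by rewrite lerDr (left_end_ge0 mm).
Qed.

(* Compactness of the set of laws on [Theta], in place of Prokhorov's theorem. *)
Lemma mass_system_compact (U : set_system nat) (ms : nat -> seq bool -> R) :
  UltraFilter U -> (forall i, mass_system Theta (ms i)) ->
  exists2 m, mass_system Theta m & forall k (dl : R), 0 < dl ->
    \forall i \near U, forall w, (size w <= k)%N -> `|ms i w - m w| <= dl.
Proof.
move=> UU mms; have PU : ProperFilter U by exact: ultra_proper.
pose m : seq bool -> R := fun w => lim (ms i w @[i --> U]).
have mP w : ms i w @[i --> U] --> m w.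
  have := @segment_compact R 0 1; rewrite compact_ultra => /(_ (ms i w @[i --> U])).
  case=> [||l [_ msl]]; last by apply/cvg_ex; exists l.
    exact: ultra_fmap.
  apply: nearW => i; rewrite /= in_itv/= (mass_system_le1 _ (mms i)) andbT.
  by case: (mms i).
exists m; last first.
  move=> k dl dl0; have key w : \forall i \near U, `|ms i w - m w| <= dl.
    by have /cvgrPdist_le/(_ _ dl0) := mP w; apply: filterS => i; rewrite distrC.
  apply: filterS (filter_all_in (words_upto k) key) => i H w wk.
  exact: H (mem_words_upto wk).
split.
- have := mP [::]; under eq_fun do rewrite (let: And4 h _ _ _ := mms _ in h).
  by move=> /cvg_unique; apply => //; exact: cvg_cst.
- move=> w; apply: cvgr_to_ge (mP w) _; apply: nearW => i.
  by case: (mms i).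
- move=> w; have := mP w; under eq_fun do rewrite (let: And4 _ _ h _ := mms _ in h w).
  move=> /cvg_unique; apply => //; exact: cvgD.
(* That a cell meets Theta does not involve the masses, so one index with positive mass suffices. *)
- move=> w w0; have : \forall i \near U, 0 < ms i w by exact: cvgr_gt (mP w) _ w0.
  by move=> /filter_ex[i] mi; have [_ _ _ h] := mms i; exact: h mi.
Qed.

End compactness.

Section law.
Context (R : realType) d1 d2 (T : measurableType d1) (U : measurableType d2).
Context (P : probability T R).

Definition law (h : T -> U) (mh : measurable_fun setT h) : probability U R :=
  distribution P (MeasurableFun.Pack (MeasurableFun.Class (isMeasurableFun.Build _ _ _ _ h mh))).

Lemma ge0_integral_law (Q : probability U R) (h : T -> U) (D : set U) (f : U -> \bar R) :
  measurable_fun setT h ->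
  (forall A, measurable A -> Q A = P (h @^-1` A)) ->
  measurable D -> measurable_fun D f -> (forall x, D x -> 0 <= f x)%E ->
  (\int[Q]_(x in D) f x = \int[P]_(t in h @^-1` D) f (h t))%E.
Proof.
move=> mh Qh mD mf f0.
transitivity (\int[law mh]_(x in D) f x)%E.
  by apply: eq_measure_integral => A mA _; exact: Qh.
by rewrite ge0_integral_pushforward// => x /set_mem; exact: f0.
Qed.

End law.

Section midpoint.
Context (R : realType) d (T : measurableType d) (P Q : probability T R).

Definition midpoint : set T -> \bar R := mscale (2^-1)%:nng (measure_add P Q).

HB.instance Definition _ := Measure.on midpoint.

Lemma midpointE A : midpoint A = (2^-1%:E * (P A + Q A))%E.
Proof. exact: (congr1 (fun y => (2^-1%:E * y)%E) (measure_addE P Q A)). Qed.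

Lemma midpoint1 A : P A = 1%E -> Q A = 1%E -> midpoint A = 1%E.
Proof. by move=> PA QA; rewrite midpointE PA QA -EFinD -EFinM; congr _%:E; field. Qed.

HB.instance Definition _ := Measure_isProbability.Build _ _ R midpoint
  (midpoint1 (probability_setT P) (probability_setT Q)).

Lemma ge0_integral_midpoint (D : set T) (f : T -> \bar R) : measurable D ->
  measurable_fun D f -> (forall x, D x -> 0 <= f x)%E ->
  (\int[midpoint]_(x in D) f x =
   2^-1%:E * (\int[P]_(x in D) f x + \int[Q]_(x in D) f x))%E.
Proof. by move=> mD mf f0; rewrite ge0_integral_mscale// ge0_integral_measure_add. Qed.

End midpoint.

Section mixture_law.
Context (R : realType) (n : nat).
Local Notation E := 'rV[R]_n.
Context (Theta : set E) (Theta_compact : compact Theta) (Theta_nonempty : Theta !=set0).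
Context (sigma : R) (sigma_gt0 : 0 < sigma).
Local Notation mass := (mass_system Theta).

Definition skorokhod_law m (mm : mass m) : probability E R :=
  law (unit_prob R) (measurable_skorokhod Theta_compact Theta_nonempty mm).

Lemma supported_on_skorokhod_law m (mm : mass m) : supported_on Theta (skorokhod_law mm).
Proof.
rewrite /supported_on -(probability_setT (unit_prob R)); congr (unit_prob R _).
by apply/seteqP; split => // u _; exact: (skorokhod_Theta Theta_compact Theta_nonempty u mm).
Qed.

Lemma measurable_shifted_gaussian (x : E) :
  measurable_fun setT (fun t : E => gaussian_density sigma (x - t)).
Proof.
apply: (measurableT_comp (measurable_gaussian_density sigma)).
apply: measurable_rVP => i; under [X in measurable_fun _ X]eq_fun do rewrite !mxE.
by apply: measurable_funB => //; exact: measurable_coord.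
Qed.

Lemma gaussian_mixtureE m (G : probability E R) : mass m ->
  (forall A, measurable A -> G A = unit_prob R (skorokhod Theta m @^-1` A)) ->
  gaussian_mixture Theta sigma G = mixture Theta sigma m.
Proof.
move=> mm Gm; apply/funext => x; rewrite /gaussian_mixture /mixture /Rintegral; congr fine.
have mh := measurable_skorokhod Theta_compact Theta_nonempty mm.
rewrite (ge0_integral_law mh Gm).
- rewrite (_ : skorokhod Theta m @^-1` Theta = setT)//.
  apply/seteqP; split => // u _.
  exact: (skorokhod_Theta Theta_compact Theta_nonempty u mm).
- exact: measurable_Theta.
- by apply/measurable_EFinP; apply: measurable_funTS; exact: measurable_shifted_gaussian.
- by move=> t _; rewrite lee_fin ltW// gaussian_density_gt0.
Qed.

Lemma gaussian_mixture_skorokhod_law m (mm : mass m) :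
  gaussian_mixture Theta sigma (skorokhod_law mm) = mixture Theta sigma m.
Proof. exact: (gaussian_mixtureE mm (G := skorokhod_law mm) (fun _ _ => erefl)). Qed.

(** Supplies the competitor to which strict concavity of the logarithm is applied: the midpoint is
    formed on laws and then represented again. *)
Lemma mixture_midpoint m1 m2 : mass m1 -> mass m2 -> exists2 m3, mass m3 &
  forall x, mixture Theta sigma m3 x =
    2^-1 * (mixture Theta sigma m1 x + mixture Theta sigma m2 x).
Proof.
move=> mm1 mm2; pose G := midpoint (skorokhod_law mm1) (skorokhod_law mm2) : probability E R.
have GT : supported_on Theta G.
  by apply: midpoint1; exact: supported_on_skorokhod_law.
have [m3 mm3 Gm3] := supported_representation Theta_compact Theta_nonempty GT.
exists m3 => // x.
rewrite -(gaussian_mixtureE mm3 Gm3).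
rewrite -(gaussian_mixture_skorokhod_law mm1) -(gaussian_mixture_skorokhod_law mm2).
have f0 (t : E) : Theta t -> (0 <= (gaussian_density sigma (x - t))%:E)%E.
  by move=> _; rewrite lee_fin ltW// gaussian_density_gt0.
have mf : measurable_fun Theta (fun t : E => (gaussian_density sigma (x - t))%:E).
  by apply/measurable_EFinP; apply: measurable_funTS; exact: measurable_shifted_gaussian.
rewrite /gaussian_mixture /Rintegral.
rewrite (ge0_integral_midpoint _ _ (measurable_Theta Theta_compact) mf f0).
have fin (Q : probability E R) :
    (\int[Q]_(t in Theta) (gaussian_density sigma (x - t))%:E)%E \is a fin_num.
  apply: integrable_fin_num; first exact: measurable_Theta.
  apply: (@integrableS _ _ _ Q setT) => //; first exact: measurable_Theta.
  apply: (bounded_integrable Q (measurable_shifted_gaussian x)) => t.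
  by rewrite gtr0_norm ?gaussian_density_gt0//; exact: gaussian_density_le_peak.
have avg (a b : \bar R) : a \is a fin_num -> b \is a fin_num ->
    fine (2^-1%:E * (a + b))%E = 2^-1 * (fine a + fine b).
  by move=> /fineK <- /fineK <-.
exact: avg (fin _) (fin _).
Qed.

End mixture_law.

(** * Identifiability of mixtures *)

Section mixture_identifiable.
Context (R : realType) (n : nat).
Local Notation E := 'rV[R]_n.
Context (Theta : set E) (Theta_compact : compact Theta) (Theta_nonempty : Theta !=set0).
Context (sigma : R) (sigma_gt0 : 0 < sigma).
Context (D : R) (D0 : 0 <= D).
Hypothesis ThetaD : forall t, Theta t -> forall i, `|t ord0 i| <= D.
Local Notation h := (skorokhod Theta).
Local Notation mass := (mass_system Theta).

(** Expanding the square factors the density at x - t as peak exp(-c |x|^2) times [damp t] times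
    exp(<kappa x, t>). Hence [lap] is the Laplace transform of the mixing law weighted by [damp]. *)
Let c := (2 * sigma ^+ 2)^-1.
Let kappa := (sigma ^+ 2)^-1.
Let damp (t : E) := expR (- (c * \sum_i t ord0 i ^+ 2)).

Let hD m u i : mass m -> `|h m u ord0 i| <= D.
Proof. by move=> mm; apply: ThetaD; exact: skorokhod_Theta. Qed.

Let mh m : mass m -> measurable_fun setT (h m : measurableTypeR R -> E).
Proof. exact: (measurable_skorokhod Theta_compact Theta_nonempty). Qed.

Let mdamp : measurable_fun setT damp.
Proof.
apply: measurableT_comp => //; apply: measurableT_comp => //; apply: measurable_funM => //.
by apply: measurable_sum => i; apply: measurable_funX; exact: measurable_coord.
Qed.

Let damp_le1 t : `|damp t| <= 1.
Proof.
rewrite gtr0_norm ?expR_gt0// expR_le1 oppr_le0 mulr_ge0//.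
  by rewrite invr_ge0 mulr_ge0// sqr_ge0.
by apply: sumr_ge0 => i _; exact: sqr_ge0.
Qed.

Let lap m (y : E) := \int[unit_prob R]_u (damp (h m u) * expR (dotrV y (h m u))).

Let mlap_integrand m y : mass m -> measurable_fun setT
  (fun u : measurableTypeR R => damp (h m u) * expR (dotrV y (h m u))).
Proof.
move=> mm; apply: (measurableT_comp (f := fun t : E => damp t * expR (dotrV y t)) _ (mh mm)).
apply: measurable_funM; first exact: mdamp.
by apply: measurableT_comp => //; exact: measurable_dotrV.
Qed.

Let lap_bounded (y : E) : exists B, forall t : E, (forall i, `|t ord0 i| <= D) ->
  `|damp t * expR (dotrV y t)| <= B.
Proof.
have [B yB] := bounded_on_cube_expR (bounded_on_cube_dot D y).
exists B => t tD; rewrite normrM (le_trans _ (yB t tD))//.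
by rewrite ler_piMl.
Qed.

Let mixture_lap m x : mass m ->
  mixture Theta sigma m x =
  gaussian_peak n sigma * expR (- (c * enorm x ^+ 2)) * lap m (kappa *: x).
Proof.
move=> mm; rewrite /lap /mixture.
have [B xB] := lap_bounded (kappa *: x).
have i1 := bounded_integrable (unit_prob R) (mlap_integrand (kappa *: x) mm)
  (fun u => xB _ (fun i => hD u i mm)).
rewrite -(RintegralZl _ measurableT i1); apply: eq_Rintegral => u _.
move: (h m u) => t; rewrite gaussian_densityE -[RHS]mulrA -!expRD; congr (_ * expR _).
rewrite !enormE /dotrV [X in - X]mulrC !mulr_sumr -!sumrN -!big_split/=.
apply: eq_bigr => i _; rewrite !mxE /c /kappa; field.
by rewrite gt_eqF.
Qed.

Let measurable_lap m : mass m -> measurable_fun setT (fun x : E => lap m (kappa *: x)).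
Proof.
move=> mm; rewrite (_ : (fun _ => _) = fun x => (gaussian_peak n sigma)^-1 *
    expR (c * enorm x ^+ 2) * mixture Theta sigma m x); last first.
  apply/funext => x; rewrite mixture_lap// expRN.
  move: (lap _ _) => l; field.
  by rewrite !gt_eqF ?gaussian_peak_gt0 ?expR_gt0.
apply: measurable_funM; last exact: measurable_mixture.
apply: measurable_funM => //; apply: measurableT_comp => //; apply: measurable_funM => //.
by apply: measurable_funX; exact: measurable_enorm.
Qed.

Let entire_lap m : mass m -> separately_entire (D * kappa) (fun x : E => lap m (kappa *: x)).
Proof.
move=> mm x i.
have k0 : 0 <= kappa by rewrite invr_ge0 sqr_ge0.
(* The coordinates held fixed go into the weight; coordinate i alone drives the exponential. *)
pose y : E := \row_j (if j == i then 0 else kappa * x ord0 j).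
have [B yB] := lap_bounded y.
have := @entire_type_Rintegral R _ _ (unit_prob R)
  (fun u => damp (h m u) * expR (dotrV y (h m u))) (fun u => h m u ord0 i * kappa) B (D * kappa).
rewrite [X in _ -> _ -> _ -> _ -> X](_ : _ = entire_type (D * kappa)
  (fun t => lap m (kappa *: (\row_j (if j == i then t else x ord0 j))))); last first.
  congr entire_type; apply/funext => t; apply: eq_Rintegral => u _; rewrite -mulrA -expRD.
  move: (h m u) => v.
  congr (_ * expR _); rewrite /dotrV (bigD1 i)//= [RHS](bigD1 i)//= !mxE eqxx mul0r add0r addrC.
  congr (_ + _); last by ring.
  by apply: eq_bigr => j /negbTE ji; rewrite !mxE ji.
apply; first exact: mlap_integrand.
- apply: measurable_funM => //; exact: (measurableT_comp (measurable_coord i) (mh mm)).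
- by move=> u; apply: yB => j; exact: hD.
- by move=> u; rewrite normrM (ger0_norm k0) ler_wpM2r// hD.
Qed.

Lemma mixture_identifiable m1 m2 : mass m1 -> mass m2 ->
  lebesgue_rV R n [set x | mixture Theta sigma m1 x = mixture Theta sigma m2 x] != 0%E ->
  forall A, measurable A -> unit_prob R (h m1 @^-1` A) = unit_prob R (h m2 @^-1` A).
Proof.
move=> mm1 mm2 Z0; have k0 : 0 < kappa by rewrite invr_gt0 exprn_gt0.
pose f (x : E) := lap m1 (kappa *: x) - lap m2 (kappa *: x).
have gc0 (x : E) : gaussian_peak n sigma * expR (- (c * enorm x ^+ 2)) != 0.
  by rewrite gt_eqF// mulr_gt0 ?expR_gt0// gaussian_peak_gt0.
have f0 : forall x, f x = 0.
  apply: (@separately_entire_eq0 R n (D * kappa)); first by rewrite mulr_ge0// ltW.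
  - exact: (measurable_funB (measurable_lap mm1) (measurable_lap mm2)).
  - by move=> x i; apply: entire_typeB; exact: entire_lap.
  move: Z0; rewrite (_ : [set x | _] = f @^-1` [set 0])//; apply/seteqP; split => x /=.
    rewrite (mixture_lap x mm1) (mixture_lap x mm2) => /(mulfI (gc0 x)) mE.
    by rewrite /f; apply/eqP; rewrite subr_eq0; apply/eqP; exact: mE.
  by move=> /subr0_eq fx; rewrite (mixture_lap x mm1) (mixture_lap x mm2) fx.
apply: (@laplace_unique R n _ _ (unit_prob R) (h m1) _ _ (unit_prob R) (h m2) D
  (mh mm1) (mh mm2) (fun u i => hD u i mm1) (fun u i => hD u i mm2) c) => y.
have ky : kappa *: (kappa^-1 *: y) = y by rewrite scalerA divff ?scale1r// gt_eqF.
have := f0 (kappa^-1 *: y); rewrite /f ky.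
exact: subr0_eq.
Qed.

End mixture_identifiable.

(** * A one-sided law of large numbers *)

Lemma sum_inv_sqr_le (R : realType) K : \sum_(k < K) ((k.+1 ^ 2)%:R : R)^-1 <= 2.
Proof.
(* The sharper bound is what induction carries. *)
apply: (@le_trans _ _ (2 - 2 / K.+1%:R)); last by rewrite lerBlDr lerDl divr_ge0.
elim: K => [|K IH]; first by rewrite big_ord0 divr1 subrr.
rewrite big_ord_recr/=; apply: le_trans (lerD IH (lexx _)) _.
rewrite natrX; have K1 : 0 < K.+1%:R :> R by rewrite ltr0n.
have -> : K.+2%:R = K.+1%:R + 1 :> R by rewrite natr1.
have K1' : 1 <= K.+1%:R :> R by rewrite ler1n.
move: (K.+1%:R) K1 K1' => a a0 a1; rewrite -subr_ge0.
have -> : 2 - 2 / (a + 1) - (2 - 2 / a + a ^- 2) = (a - 1) / (a ^+ 2 * (a + 1)).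
  by field; rewrite !gt_eqF//; lra.
rewrite divr_ge0 ?subr_ge0// mulr_ge0 ?sqr_ge0//; lra.
Qed.

Lemma square_bracket n : (0 < n)%N -> exists k, (k ^ 2 < n <= k.+1 ^ 2)%N.
Proof.
elim: n => // -[_ _|n IH _]; first by exists 0%N.
have [k /andP[kn nk]] := IH isT; case: (ltnP n.+1 (k.+1 ^ 2)) => h.
  by exists k; rewrite h andbT ltnW.
exists k.+1; rewrite ltnS h/=; apply: leq_trans (_ : (k.+1 ^ 2).+1 <= _)%N; first by rewrite ltnS.
by rewrite ltn_exp2r.
Qed.

(* Sums of nonnegative terms are monotone, so the averages along the squares
   control all the others. *)
Lemma nneg_averages_le (R : realType) (x : nat -> R) (a : R) :
  (forall i, 0 <= x i) -> 0 <= a ->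
  ((\sum_(i < k.+1 ^ 2) x i) / (k.+1 ^ 2)%:R @[k --> \oo] --> a) ->
  forall e : R, 0 < e -> \forall n \near \oo, \sum_(i < n) x i <= n%:R * (a + e).
Proof.
move=> x0 a0 xa e e0; have e20 : 0 < e / 2 by rewrite divr_gt0.
have /cvgrPdist_le/(_ _ e20)[k0 _ k0P] := xa.
pose b := a + e / 2; have b0 : 0 < b by rewrite ltr_wpDl.
(* For k >= 1 one has (k + 1)^2 <= k^2 + 3 k, so 3 b <= k e / 2 absorbs the passage from k^2 to (k +
   1)^2. *)
pose K := maxn (maxn k0 1) (Num.truncn (3 * b / (e / 2))).+1.
exists ((K ^ 2).+1) => // n /= Kn.
have [k /andP[kn nk]] := square_bracket (leq_trans (ltn0Sn _) Kn).
have Kk : (K <= k)%N by rewrite -ltnS -(@ltn_exp2r _ _ 2)// (leq_trans Kn).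
have k0k : (k0 <= k)%N by rewrite (leq_trans _ Kk)// !leq_max leqnn.
have k1 : 1 <= k%:R :> R by rewrite ler1n (leq_trans _ Kk)// !leq_max leqnn orbT.
have kb : 3 * b <= k%:R * (e / 2).
  rewrite -ler_pdivrMr// ltW// (lt_le_trans (truncnS_gt _))// ler_nat (leq_trans _ Kk)//.
  by rewrite !leq_max leqnn !orbT.
have S1 : \sum_(i < k.+1 ^ 2) x i <= (k.+1 ^ 2)%:R * b.
  rewrite mulrC -ler_pdivrMr ?ltr0n ?expn_gt0//.
  have := k0P k k0k; rewrite ler_distlC /b => /andP[_]; exact.
apply: le_trans (_ : \sum_(i < k.+1 ^ 2) x i <= _).
  by rewrite -!(big_mkord xpredT x) (big_cat_nat _ nk)//= lerDl sumr_ge0.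
apply: le_trans S1 _; apply: le_trans (_ : (k ^ 2)%:R * (a + e) <= _).
  have -> : a + e = b + e / 2 by rewrite /b; field.
  rewrite !natrX -natr1; move: (k%:R) k1 kb => q q1 qb.
  have : 0 <= q * (q * (e / 2) - 3 * b) by rewrite mulr_ge0 ?subr_ge0//; lra.
  have : 0 <= (q - 1) * b by rewrite mulr_ge0 ?subr_ge0// ltW.
  by nra.
rewrite ler_wpM2r//; first lra.
by rewrite ler_nat ltnW.
Qed.

Section orthogonal_sums.
Context (R : realType) d (T : measurableType d) (P : probability T R).
Context (W : nat -> T -> R) (s : R).
Hypotheses (mW : forall i, measurable_fun setT (W i))
  (iW : forall i j, P.-integrable setT (EFin \o (fun t => W i t * W j t)))
  (orthW : forall i j, i != j -> \int[P]_t (W i t * W j t) = 0)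
  (sW : forall i, \int[P]_t (W i t * W i t) <= s).

Let S N t := \sum_(i < N) W i t.

Let iSW N j : P.-integrable setT (EFin \o (fun t => S N t * W j t)) /\
  ((N <= j)%N -> \int[P]_t (S N t * W j t) = 0).
Proof.
elim: N => [|N [IHi IH0]].
  have -> : (fun t => S 0 t * W j t) = cst 0 by apply/funext => t; rewrite /S big_ord0 mul0r.
  by split=> [|_]; [exact: finite_measure_integrable_cst|rewrite Rintegral_cst// mul0r].
have -> : (fun t => S N.+1 t * W j t) = fun t => S N t * W j t + W N t * W j t.
  by apply/funext => t; rewrite /S big_ord_recr mulrDl.
split=> [|Nj]; first exact: (integrableD measurableT IHi (iW N j)).
by rewrite (RintegralD measurableT IHi (iW N j)) IH0 1?ltnW// add0r orthW// ltn_eqF.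
Qed.

Let iSS N : P.-integrable setT (EFin \o (fun t => S N t ^+ 2)) /\
  \int[P]_t (S N t ^+ 2) <= N%:R * s.
Proof.
elim: N => [|N [IHi IHs]].
  have -> : (fun t => S 0 t ^+ 2) = cst 0 by apply/funext => t; rewrite /S big_ord0 expr0n.
  by split; [exact: finite_measure_integrable_cst|rewrite Rintegral_cst// !mul0r].
have -> : (fun t => S N.+1 t ^+ 2) = fun t => S N t ^+ 2 + (2 * (S N t * W N t) + W N t * W N t).
  by apply/funext => t; rewrite /S big_ord_recr/=; ring.
have [i1 i0] := iSW N N.
have i2 : P.-integrable setT (EFin \o (fun t => 2 * (S N t * W N t))).
  exact: (integrableZl measurableT 2 i1).
have i3 : P.-integrable setT (EFin \o (fun t => 2 * (S N t * W N t) + W N t * W N t)).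
  exact: (integrableD measurableT i2 (iW N N)).
split; first exact: (integrableD measurableT IHi i3).
rewrite (RintegralD measurableT IHi i3) (RintegralD measurableT i2 (iW N N)).
rewrite (RintegralZl _ measurableT i1) i0// mulr0 add0r -natr1 mulrDl mul1r.
exact: lerD.
Qed.

Let Z k t := S (k.+1 ^ 2) t / (k.+1 ^ 2)%:R.

Let iZ k : P.-integrable setT (EFin \o (fun t => Z k t ^+ 2)) /\
  \int[P]_t (Z k t ^+ 2) <= s / (k.+1 ^ 2)%:R.
Proof.
have [i1 i2] := iSS (k.+1 ^ 2); set N := (k.+1 ^ 2)%N in i1 i2 *.
have -> : (fun t => Z k t ^+ 2) = fun t => N%:R ^- 2 * S N t ^+ 2.
  by apply/funext => t; rewrite /Z exprMn exprVn mulrC.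
split; first exact: (integrableZl measurableT _ i1).
have N0 : 0 < N%:R :> R by rewrite ltr0n expn_gt0.
rewrite (RintegralZl _ measurableT i1) ler_pdivrMl ?exprn_gt0//.
rewrite (le_trans i2)// expr2 -mulrA ler_wpM2l ?ler0n// mulrCA mulfV ?mulr1 ?gt_eqF//.
Qed.

(** By orthogonality the average of (k + 1)^2 terms has second moment at most s / (k + 1)^2. These
    bounds are summable, so the sum of the squared averages is integrable, hence almost surely
    finite, and its terms tend to 0. *)
Lemma orthogonal_averages_cvg0 :
  {ae P, forall t, (\sum_(i < k.+1 ^ 2) W i t) / (k.+1 ^ 2)%:R @[k --> \oo] --> (0 : R)}.
Proof.
have s0 : 0 <= s.
  by apply: le_trans (sW 0); apply: Rintegral_ge0 => t _; exact: sqr_ge0.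
have mZ k : measurable_fun setT (fun t => (Z k t ^+ 2)%:E).
  by case: (iZ k) => /integrableP[].
pose f t := (\sum_(k <oo) (Z k t ^+ 2)%:E)%E.
have Z0 k t : (0 <= (Z k t ^+ 2)%:E)%E by rewrite lee_fin sqr_ge0.
have f0 t : (0 <= f t)%E by apply: nneseries_ge0 => k _ _; exact: Z0.
have mf : measurable_fun setT f.
  by apply: ge0_emeasurable_sum => // k t _ _; exact: Z0.
have fi : P.-integrable setT f.
  apply/integrableP; split => //.
  under eq_integral do rewrite gee0_abs//.
  rewrite integral_nneseries//; apply: (@le_lt_trans _ _ (s * 2)%:E); last exact: ltry.
  apply: lime_le.
    by apply: is_cvg_nneseries => k _ _; apply: integral_ge0 => t _; exact: Z0.
  apply: nearW => K; rewrite big_mkord.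
  apply: (@le_trans _ _ (\sum_(k < K) (s / (k.+1 ^ 2)%:R)%:E)%E).
    apply: lee_sum => k _; have [i1 i2] := iZ k.
    by rewrite -[leLHS]fineK ?lee_fin//; exact: (integrable_fin_num measurableT i1).
  by rewrite sumEFin lee_fin -mulr_sumr ler_wpM2l// sum_inv_sqr_le.
have := integrable_ae measurableT fi; apply: filterS => t /(_ Logic.I) ft.
have cZ : (series (fun k => Z k t ^+ 2) @ \oo) --> limn (series (fun k => Z k t ^+ 2)).
  apply: nondecreasing_is_cvgn.
    by apply: nondecreasing_series => k _ _; exact: sqr_ge0.
  exists (fine (f t)) => _ [K _ <-]; rewrite -lee_fin fineK// /series/= -sumEFin.
  by apply: nneseries_lim_ge => k _ _; exact: Z0.
have /cvg_series_cvg_0 : cvgn (series (fun k => Z k t ^+ 2)) by exact: cZ.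
move=> /cvgrPdist_lt H; apply/cvgrPdist_lt => e e0.
have := H _ (exprn_gt0 2 e0); apply: filterS => k.
rewrite !sub0r !normrN normrX => h.
by rewrite -(@ltr_pXn2r _ 2) ?nnegrE// ltW.
Qed.

End orthogonal_sums.

Section iid_averages.
Context (R : realType) (n : nat).
Local Notation E := 'rV[R]_n.
Local Notation mu := (lebesgue_rV R n).
Context (p0 : E -> R) (p0_density : is_density p0).

Let p0_ge0 x : 0 <= p0 x. Proof. by case: p0_density. Qed.
Let mp0 : measurable_fun setT p0. Proof. by case: p0_density. Qed.

(** Q is dominated by Lebesgue measure and its Radon-Nikodym derivative agrees with p0 almost
    everywhere. *)
Lemma ge0_integral_density (Q : probability E R) (f : E -> R) :
  (forall B, measurable B -> Q B = \int[mu]_(x in B) (p0 x)%:E)%E ->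
  measurable_fun setT f -> (forall x, 0 <= f x) ->
  (\int[Q]_x (f x)%:E = \int[mu]_x (p0 x * f x)%:E)%E.
Proof.
move=> Qp0 mf f0.
have ip0 : mu.-integrable setT (EFin \o p0).
  apply/integrableP; split; first exact/measurable_EFinP.
  under eq_integral do rewrite /= ger0_norm//.
  by case: p0_density => _ _ ->; rewrite ltry.
have Qmu : Q `<< mu.
  apply/null_content_dominatesP => B mB B0; rewrite (Qp0 _ mB).
  by apply: null_set_integral => //; apply: measurable_funTS; exact/measurable_EFinP.
have fE := Radon_Nikodym_SigmaFinite.f_integral Qmu.
have fi := Radon_Nikodym_SigmaFinite.f_integrable Qmu.
have aef : ae_eq mu setT (Radon_Nikodym_SigmaFinite.f Q mu) (EFin \o p0).
  apply: integral_ae_eq => //; first exact/measurable_EFinP.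
  by move=> B _ mB; exact: etrans (esym (fE _ mB)) (Qp0 _ mB).
rewrite -(Radon_Nikodym_SigmaFinite.change_of_variables Qmu)//; last exact/measurable_EFinP.
have mrn := measurable_int _ fi.
apply: ae_eq_integral => //.
- by apply: emeasurable_funM => //; exact/measurable_EFinP.
- by apply/measurable_EFinP; exact: measurable_funM.
apply: filterS aef => x /(_ Logic.I) /= fx _.
by rewrite fx EFinM muleC.
Qed.

Context d' (T : measurableType d') (P : probability T R) (Y : nat -> {RV P >-> E}).
Hypothesis iidY : iid_from p0 Y.

Let mY i : measurable_fun setT (Y i).
Proof. exact: measurable_funP. Qed.

Let EY i (f : E -> R) : measurable_fun setT f -> (forall x, 0 <= f x) ->
  (\int[P]_t (f (Y i t))%:E = \int[mu]_x (p0 x * f x)%:E)%E.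
Proof.
move=> mf f0; have [_ dY] := iidY.
rewrite -(ge0_integral_density (dY i))//.
rewrite (ge0_integral_law (P := P) (mY i))//.
  exact/measurable_EFinP.
by move=> x _; rewrite lee_fin.
Qed.

(** Independence over {i, j} identifies the law of the pair with a product measure on rectangles,
    hence everywhere; Tonelli then factors the integral. *)
Let EYY i j (f : E -> R) : i != j -> measurable_fun setT f -> (forall x, 0 <= f x) ->
  (\int[P]_t (f (Y i t) * f (Y j t))%:E =
   \int[P]_t (f (Y i t))%:E * \int[P]_t (f (Y j t))%:E)%E.
Proof.
move=> ij mf f0; have [indY _] := iidY.
have mYY : measurable_fun setT (fun t => (Y i t, Y j t)) by exact/measurable_fun_pairP.
pose Q1 := distribution P (Y i); pose Q2 := distribution P (Y j).
pose Q := law P mYY.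
have QE A B : measurable A -> measurable B -> Q (A `*` B) = (Q1 A * Q2 B)%E.
  move=> mA mB; pose C k := if k == i then A else if k == j then B else setT.
  have mC k : measurable (C k) by rewrite /C; case: ifPn => // _; case: ifPn.
  have := indY [fset i; j]%fset C mC.
  rewrite big_fsetU1/= ?inE// big_seq_fset1 /C eqxx (eq_sym j i) (negbTE ij) eqxx => <-.
  congr (P _); apply/seteqP; split => t /=.
    move=> [At Bt] k /=; rewrite !inE => /orP[]/eqP->; first by rewrite eqxx.
    by rewrite (eq_sym j i) (negbTE ij) eqxx.
  move=> H; split; first by have := H i; rewrite /= !inE !eqxx; exact.
  by have := H j; rewrite /= !inE eqxx orbT (eq_sym j i) (negbTE ij); exact.
have mff : measurable_fun setT (fun z : E * E => (f z.1 * f z.2)%:E).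
  apply/measurable_EFinP; apply: measurable_funM.
    exact: (measurableT_comp mf measurable_fst).
  exact: (measurableT_comp mf measurable_snd).
have ff0 (z : E * E) : (0 <= (f z.1 * f z.2)%:E)%E by rewrite lee_fin mulr_ge0.
transitivity (\int[Q]_z (f z.1 * f z.2)%:E)%E.
  by rewrite (ge0_integral_law (P := P) mYY).
transitivity (\int[(Q1 \x Q2)%E]_z (f z.1 * f z.2)%:E)%E.
  apply: eq_measure_integral => A mA _.
  exact: (esym (product_measure_unique QE mA)).
have mfE : measurable_fun setT (fun x => (f x)%:E) by exact/measurable_EFinP.
have fE0 (x : E) : setT x -> (0 <= (f x)%:E)%E by rewrite lee_fin.
rewrite fubini_tonelli1// /fubini_F.
under eq_integral => x _.
  rewrite (_ : (fun y => (f (x, y).1 * f (x, y).2)%:E) = fun y => ((f x)%:E * (f y)%:E)%E) //.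
  rewrite (ge0_integralZl_EFin _ measurableT)//.
  over.
have LQ k : (\int[distribution P (Y k)]_x (f x)%:E = \int[P]_t (f (Y k t))%:E)%E.
  by rewrite (ge0_integral_law (P := P) (mY k)).
rewrite -(LQ i) -(LQ j).
rewrite ge0_integralZr//; apply: integral_ge0 => x _; exact: fE0.
Qed.

(** The variables f(Y i) - a are orthogonal with second moment b - a^2 <= b. The exceptional set is
    common to all e. *)
Lemma iid_averages_le (f : E -> R) : measurable_fun setT f -> (forall x, 0 <= f x) ->
  mu.-integrable setT (EFin \o (fun x => p0 x * f x)) ->
  mu.-integrable setT (EFin \o (fun x => p0 x * f x ^+ 2)) ->
  {ae P, forall t, forall e : R, 0 < e -> \forall N \near \oo,
    \sum_(i < N) f (Y i t) <= N%:R * (\int[mu]_x (p0 x * f x) + e)}.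
Proof.
move=> mf f0 i1 i2; set a := \int[mu]_x (p0 x * f x); set b := \int[mu]_x (p0 x * f x ^+ 2).
have a0 : 0 <= a by apply: Rintegral_ge0 => x _; rewrite mulr_ge0.
have mf2 : measurable_fun setT (fun x => f x ^+ 2) by exact: measurable_funX.
have mX i : measurable_fun setT (fun t => f (Y i t)) by exact: (measurableT_comp mf (mY i)).
have eX i : (\int[P]_t (f (Y i t))%:E = a%:E)%E.
  by rewrite EY// /a fineK//; exact: (integrable_fin_num measurableT i1).
have eX2 i : (\int[P]_t (f (Y i t) * f (Y i t))%:E = b%:E)%E.
  rewrite (EY i mf2 (fun x => sqr_ge0 _)) /b fineK//.
  exact: (integrable_fin_num measurableT i2).
have ge0_int (g : T -> R) (c : R) : measurable_fun setT g -> (forall t, 0 <= g t) ->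
    (\int[P]_t (g t)%:E = c%:E)%E -> P.-integrable setT (EFin \o g).
  move=> mg g0 gc; apply/integrableP; split; first exact/measurable_EFinP.
  by under eq_integral do rewrite /= ger0_norm//; rewrite gc ltry.
have iX i : P.-integrable setT (EFin \o (fun t => f (Y i t))) by exact: ge0_int (eX i).
have iXX i j : P.-integrable setT (EFin \o (fun t => f (Y i t) * f (Y j t))).
  have [<-|ij] := eqVneq i j.
    by apply: ge0_int (eX2 i) => [|t]; [exact: measurable_funM|rewrite mulr_ge0].
  apply: (ge0_int _ (a * a)) => [|t|]; [exact: measurable_funM|by rewrite mulr_ge0|].
  by rewrite EYY// !eX.
have RX i : \int[P]_t f (Y i t) = a by rewrite /Rintegral eX.
pose W i t := f (Y i t) - a.
have WW i j : (fun t => W i t * W j t) =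
    (fun t => f (Y i t) * f (Y j t) - (a * (f (Y i t) + f (Y j t)) - a * a)).
  by apply/funext => t; rewrite /W; ring.
have iS i j : P.-integrable setT (EFin \o (fun t => f (Y i t) + f (Y j t))).
  exact: (integrableD measurableT (iX i) (iX j)).
have iaS i j : P.-integrable setT (EFin \o (fun t => a * (f (Y i t) + f (Y j t)))).
  exact: (integrableZl measurableT a (iS i j)).
have iaa : P.-integrable setT (EFin \o cst (a * a)) by exact: finite_measure_integrable_cst.
have iB i j : P.-integrable setT (EFin \o (fun t => a * (f (Y i t) + f (Y j t)) - a * a)).
  exact: (integrableB measurableT (iaS i j) iaa).
have RW i j : \int[P]_t (W i t * W j t) = \int[P]_t (f (Y i t) * f (Y j t)) - a * a.
  rewrite WW (RintegralB measurableT (iXX i j) (iB i j)) (RintegralB measurableT (iaS i j) iaa).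
  rewrite (RintegralZl _ measurableT (iS i j)) (RintegralD measurableT (iX i) (iX j)) !RX.
  rewrite Rintegral_cst// (congr1 fine (probability_setT P)) mulr1; ring.
have : {ae P, forall t, (\sum_(i < k.+1 ^ 2) W i t) / (k.+1 ^ 2)%:R @[k --> \oo] --> (0 : R)}.
  apply: (@orthogonal_averages_cvg0 _ _ _ P W b).
  - by move=> i j; rewrite WW; exact: (integrableB measurableT (iXX i j) (iB i j)).
  - by move=> i j ij; rewrite RW /Rintegral EYY// !eX /= subrr.
  - by move=> i; rewrite RW /Rintegral eX2 /= lerBlDr lerDl mulr_ge0.
apply: filterS => t Wt; apply: (nneg_averages_le (fun i => f0 (Y i t)) a0).
rewrite (_ : (fun _ => _) =
    fun k => (\sum_(i < k.+1 ^ 2) W i t) / (k.+1 ^ 2)%:R + a); last first.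
  apply/funext => k; rewrite /W sumrB sumr_const card_ord mulrBl.
  by rewrite -[a *+ _]mulr_natr mulfK ?subrK// pnatr_eq0 expn_eq0.
by rewrite -[X in _ --> X](add0r a); apply: cvgD; [exact: Wt|exact: cvg_cst].
Qed.

End iid_averages.

(** * Closeness in Wasserstein distance *)

Section mass_net.
Context (R : realType) (n : nat).
Local Notation E := 'rV[R]_n.
Context (Theta : set E).
Local Notation mass := (mass_system Theta).

(* Masses up to a given depth are rounded, and one mass system is chosen for
   each rounding pattern that occurs. *)
Lemma mass_net (m0 : seq bool -> R) : mass m0 ->
  exists2 net : nat -> seq bool -> R, forall j, mass (net j) &
  forall m k (dl : R), mass m -> 0 < dl ->
    exists j, forall w, (size w <= k)%N -> `|m w - net j w| <= dl.
Proof.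
move=> mm0.
pose rounded (i : nat * nat * seq nat) (m : seq bool -> R) :=
  i.2 = [seq Num.truncn (m w * i.1.2.+1%:R) | w <- words_upto i.1.1].
have repr i : exists m, mass m /\ ((exists m', mass m' /\ rounded i m') -> rounded i m).
  have [[m [mm im]]|no] := pselect (exists m, mass m /\ rounded i m); first by exists m.
  by exists m0; split.
pose net j := if @choice.unpickle (nat * nat * seq nat)%type j is Some i
  then projT1 (cid (repr i)) else m0.
exists net.
  by move=> j; rewrite /net; case: choice.unpickle => // i; case: cid => ? [].
(* Equal roundings put two masses within 1 / (N + 1) < dl of each other. *)
move=> m k dl mm dl0; pose N := Num.truncn dl^-1.
pose i : nat * nat * seq nat :=
  (k, N, [seq Num.truncn (m w * N.+1%:R) | w <- words_upto k]).
exists (choice.pickle i) => w wk; rewrite /net choice.pickleK.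
case: cid => /= m' [mm' /(_ (ex_intro _ m (conj mm erefl)))].
move=> /eq_in_map/(_ _ (mem_words_upto wk)) mw.
have N0 : 0 < N.+1%:R :> R by rewrite ltr0n.
have ge0 m1 : mass m1 -> 0 <= m1 w * N.+1%:R.
  by case=> _ h _ _; rewrite mulr_ge0 ?ler0n.
have /andP[a1 a2] := truncn_itv (ge0 _ mm); have /andP[b1 b2] := truncn_itv (ge0 _ mm').
rewrite -mw in b1 b2.
apply: le_trans (_ : N.+1%:R^-1 <= _); last first.
  by rewrite -(ler_pM2l N0) mulfV ?gt_eqF// -ler_pdivrMr// div1r ltW// truncnS_gt.
rewrite -(ler_pM2r N0) mulVf ?gt_eqF// -[X in _ * X](gtr0_norm N0) -normrM mulrBl.
rewrite ler_distlC; move: a1 a2 b1 b2.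
move: (Num.truncn _) => q; move: (m w * _) (m' w * _) => a b.
by rewrite -natr1 => *; lra.
Qed.

End mass_net.

Section wasserstein_close.
Context (R : realType) (n : nat).
Local Notation E := 'rV[R]_n.
Context (Theta : set E) (Theta_compact : compact Theta) (Theta_nonempty : Theta !=set0).
Local Notation h := (skorokhod Theta).
Local Notation mass := (mass_system Theta).

Lemma enorm_le_cube (x : E) (e : R) : 0 <= e -> (forall i, `|x ord0 i| <= e) ->
  enorm x <= n%:R * e.
Proof.
move=> e0 xe; rewrite -(@ler_pXn2r _ 2) ?nnegrE ?mulr_ge0 ?enorm_ge0// enormE.
apply: (@le_trans _ _ (\sum_(i < n) e ^+ 2)).
  by apply: ler_sum => i _; rewrite -real_normK ?num_real// lerXn2r ?nnegrE.
rewrite sumr_const card_ord -[leLHS]mulr_natl exprMn; apply: ler_wpM2r; first exact: sqr_ge0.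
by rewrite -natrX ler_nat; case: n => // k; rewrite expnS expn1 leq_pmulr.
Qed.

Lemma coupling_bound (r : R) (m1 m2 : seq bool -> R) (G1 G2 : probability E R) (c : \bar R) :
  0 <= r -> mass m1 -> mass m2 ->
  (forall A, measurable A -> G1 A = unit_prob R (h m1 @^-1` A)) ->
  (forall A, measurable A -> G2 A = unit_prob R (h m2 @^-1` A)) ->
  (\int[unit_prob R]_u (enorm (h m1 u - h m2 u) `^ r)%:E <= c)%E ->
  (wasserstein Theta r G1 G2 <= poweR c r^-1)%E.
Proof.
move=> r0 mm1 mm2 G1E G2E le_c.
have mh1 := measurable_skorokhod Theta_compact Theta_nonempty mm1.
have mh2 := measurable_skorokhod Theta_compact Theta_nonempty mm2.
have mhh : measurable_fun setT (fun u => (h m1 u, h m2 u)) by exact/measurable_fun_pairP.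
pose Q := law (unit_prob R) mhh.
have mT := measurable_Theta Theta_compact.
have mdist : measurable_fun setT (fun z : E * E => (enorm (z.1 - z.2) `^ r)%:E).
  apply/measurable_EFinP; apply: (measurableT_comp (measurable_powR r)).
  apply: measurableT_comp; first exact: measurable_enorm.
  apply: measurable_rVP => i; under [X in measurable_fun _ X]eq_fun do rewrite !mxE.
  apply: measurable_funB.
    exact: (measurableT_comp (measurable_coord i) measurable_fst).
  exact: (measurableT_comp (measurable_coord i) measurable_snd).
have QI : (\int[Q]_(z in Theta `*` Theta) (enorm (z.1 - z.2) `^ r)%:E =
    \int[unit_prob R]_u (enorm (h m1 u - h m2 u) `^ r)%:E)%E.
  rewrite (ge0_integral_law (P := unit_prob R) mhh)//.
  - rewrite (_ : _ @^-1` _ = setT)//; apply/seteqP; split => // u _; split.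
      exact: (skorokhod_Theta Theta_compact Theta_nonempty u mm1).
    exact: (skorokhod_Theta Theta_compact Theta_nonempty u mm2).
  - exact: measurableX.
  - exact: measurable_funTS.
  - by move=> z _; rewrite lee_fin powR_ge0.
have cQ : couplings G1 G2 Q.
  move=> A mA; rewrite G1E// G2E//; split.
    by congr (unit_prob R _); apply/seteqP; split => u /=; [case|split].
  by congr (unit_prob R _); apply/seteqP; split => u /=; [case|split].
have le0 : (0 <= ereal_inf [set \int[g]_(z in Theta `*` Theta) (enorm (z.1 - z.2) `^ r)%:E
    | g in couplings G1 G2])%E.
  apply: le_ereal_inf_tmp => _ [g _ <-]; apply: integral_ge0 => z _.
  by rewrite lee_fin powR_ge0.
have lec : (ereal_inf [set \int[g]_(z in Theta `*` Theta) (enorm (z.1 - z.2) `^ r)%:E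
    | g in couplings G1 G2] <= c)%E.
  by apply: le_trans le_c; rewrite -QI; apply: ereal_inf_lbound; exists Q.
apply: gt0_ler_poweR => //; first by rewrite invr_ge0.
  by rewrite in_itv/= le0 leey.
by rewrite in_itv/= (le_trans le0 lec) leey.
Qed.

(** The budget e^r is halved. Off the exceptional event the distance is at most [c1], with c1^r =
    e^r / 2; on it the r-th power of the distance is at most [c2], and the event has probability at
    most [d2]. *)
Lemma wasserstein_close (D r e : R) : 0 <= D ->
  (forall t, Theta t -> forall i, `|t ord0 i| <= D) -> 1 <= r -> 0 < e ->
  exists k, exists2 dl : R, 0 < dl & forall m1 m2, mass m1 -> mass m2 ->
    (forall w, (size w <= k)%N -> `|m1 w - m2 w| <= dl) ->
    forall G1 G2 : probability E R,
    (forall A, measurable A -> G1 A = unit_prob R (h m1 @^-1` A)) ->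
    (forall A, measurable A -> G2 A = unit_prob R (h m2 @^-1` A)) ->
    (wasserstein Theta r G1 G2 <= e%:E)%E.
Proof.
move=> D0 ThetaD r1 e0; have r0 : 0 < r by rewrite (lt_le_trans ltr01).
have er0 : 0 < (e `^ r) / 2 by rewrite divr_gt0// powR_gt0.
pose c1 := (e `^ r / 2) `^ r^-1; have c10 : 0 < c1 by rewrite powR_gt0.
pose c2 := (n%:R * (2 * D)) `^ r; have c20 : 0 <= c2 by exact: powR_ge0.
(* The added 1 keeps the denominators positive when n = 0 or D = 0. *)
pose d1 := c1 / n.+1%:R; pose d2 := (e `^ r / 2) / (c2 + 1).
have d10 : 0 < d1 by rewrite divr_gt0.
have d20 : 0 < d2 by rewrite divr_gt0// ltr_wpDl.
have dm0 : 0 < Num.min d1 d2 by rewrite lt_min d10.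
have [k [dl dl0 kP]] := skorokhod_unif_close Theta_compact Theta_nonempty dm0.
exists k, dl => // m1 m2 mm1 mm2 m12 G1 G2 G1E G2E.
have [B [mB UB] hB] := kP _ _ mm1 mm2 m12.
have m1B : measurable_fun setT (fun u : measurableTypeR R => \1_B u : R).
  exact: measurable_indic.
have powE : e%:E = poweR (e `^ r)%:E r^-1.
  by rewrite poweR_EFin -powRrM mulfV ?gt_eqF// powRr1// ltW.
rewrite powE; apply: (coupling_bound _ mm1 mm2 G1E G2E); first exact: ltW.
apply: (@le_trans _ _ (\int[unit_prob R]_u (e `^ r / 2 + c2 * \1_B u)%:E)%E).
  apply: ge0_le_integral => //.
  - by move=> u _; rewrite lee_fin powR_ge0.
  - apply/measurable_EFinP; apply: (measurableT_comp (measurable_powR r)).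
    have mh1 := measurable_skorokhod Theta_compact Theta_nonempty mm1.
    have mh2 := measurable_skorokhod Theta_compact Theta_nonempty mm2.
    apply: measurableT_comp; first exact: measurable_enorm.
    apply: measurable_rVP => i.
    rewrite (_ : (fun _ => _) = fun u => h m1 u ord0 i - h m2 u ord0 i); last first.
      by apply/funext => u; rewrite [LHS]mxE [X in _ + X = _]mxE.
    apply: measurable_funB.
      exact: (measurableT_comp (measurable_coord i) mh1).
    exact: (measurableT_comp (measurable_coord i) mh2).
  - apply/measurable_EFinP; apply: measurable_funD; first exact: measurable_cst.
    by apply: measurable_funM; [exact: measurable_cst|exact: m1B].
  - move=> u _; rewrite lee_fin; have [Bu|nBu] := pselect (B u).
      rewrite indicE mem_set// mulr1 ler_wpDl ?(ltW er0)//.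
      apply: ge0_ler_powR; rewrite ?nnegrE ?enorm_ge0 ?(ltW r0) ?mulr_ge0//.
      apply: enorm_le_cube; first by rewrite mulr_ge0.
      move=> i; rewrite [X in `|X|]mxE [X in `|_ + X|]mxE (le_trans (ler_normB _ _))//.
      rewrite mulr_natl mulr2n lerD//; apply: ThetaD.
        exact: (skorokhod_Theta Theta_compact Theta_nonempty u mm1).
      exact: (skorokhod_Theta Theta_compact Theta_nonempty u mm2).
    rewrite indicE memNset// mulr0 addr0.
    have -> : e `^ r / 2 = c1 `^ r by rewrite /c1 -powRrM mulVf ?gt_eqF// powRr1// ltW.
    apply: ge0_ler_powR; rewrite ?nnegrE ?enorm_ge0 ?(ltW r0) ?(ltW c10)//.
    apply: (@le_trans _ _ (n%:R * d1)); last first.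
      by rewrite /d1 mulrCA ger_pMr// ler_pdivrMr// mul1r ler_nat.
    apply: enorm_le_cube; first exact: ltW.
    move=> i; rewrite [X in `|X|]mxE [X in `|_ + X|]mxE.
    by rewrite (le_trans (hB u nBu i))// ge_min lexx.
have IE (a : R) : 0 <= a ->
    (\int[unit_prob R]_u (a + c2 * \1_B u)%:E = a%:E + c2%:E * unit_prob R B)%E.
  move=> a0; under eq_integral do rewrite EFinD EFinM.
  have mi : measurable_fun setT (fun u : measurableTypeR R => (\1_B u : R)%:E).
    by apply/measurable_EFinP; exact: m1B.
  have i0 (u : measurableTypeR R) : (0 <= (\1_B u : R)%:E)%E by rewrite lee_fin.
  rewrite ge0_integralD//; [|by move=> u _; rewrite mule_ge0 ?lee_fin|exact: measurable_funeM].
  rewrite integral_cst// ge0_integralZl_EFin// integral_indic// setIT.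
  rewrite -[X in _ = (X + _)%E]mule1; congr (_ * _ + _)%E.
  exact: (probability_setT (unit_prob R)).
rewrite (IE _ (ltW er0)) [leRHS](_ : _ = (e `^ r / 2)%:E + (e `^ r / 2)%:E)%E; last first.
  by rewrite -EFinD -splitr.
rewrite leeD2l//; apply: (@le_trans _ _ (c2%:E * (Num.min d1 d2)%:E)%E).
  by apply: lee_wpmul2l; rewrite ?lee_fin.
rewrite -EFinM lee_fin.
apply: (@le_trans _ _ (c2 * d2)); first by rewrite ler_wpM2l// ge_min lexx orbT.
rewrite /d2 mulrCA ger_pMr// ler_pdivrMr ?ltr_wpDl// mul1r.
by rewrite lerDl.
Qed.

End wasserstein_close.

(** * Minimization of the Kullback-Leibler divergence *)

Lemma mul_ln_div (R : realType) (q a b : R) : 0 <= q -> 0 < a -> 0 < b ->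
  q * ln (q / a) = q * ln (q / b) - q * (ln a - ln b).
Proof.
rewrite le_eqVlt => /predU1P[<- _ _|q0 a0 b0]; first by rewrite !mul0r subr0.
by rewrite !ln_div ?posrE//; ring.
Qed.

Lemma add_le_sqr (R : realFieldType) (e D : R) : 0 <= D ->
  e + D <= (1 + D) * (e ^+ 2 + 1).
Proof. by move=> D0; have := sqr_ge0 (e - 1); have := mulr_ge0 D0 (sqr_ge0 e); nra. Qed.

Lemma sqr_add_le (R : realFieldType) (e D : R) :
  (e + D) ^+ 2 <= 2 * (1 + D ^+ 2) * (e ^+ 2 + 1).
Proof. by have := sqr_ge0 (e - D); have := sqr_ge0 (e * D); nra. Qed.

Lemma le_add_halves (R : realFieldType) (a b c e : R) :
  a <= b + e / 2 -> c - a <= e / 2 -> c <= b + e.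
Proof. lra. Qed.

Lemma subrBB (V : zmodType) (a b c : V) : a - c - (b - c) = a - b.
Proof. by rewrite opprB addrA subrK. Qed.

Lemma subr_midpoint (R : realFieldType) (a b c e : R) :
  a - e - 2^-1 * (b - e + (c - e)) = a - 2^-1 * (b + c).
Proof. by field. Qed.

Lemma mulr_sub_midpoint (R : realFieldType) (p a b c : R) :
  p * (a - 2^-1 * (b + c)) = p * a - 2^-1 * (p * b + p * c).
Proof. by ring. Qed.

Lemma sub_midpoint_le0 (R : realFieldType) (a b c : R) :
  a <= b -> a <= c -> a - 2^-1 * (b + c) <= 0.
Proof. lra. Qed.

(** Strict concavity through the identity ((a + b) / 2)^2 = a b + ((a - b) / 2)^2. *)
Lemma ln_midpoint (R : realType) (a b : R) : 0 < a -> 0 < b ->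
  2^-1 * (ln a + ln b) <= ln (2^-1 * (a + b)) ?= iff (a == b).
Proof.
move=> a0 b0; have c0 : 0 < 2^-1 * (a + b) by rewrite mulr_gt0// addr_gt0.
have E1 : 2^-1 * (ln a + ln b) = 2^-1 * ln (a * b) by rewrite lnM ?posrE.
have E2 : ln (2^-1 * (a + b)) = 2^-1 * ln ((2^-1 * (a + b)) ^+ 2).
  by rewrite lnXn//; field.
have E3 : (2^-1 * (a + b)) ^+ 2 = a * b + (2^-1 * (a - b)) ^+ 2 by field.
have ab0 : 0 < a * b by rewrite mulr_gt0.
split; rewrite E1 E2.
  rewrite ler_pM2l// ler_ln ?posrE ?exprn_gt0// E3 lerDl sqr_ge0//.
rewrite (inj_eq (mulfI _)) ?invr_eq0//.
rewrite (can_in_eq (@lnK R)) ?posrE ?exprn_gt0// E3 -subr_eq0 opprD addNKr.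
by rewrite oppr_eq0 sqrf_eq0 mulf_eq0 invr_eq0/= pnatr_eq0/= subr_eq0.
Qed.

Lemma sqr_le_sum (R : realFieldType) (e a b : R) : 0 <= e -> e <= a + b ->
  e ^+ 2 <= 2 * (a ^+ 2 + b ^+ 2).
Proof. by move=> e0 eab; have := sqr_ge0 (a - b); nra. Qed.

Lemma sumr_affine (R : pzRingType) N (a c : R) (f : nat -> R) :
  N%:R * a + \sum_(i < N) f i - N%:R * c = \sum_(i < N) (a + f i - c).
Proof. by rewrite sumrB big_split/= !sumr_const !card_ord !mulr_natl. Qed.

Lemma ler_sub_EFin (R : realFieldType) (c a b : R) :
  (a <= b) = ((c - b)%:E <= (c - a)%:E)%E.
Proof. by rewrite lee_fin lerD2l lerN2. Qed.

Lemma ler_add_twice (R : realFieldType) (q b l : R) : 0 <= q -> - b <= l ->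
  q * b <= q * l + 2 * (q * b).
Proof. by move=> q0 bl; have := ler_wpM2l q0 bl; lra. Qed.

(** The error budget of [limit_gain_ge0]: one fifth each for closeness to the net, the law of large
    numbers and continuity of the gain, and two for the doubled tail. *)
Lemma limit_arith (R : realFieldType) (N e s c I g t g' : R) : 0 < N ->
  0 <= N * (e / 5) + s - N * c -> s <= N * (I + e / 5) -> I <= c + g' + 2 * t ->
  t <= e / 5 -> g' <= g + e / 5 -> 0 <= g + e.
Proof.
move=> N0 h1 h2 h3 h4 h5.
have : 0 <= N * (e / 5 + (I + e / 5) - c) by lra.
rewrite pmulr_rge0//; lra.
Qed.

Section kullback_leibler.
Context (R : realType) (n : nat).
Local Notation E := 'rV[R]_n.
Context (Theta : set E) (Theta_compact : compact Theta) (Theta_nonempty : Theta !=set0).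
Context (sigma : R) (sigma_gt0 : 0 < sigma).
Context (D : R) (D0 : 0 <= D).
Hypothesis ThetaD : forall t, Theta t -> forall i, `|t ord0 i| <= D.
Context (p0 : E -> R) (p0_density : is_density p0).

Local Notation mass := (mass_system Theta).
Local Notation mixture := (@mixture R n Theta sigma).
Local Notation peak := (gaussian_peak n sigma).
Local Notation bound := (@shift_bound R n sigma D).
Local Notation mu := (lebesgue_rV R n).

Let p0_ge0 x : 0 <= p0 x. Proof. by case: p0_density. Qed.
Let mp0 : measurable_fun setT p0. Proof. by case: p0_density. Qed.
Let ip0 : mu.-integrable setT (EFin \o p0).
Proof.
apply/integrableP; split; first exact/measurable_EFinP.
under eq_integral do rewrite /= ger0_norm//.
by case: p0_density => _ _ ->; rewrite ltry.
Qed.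

Let mix_gt0 m x : mass m -> 0 < mixture m x.
Proof. exact: (mixture_gt0 Theta_compact Theta_nonempty sigma_gt0 D0 ThetaD). Qed.

Let mmix m : mass m -> measurable_fun setT (mixture m).
Proof. exact: (measurable_mixture Theta_compact Theta_nonempty sigma_gt0). Qed.

Definition kl_integrand m x := p0 x * ln (p0 x / mixture m x).

Lemma KLE m : mass m -> KL p0 (mixture m) = (\int[mu]_x (kl_integrand m x)%:E)%E.
Proof.
move=> mm; apply: eq_integral => x _; have q0 := mix_gt0 x mm.
rewrite inver gt_eqF// -EFinM /kl_integrand.
have := p0_ge0 x; rewrite le_eqVlt => /predU1P[<-|p0x].
  by rewrite mul0e mul0r.
by rewrite lne_EFin ?divr_gt0// EFinM.
Qed.

Lemma measurable_kl_integrand m : mass m -> measurable_fun setT (kl_integrand m).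
Proof.
move=> mm; apply: measurable_funM => //; apply: measurableT_comp => //.
apply: measurable_funM => //.
rewrite (_ : (fun _ => _) = fun x => expR (- ln (mixture m x))); last first.
  by apply/funext => x; rewrite expRN lnK// posrE mix_gt0.
apply: measurableT_comp => //; apply: measurableT_comp => //.
by apply: measurableT_comp => //; exact: mmix.
Qed.

Let gauss (c : R) (x : E) := expR (- (c * enorm x ^+ 2)).

Let igauss c : 0 < c -> mu.-integrable setT (EFin \o gauss c).
Proof.
move=> c0; apply/integrableP; split.
  apply/measurable_EFinP; apply: measurableT_comp => //; apply: measurableT_comp => //.
  by apply: measurable_funM => //; apply: measurable_funX; exact: measurable_enorm.
under eq_integral do rewrite /= ger0_norm ?expR_ge0//.
exact: lebesgue_rV_gaussian_lty.
Qed.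

(** Mixtures are at most [K8] exp(-2 c8 |x|^2). Half of this decay pays for the factor exp(c8 |x|^2)
    in Young's inequality; the other half stays integrable. *)
Let c8 := (8 * sigma ^+ 2)^-1.

Let c8_gt0 : 0 < c8.
Proof. by rewrite invr_gt0 mulr_gt0// exprn_gt0. Qed.

Let K8 := peak * expR (n%:R * D ^+ 2 / (2 * sigma ^+ 2)).

Let mixture_gauss m x : mass m -> mixture m x * expR (c8 * enorm x ^+ 2) <= K8 * gauss c8 x.
Proof.
move=> mm; rewrite /gauss expRN ler_pdivlMr ?expR_gt0// -mulrA -expRD.
apply: (@le_trans _ _ (peak * expR (- ((enorm x ^+ 2 / 2 - n%:R * D ^+ 2) / (2 * sigma ^+ 2))) *
  expR (c8 * enorm x ^+ 2 + c8 * enorm x ^+ 2))).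
  rewrite ler_wpM2r ?expR_ge0//.
  exact: (mixture_le Theta_compact Theta_nonempty sigma_gt0 D0 ThetaD).
rewrite -mulrA -expRD /K8 le_eqVlt; apply/orP; left; apply/eqP.
congr (_ * expR _); rewrite /c8; field.
by rewrite gt_eqF.
Qed.

(* Young's inequality [u b <= u ln u - u + e^b] at [u = p0 / p], [b = c |x|^2] *)
Let young m x : mass m ->
  p0 x * (c8 * enorm x ^+ 2) <= kl_integrand m x + K8 * gauss c8 x.
Proof.
move=> mm; have q0 := mix_gt0 x mm; have := mixture_gauss x mm.
set b := c8 * enorm x ^+ 2 => H.
apply: le_trans (_ : kl_integrand m x + mixture m x * expR b <= _); last by rewrite lerD2l.
rewrite /kl_integrand; have := p0_ge0 x; rewrite le_eqVlt => /predU1P[<-|p0x].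
  by rewrite !mul0r add0r mulr_ge0 ?expR_ge0// ltW.
set u := p0 x / mixture m x.
have u0 : 0 < u by rewrite divr_gt0.
have := expR_ge1Dx (b - ln u); rewrite expRB lnK ?posrE// ler_pdivlMr//.
have -> : p0 x = u * mixture m x by rewrite /u divfK ?gt_eqF.
move: (mixture m x) (ln u) (expR b) q0 => q l e q0 H1.
have H2 : u * b <= u * l + e by nra.
by have := ler_wpM2l (ltW q0) H2; lra.
Qed.

Lemma kl_integrand_ge m x : mass m -> - (K8 * gauss c8 x) <= kl_integrand m x.
Proof.
move=> mm; rewrite -subr_ge0 opprK; apply: le_trans (young x mm).
by rewrite mulr_ge0// mulr_ge0 ?sqr_ge0// ltW.
Qed.

(** The negative part lies below an integrable Gaussian, so an infinite positive part would make the
    divergence +oo. *)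
Lemma integrable_kl_integrand m : mass m -> (KL p0 (mixture m) < +oo)%E ->
  mu.-integrable setT (EFin \o kl_integrand m).
Proof.
move=> mm; rewrite KLE// => KLoo.
have mF : measurable_fun setT (EFin \o kl_integrand m).
  by apply/measurable_EFinP; exact: measurable_kl_integrand.
have ig : mu.-integrable setT (EFin \o (fun x => K8 * gauss c8 x)).
  exact: (integrableZl measurableT K8 (igauss c8_gt0)).
have peak0 := ltW (gaussian_peak_gt0 n sigma_gt0).
have K80 : 0 <= K8 by rewrite mulr_ge0 ?expR_ge0.
have ng : (\int[mu]_x (EFin \o kl_integrand m)^\- x < +oo)%E.
  have /integrableP[_] := ig; apply: le_lt_trans.
  apply: ge0_le_integral => //.
  - exact: measurable_funeneg.
  - by apply: measurableT_comp => //; case/integrableP : ig.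
  move=> x _; rewrite /= funenegE ger0_norm ?mulr_ge0 ?expR_ge0//.
  rewrite ge_max -EFinN !lee_fin mulr_ge0 ?expR_ge0// andbT lerNl.
  exact: kl_integrand_ge.
have ps : (\int[mu]_x (EFin \o kl_integrand m)^\+ x < +oo)%E.
  rewrite ltey; apply/eqP => Fy; move: KLoo; rewrite integralE Fy.
  have ng_fin : (\int[mu]_x (EFin \o kl_integrand m)^\- x)%E \is a fin_num.
    rewrite ge0_fin_numE; first exact: ng.
    by apply: integral_ge0 => x _; exact: funeneg_ge0.
  by rewrite -[X in (_ - X)%E](fineK ng_fin) -EFinN addye// ltxx.
apply/integrableP; split => //.
rewrite (eq_integral (fun x => (EFin \o kl_integrand m)^\+ x + (EFin \o kl_integrand m)^\- x)%E).
  rewrite ge0_integralD//; first exact: lte_add_pinfty.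
  - exact: measurable_funepos.
  - exact: measurable_funeneg.
by move=> x _; exact: (congr1 (fun g => g x) (fune_abse (EFin \o kl_integrand m))).
Qed.

Lemma second_moment m : mass m -> (KL p0 (mixture m) < +oo)%E ->
  mu.-integrable setT (EFin \o (fun x => p0 x * enorm x ^+ 2)).
Proof.
move=> mm KLoo; have iF := integrable_kl_integrand mm KLoo.
have ig : mu.-integrable setT (EFin \o (fun x => K8 * gauss c8 x)).
  exact: (integrableZl measurableT K8 (igauss c8_gt0)).
have iS : mu.-integrable setT (EFin \o (fun x => c8^-1 * (kl_integrand m x + K8 * gauss c8 x))).
  exact: (integrableZl measurableT c8^-1 (integrableD measurableT iF ig)).
apply: le_integrable iS => //.
  apply/measurable_EFinP; apply: measurable_funM => //; apply: measurable_funX.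
  exact: measurable_enorm.
move=> x _; rewrite /= lee_fin ger0_norm ?mulr_ge0 ?enorm_ge0//.
apply: le_trans (ler_norm _); rewrite ler_pdivlMl// mulrCA.
exact: young.
Qed.

Lemma bound_moments m : mass m -> (KL p0 (mixture m) < +oo)%E ->
  mu.-integrable setT (EFin \o (fun x => p0 x * bound x)) /\
  mu.-integrable setT (EFin \o (fun x => p0 x * bound x ^+ 2)).
Proof.
move=> mm KLoo; have i2 := second_moment mm KLoo.
pose k := n%:R * (4 * D) / (2 * sigma ^+ 2).
have boundE x : bound x = k * (enorm x + D) by rewrite /shift_bound /k mulrAC.
have k0 : 0 <= k by rewrite divr_ge0 ?mulr_ge0// ltW.
have mb : measurable_fun setT bound.
  rewrite (_ : bound = fun x => k * (enorm x + D)); last exact/funext.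
  by apply: measurable_funM => //; apply: measurable_funD => //; exact: measurable_enorm.
have idom (c : R) : mu.-integrable setT (EFin \o (fun x => c * (p0 x * enorm x ^+ 2 + p0 x))).
  exact: (integrableZl measurableT c (integrableD measurableT i2 ip0)).
split.
- apply: le_integrable (idom (k * (1 + D))) => //.
    by apply/measurable_EFinP; exact: measurable_funM.
  move=> x _; have b0 := shift_bound_ge0 sigma_gt0 D0 x.
  rewrite /= lee_fin (ger0_norm (mulr_ge0 (p0_ge0 x) b0)).
  apply: le_trans (ler_norm _); rewrite boundE.
  have := enorm_ge0 x; move: (enorm x) => e e0; have := p0_ge0 x; move: (p0 x) => q q0.
  have : e + D <= (1 + D) * (e ^+ 2 + 1) by exact: add_le_sqr.
  move=> H; rewrite (_ : q * (k * _) = (q * k) * (e + D)); last by ring.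
  rewrite (_ : k * (1 + D) * _ = (q * k) * ((1 + D) * (e ^+ 2 + 1))); last by ring.
  by rewrite ler_wpM2l// mulr_ge0.
- apply: le_integrable (idom (k ^+ 2 * (2 * (1 + D ^+ 2)))) => //.
    by apply/measurable_EFinP; apply: measurable_funM => //; exact: measurable_funX.
  move=> x _; rewrite /= lee_fin (ger0_norm (mulr_ge0 (p0_ge0 x) (sqr_ge0 (bound x)))).
  apply: le_trans (ler_norm _); rewrite boundE.
  have := enorm_ge0 x; move: (enorm x) => e e0; have := p0_ge0 x; move: (p0 x) => q q0.
  have : (e + D) ^+ 2 <= (2 * (1 + D ^+ 2)) * (e ^+ 2 + 1) by exact: sqr_add_le.
  move=> H; rewrite (_ : q * (k * _) ^+ 2 = (q * k ^+ 2) * (e + D) ^+ 2); last by ring.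
  rewrite (_ : k ^+ 2 * (2 * _) * _ =
    (q * k ^+ 2) * ((2 * (1 + D ^+ 2)) * (e ^+ 2 + 1))); last by ring.
  by rewrite ler_wpM2l// mulr_ge0 ?sqr_ge0.
Qed.

(** * Gain over a reference mixture of finite divergence *)

Section with_reference.
Context (m0 : seq bool -> R) (mm0 : mass m0) (KL0 : (KL p0 (mixture m0) < +oo)%E).

Definition log_ratio m x := ln (mixture m x) - ln (mixture m0 x).

(** Minus the divergence up to a constant, see [KL_gain]. Its integrand is dominated by p0 [bound]
    uniformly in m, so one finite divergence makes all of them finite. *)
Definition gain m := \int[mu]_x (p0 x * log_ratio m x).

Lemma measurable_log_ratio m : mass m -> measurable_fun setT (log_ratio m).
Proof.
by move=> mm; apply: measurable_funB; apply: measurableT_comp => //; exact: mmix.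
Qed.

Lemma log_ratio_le m x : mass m -> `|log_ratio m x| <= bound x.
Proof.
by move=> mm; exact: (ln_mixture_shift Theta_compact Theta_nonempty sigma_gt0 D0 ThetaD).
Qed.

Lemma integrable_log_ratio m : mass m ->
  mu.-integrable setT (EFin \o (fun x => p0 x * log_ratio m x)).
Proof.
move=> mm; apply: le_integrable (bound_moments mm0 KL0).1 => //.
  by apply/measurable_EFinP; apply: measurable_funM => //; exact: measurable_log_ratio.
move=> x _; rewrite /= lee_fin normrM [leRHS]normrM ler_wpM2l//.
by rewrite (le_trans (log_ratio_le x mm))// ler_norm.
Qed.

Lemma kl_integrandE m x : mass m ->
  kl_integrand m x = kl_integrand m0 x - p0 x * log_ratio m x.
Proof.
move=> mm; rewrite /kl_integrand /log_ratio.
exact: mul_ln_div (p0_ge0 x) (mix_gt0 x mm) (mix_gt0 x mm0).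
Qed.

Lemma KL_gain m : mass m ->
  KL p0 (mixture m) = (\int[mu]_x kl_integrand m0 x - gain m)%:E.
Proof.
move=> mm; have iF := integrable_kl_integrand mm0 KL0; have iG := integrable_log_ratio mm.
rewrite /gain -(RintegralB measurableT iF iG) KLE//.
rewrite fineK; last exact: (integrable_fin_num measurableT (integrableB measurableT iF iG)).
by apply: eq_integral => x _; rewrite kl_integrandE.
Qed.

Lemma log_ratioB m1 m2 x :
  log_ratio m1 x - log_ratio m2 x = ln (mixture m1 x) - ln (mixture m2 x).
Proof.
exact: subrBB.
Qed.

Let mbound : measurable_fun setT bound.
Proof.
apply: measurable_funM => //; apply: measurable_funM => //.
by apply: measurable_funD => //; exact: measurable_enorm.
Qed.

Let mind (N : nat) : measurable_fun setT (fun x : E => (N%:R < enorm x)%R%:R : R).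
Proof.
rewrite (_ : (fun _ => _) = \1_[set x : E | N%:R < enorm x]); last first.
  apply/funext => x; rewrite indicE; congr (_%:R).
  by apply/esym; case: ltP => Nx; [rewrite mem_set|rewrite memNset//= ltNge Nx].
apply: measurable_indic; rewrite (_ : mkset _ = (@enorm R n) @^-1` `]N%:R, +oo[); last first.
  by apply/seteqP; split => x /=; rewrite in_itv/= andbT.
by rewrite -[X in measurable X]setTI; exact: measurable_enorm.
Qed.

Definition tail (N : nat) x := p0 x * bound x * (N%:R < enorm x)%R%:R.

Lemma measurable_tail N : measurable_fun setT (tail N).
Proof. by apply: measurable_funM => //; exact: measurable_funM. Qed.

Lemma tail_le N x : `|tail N x| <= p0 x * bound x.
Proof.
have b0 := shift_bound_ge0 sigma_gt0 D0 x.
rewrite /tail normrM (ger0_norm (mulr_ge0 (p0_ge0 x) b0)) -[leRHS]mulr1.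
rewrite ler_wpM2l//; first exact: mulr_ge0 (p0_ge0 x) b0.
by case: ltP; rewrite ?normr1 ?normr0.
Qed.

Lemma integrable_tail N : mu.-integrable setT (EFin \o tail N).
Proof.
apply: le_integrable (bound_moments mm0 KL0).1 => //.
  by apply/measurable_EFinP; exact: measurable_tail.
by move=> x _; rewrite /= lee_fin (le_trans (tail_le N x))// ler_norm.
Qed.

Lemma cvg_tail : \int[mu]_x tail N x @[N --> \oo] --> (0 : R).
Proof.
have -> : (0 : R) = \int[mu]_x (cst 0 x : R) by rewrite Rintegral_cst// mul0r.
apply: (cvg_Rintegral measurable_tail _ (bound_moments mm0 KL0).1 tail_le) => x.
apply: cvg_near_cst; near=> N; rewrite /tail ltNge.
by rewrite (_ : enorm x <= N%:R) ?mulr0//; near: N; exact: nbhs_infty_ger.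
Unshelve. all: by end_near. Qed.

Lemma Rintegral_density : \int[mu]_x p0 x = 1.
Proof. by rewrite /Rintegral; case: p0_density => _ _ ->. Qed.

(** Inside a large ball log-mixtures are uniformly close; outside, [bound] controls their difference
    and its integral against p0 is a small tail. *)
Lemma gain_close (e : R) : 0 < e -> exists k, exists2 dl : R, 0 < dl &
  forall m1 m2, mass m1 -> mass m2 ->
  (forall w, (size w <= k)%N -> `|m1 w - m2 w| <= dl) -> gain m1 <= gain m2 + e.
Proof.
move=> e0; have e20 : 0 < e / 2 by rewrite divr_gt0.
have /cvgrPdist_le/(_ _ e20)/filter_ex[N] := cvg_tail.
rewrite sub0r normrN => /(le_trans (ler_norm _)) tN.
have [k [dl dl0 kP]] :=
  ln_mixture_close Theta_compact Theta_nonempty sigma_gt0 D0 ThetaD (ler0n R N) e20.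
exists k, dl => // m1 m2 mm1 mm2 m12.
have i2 := integrable_log_ratio mm2; have it := integrable_tail N.
have ie : mu.-integrable setT (EFin \o (fun x => e / 2 * p0 x)).
  exact: (integrableZl measurableT (e / 2) ip0).
have iet : mu.-integrable setT (EFin \o (fun x => e / 2 * p0 x + tail N x)).
  exact: (integrableD measurableT ie it).
apply: (@le_trans _ _ (\int[mu]_x (p0 x * log_ratio m2 x + (e / 2 * p0 x + tail N x)))).
  apply: le_Rintegral; first exact: measurableT.
  - exact: integrable_log_ratio.
  - exact: (integrableD measurableT i2 iet).
  move=> x _; rewrite -lerBlDl -mulrBr.
  have -> : log_ratio m1 x - log_ratio m2 x = ln (mixture m1 x) - ln (mixture m2 x).
    exact: log_ratioB.
  rewrite /tail; case: ltP => Nx; rewrite ?mulr1 ?mulr0 ?addr0.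
    have h1 := ln_mixture_shift Theta_compact Theta_nonempty sigma_gt0 D0 ThetaD x mm1 mm2.
    have h2 : 0 <= e / 2 * p0 x by rewrite mulr_ge0// ltW.
    apply: le_trans (ler_wpM2l (p0_ge0 x) (le_trans (ler_norm _) h1)) _.
    by rewrite lerDr.
  by rewrite mulrC ler_wpM2r//; exact: kP.
rewrite (RintegralD measurableT i2 iet) lerD2l (RintegralD measurableT ie it).
by rewrite (RintegralZl _ measurableT ip0) Rintegral_density mulr1 [leRHS]splitr lerD2l.
Qed.

Lemma gain_max : exists2 m, mass m & forall m', mass m' -> gain m' <= gain m.
Proof.
pose S := [set gain m | m in mass].
have supS : has_sup S.
  split; first by exists (gain m0), m0.
  exists (\int[mu]_x (p0 x * bound x)) => _ [m mm <-].
  apply: le_Rintegral; first exact: measurableT.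
  - exact: integrable_log_ratio.
  - exact: (bound_moments mm0 KL0).1.
  by move=> x _; rewrite ler_wpM2l// (le_trans (ler_norm _))// log_ratio_le.
have seq_sup i : exists m, mass m /\ sup S - i.+1%:R^-1 < gain m.
  have [|_ [m mm <-] mS] := sup_adherent _ supS (eps := i.+1%:R^-1).
    by rewrite invr_gt0.
  by exists m.
pose ms i := projT1 (cid (seq_sup i)).
have mms i : mass (ms i) by rewrite /ms; case: cid => ? [].
have [U [UU oU]] := ultraFilterLemma eventually_filter.
have PU : ProperFilter U by exact: ultra_proper.
have [m mm msm] := mass_system_compact UU mms.
exists m; first exact: mm.
move=> m' mm'; apply/ler_addgt0Pr => e e0.
apply: (@le_trans _ _ (sup S)); first by apply: ub_le_sup; [case: supS|exists m'].
have e20 : 0 < e / 2 by rewrite divr_gt0.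
have [k [dl dl0 kP]] := gain_close e20.
have near_sup : \forall i \near U, sup S - gain (ms i) <= e / 2.
  apply: oU; apply: filterS (near_infty_natSinv_lt (PosNum e20)) => i /ltW; apply: le_trans.
  by rewrite lerBlDl -lerBlDr ltW// /ms; case: cid => ? [].
have [i [/(kP _ _ (mms i) mm) h1 h2]] := filter_ex (filterI (msm k dl dl0) near_sup).
exact: le_add_halves h1 h2.
Qed.

(** The concavity gap at the midpoint mixture is nonnegative, and by maximality its integral is at
    most 0, so it vanishes almost everywhere. If the mixtures differed almost everywhere, p0 would
    vanish almost everywhere. *)
Lemma gain_max_mixture m1 m2 : mass m1 -> mass m2 ->
  (forall m, mass m -> gain m <= gain m1) -> (forall m, mass m -> gain m <= gain m2) ->
  mu [set x | mixture m1 x = mixture m2 x] != 0%E.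
Proof.
move=> mm1 mm2 max1 max2; set Z := [set x | _].
have mZ : measurable Z.
  rewrite (_ : Z = (fun x => mixture m1 x - mixture m2 x) @^-1` [set 0]).
    rewrite -[X in measurable X]setTI.
    by apply: (measurable_funB (mmix mm1) (mmix mm2)); [exact: measurableT|exact: measurable_set1].
  apply/seteqP; split => x; last exact: subr0_eq.
  by rewrite /Z /= => ->; rewrite subrr.
have [m3 mm3 m3E] := mixture_midpoint Theta_compact Theta_nonempty sigma_gt0 mm1 mm2.
pose gap x := p0 x * (log_ratio m3 x - 2^-1 * (log_ratio m1 x + log_ratio m2 x)).
have gapE x : gap x = p0 x * (ln (2^-1 * (mixture m1 x + mixture m2 x)) -
    2^-1 * (ln (mixture m1 x) + ln (mixture m2 x))).
  by rewrite /gap /log_ratio subr_midpoint m3E.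
have gap0 x : 0 <= gap x.
  rewrite gapE; apply: mulr_ge0 => //; rewrite subr_ge0.
  by apply: (ln_midpoint _ _).1; exact: mix_gt0.
have i1 := integrable_log_ratio mm1; have i2 := integrable_log_ratio mm2.
have i3 := integrable_log_ratio mm3.
have i12 : mu.-integrable setT (EFin \o (fun x => p0 x * log_ratio m1 x + p0 x * log_ratio m2 x)).
  exact: (integrableD measurableT i1 i2).
have ih : mu.-integrable setT
    (EFin \o (fun x => 2^-1 * (p0 x * log_ratio m1 x + p0 x * log_ratio m2 x))).
  exact: (integrableZl measurableT 2^-1 i12).
have gapB : gap = fun x => p0 x * log_ratio m3 x -
    2^-1 * (p0 x * log_ratio m1 x + p0 x * log_ratio m2 x).
  by apply/funext => x; exact: mulr_sub_midpoint.
have igap : mu.-integrable setT (EFin \o gap).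
  by rewrite gapB; exact: (integrableB measurableT i3 ih).
have Igap : \int[mu]_x gap x = 0.
  apply: le_anti; apply/andP; split; last by apply: Rintegral_ge0 => x _; exact: gap0.
  rewrite gapB (RintegralB measurableT i3 ih) (RintegralZl _ measurableT i12).
  rewrite (RintegralD measurableT i1 i2).
  exact: sub_midpoint_le0 (max1 _ mm3) (max2 _ mm3).
have mgap : measurable_fun setT (EFin \o gap) by case/integrableP : igap.
apply/eqP => Z0.
have : (\int[mu]_x (p0 x)%:E)%E = 0%E.
  have gapae : ae_eq mu setT (EFin \o gap) (cst 0%E).
    apply/(ae_eq_integral_abs mu measurableT mgap).
    under eq_integral do rewrite /= ger0_norm//.
    rewrite -[LHS]fineK; last by apply: integrable_fin_num => //.
    by congr EFin.
  rewrite (ae_eq_integral (cst 0%E)) ?integral0//; first exact/measurable_EFinP.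
  have Zae : \forall x \ae mu, ~ Z x.
    by exists Z; split; [exact: mZ|exact: Z0|move=> x; exact: contrapT].
  move: gapae Zae; apply: filterS2 => x /(_ Logic.I) + nZ _ => /eqP.
  rewrite /= eqe gapE mulf_eq0 subr_eq0 => /orP[/eqP ->//|].
  rewrite eq_sym (ln_midpoint (mix_gt0 x mm1) (mix_gt0 x mm2)).2 => /eqP.
  by move=> /nZ.
by case: p0_density => _ _ -> /eqP; rewrite onee_eq0.
Qed.

(** * Limits of maximum likelihood estimators *)

(* [cap M] is the value of [bound] on the sphere of radius [M]; it makes the
   envelope nonnegative, as the one-sided law of large numbers requires. *)
Definition cap (M : nat) : R := n%:R * (4 * D) * (M%:R + D) / (2 * sigma ^+ 2).

(** Outside the ball, where closeness of mass systems says nothing, the log-ratio is replaced by its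
    universal majorant. Up to a small constant, one envelope thus dominates the log-ratios of all
    nearby mass systems. *)
Definition envelope m M x := cap M + (if enorm x <= M%:R then log_ratio m x else bound x).

Lemma bound_le_cap M x : enorm x <= M%:R -> bound x <= cap M.
Proof.
move=> xM; rewrite /cap /shift_bound ler_pM2r ?invr_gt0 ?mulr_gt0 ?exprn_gt0//.
by rewrite ler_wpM2l ?mulr_ge0// lerD2r.
Qed.

Lemma cap_ge0 M : 0 <= cap M.
Proof.
by rewrite /cap !(mulr_ge0, invr_ge0, addr_ge0) ?(ltW sigma_gt0).
Qed.

Lemma envelope_ge0 m M x : mass m -> 0 <= envelope m M x.
Proof.
move=> mm; rewrite /envelope; case: ifPn => xM; last first.
  by rewrite addr_ge0 ?cap_ge0//; exact: (shift_bound_ge0 sigma_gt0 D0 x).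
rewrite addrC -lerBlDr sub0r (le_trans _ (lerNnormlW (log_ratio_le x mm)))//.
by rewrite lerN2 bound_le_cap.
Qed.

Lemma envelope_le m M x : mass m -> envelope m M x <= cap M + bound x.
Proof.
move=> mm; rewrite /envelope lerD2l; case: ifPn => // _.
exact: le_trans (ler_norm _) (log_ratio_le x mm).
Qed.

Lemma measurable_envelope m M : mass m -> measurable_fun setT (envelope m M).
Proof.
move=> mm; apply: measurable_funD; first exact: measurable_cst.
apply: measurable_fun_ifT; last exact: mbound.
  by apply: measurable_fun_ler; [exact: measurable_enorm|exact: measurable_cst].
exact: measurable_log_ratio.
Qed.

Lemma integrable_envelope m M : mass m ->
  mu.-integrable setT (EFin \o (fun x => p0 x * envelope m M x)) /\
  mu.-integrable setT (EFin \o (fun x => p0 x * envelope m M x ^+ 2)).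
Proof.
move=> mm; have [ib ib2] := bound_moments mm0 KL0.
have me := measurable_envelope M mm.
have ic (c : R) : mu.-integrable setT (EFin \o (fun x => c * p0 x)).
  exact: (integrableZl measurableT c ip0).
split.
- have idom : mu.-integrable setT (EFin \o (fun x => cap M * p0 x + p0 x * bound x)).
    exact: (integrableD measurableT (ic (cap M)) ib).
  apply: (le_integrable measurableT _ _ idom).
    by apply/measurable_EFinP; exact: measurable_funM mp0 me.
  move=> x _; rewrite /= lee_fin (ger0_norm (mulr_ge0 (p0_ge0 x) (envelope_ge0 M x mm))).
  apply: le_trans (ler_norm _); rewrite [cap M * _]mulrC -mulrDr.
  exact: ler_wpM2l (p0_ge0 x) _ _ (envelope_le M x mm).
- have idom : mu.-integrable setT
      (EFin \o (fun x => 2 * (cap M ^+ 2 * p0 x + p0 x * bound x ^+ 2))).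
    exact: (integrableZl measurableT 2 (integrableD measurableT (ic (cap M ^+ 2)) ib2)).
  apply: (le_integrable measurableT _ _ idom).
    by apply/measurable_EFinP; apply: measurable_funM mp0 _; exact: measurable_funX.
  move=> x _; rewrite /= lee_fin (ger0_norm (mulr_ge0 (p0_ge0 x) (sqr_ge0 _))).
  apply: le_trans (ler_norm _); rewrite [cap M ^+ 2 * _]mulrC -mulrDr [leRHS]mulrCA.
  apply: (ler_wpM2l (p0_ge0 x)).
  exact: sqr_le_sum (envelope_ge0 M x mm) (envelope_le M x mm).
Qed.

(** Outside the ball [bound] exceeds the log-ratio by at most 2 [bound], hence the doubled tail. *)
Lemma Rintegral_envelope_le m M : mass m ->
  \int[mu]_x (p0 x * envelope m M x) <= cap M + gain m + 2 * \int[mu]_x tail M x.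
Proof.
move=> mm; have [ie _] := integrable_envelope M mm.
have ic : mu.-integrable setT (EFin \o (fun x => cap M * p0 x)).
  exact: (integrableZl measurableT (cap M) ip0).
have il := integrable_log_ratio mm; have it := integrable_tail M.
have icl : mu.-integrable setT (EFin \o (fun x => cap M * p0 x + p0 x * log_ratio m x)).
  exact: (integrableD measurableT ic il).
have i2 : mu.-integrable setT (EFin \o (fun x => 2 * tail M x)).
  exact: (integrableZl measurableT 2 it).
have -> : cap M + gain m + 2 * \int[mu]_x tail M x =
    \int[mu]_x (cap M * p0 x + p0 x * log_ratio m x + 2 * tail M x).
  rewrite (RintegralD measurableT icl i2) (RintegralD measurableT ic il).
  rewrite (RintegralZl _ measurableT it) (RintegralZl _ measurableT ip0).
  by rewrite Rintegral_density mulr1.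
apply: le_Rintegral; first exact: measurableT.
- exact: ie.
- exact: (integrableD measurableT icl i2).
move=> x _; rewrite /envelope /tail mulrDr [cap M * _]mulrC -addrA lerD2l.
case: (leP (enorm x) M%:R) => xM; first by rewrite mulr0 mulr0 addr0.
have -> : p0 x * bound x * true%:R = p0 x * bound x by exact: mulr1.
exact: ler_add_twice (p0_ge0 x) (lerNnormlW (log_ratio_le x mm)).
Qed.

Lemma log_ratio_le_envelope m1 m2 M (e : R) : mass m1 -> mass m2 -> 0 <= e ->
  (forall x, enorm x <= M%:R -> ln (mixture m1 x) - ln (mixture m2 x) <= e) ->
  forall x, log_ratio m1 x <= e + envelope m2 M x - cap M.
Proof.
move=> mm1 mm2 e0 close x; rewrite /envelope [cap M + _]addrC addrA addrK.
case: ifPn => xM; first by rewrite -lerBlDr log_ratioB; exact: close.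
apply: le_trans (le_trans (ler_norm _) (log_ratio_le x mm1)) _.
by rewrite lerDr.
Qed.

(** A deterministic statement about one sample path y: the envelope of a net element near the limit
    m dominates the log-ratio of the estimator and obeys the law of large numbers. *)
Lemma limit_gain_ge0 (net : nat -> seq bool -> R) (y : nat -> E)
    (ms : nat -> seq bool -> R) (U : set_system nat) (m : seq bool -> R) :
  (forall j, mass (net j)) ->
  (forall m k (dl : R), mass m -> 0 < dl ->
    exists j, forall w, (size w <= k)%N -> `|m w - net j w| <= dl) ->
  (forall j M (e : R), 0 < e -> \forall N \near \oo, \sum_(i < N) envelope (net j) M (y i) <=
    N%:R * (\int[mu]_x (p0 x * envelope (net j) M x) + e)) ->
  (forall N, mass (ms N)) -> (forall N, 0 <= \sum_(i < N) log_ratio (ms N) (y i)) ->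
  UltraFilter U -> \oo `<=` U -> mass m ->
  (forall k (dl : R), 0 < dl -> \forall i \near U,
     forall w, (size w <= k)%N -> `|ms i w - m w| <= dl) ->
  0 <= gain m.
Proof.
move=> mnet net_dense slln mms opt UU oU mm msm; have PU : ProperFilter U by exact: ultra_proper.
apply/ler_addgt0Pr => e e0; have e50 : 0 < e / 5 by rewrite divr_gt0.
have /cvgrPdist_le/(_ _ e50)/filter_ex[M] := cvg_tail.
rewrite sub0r normrN => /(le_trans (ler_norm _)) tM.
have [k1 [dl1 dl10 k1P]] :=
  ln_mixture_close Theta_compact Theta_nonempty sigma_gt0 D0 ThetaD (ler0n R M) e50.
have [k2 [dl2 dl20 k2P]] := gain_close e50.
(* Estimator and net element are compared through m, hence half of [dl1]. *)
pose dl := Num.min (dl1 / 2) dl2.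
have dl0 : 0 < dl by rewrite lt_min dl20 divr_gt0.
have [j mj] := net_dense m (maxn k1 k2) dl mm dl0.
have gj : gain (net j) <= gain m + e / 5.
  apply: k2P => // w wk; rewrite distrC (le_trans (mj w _))//.
    by rewrite (leq_trans wk)// leq_maxr.
  by rewrite /dl ge_min lexx orbT.
have Ngt0 : \forall N \near U, (0 < N)%N by apply: oU; exact: nbhs_infty_gt.
have [N [[N0 msN] sN]] := filter_ex (filterI (filterI Ngt0 (msm k1 dl dl0))
  (oU _ (slln j M _ e50))).
have close : forall x, enorm x <= M%:R -> ln (mixture (ms N) x) - ln (mixture (net j) x) <= e / 5.
  apply: k1P => // w wk; rewrite (splitr dl1) (le_trans (ler_distD (m w) _ _))// lerD//.
    by rewrite (le_trans (msN w wk))// ge_min lexx.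
  by rewrite (le_trans (mj w _)) ?ge_min ?lexx// (leq_trans wk)// leq_maxl.
have NR : 0 < N%:R :> R by rewrite ltr0n.
have h1 : 0 <= N%:R * (e / 5) + \sum_(i < N) envelope (net j) M (y i) - N%:R * cap M.
  apply: le_trans (opt N) _.
  rewrite (sumr_affine _ (e / 5) (cap M) (fun i => envelope (net j) M (y i))).
  apply: ler_sum => i _.
  exact: (log_ratio_le_envelope (mms N) (mnet j) (ltW e50) close).
have h2 := Rintegral_envelope_le M (mnet j).
exact: (limit_arith NR h1 sN h2 tM gj).
Qed.

Lemma gain_ref : gain m0 = 0.
Proof.
rewrite /gain; under eq_Rintegral do rewrite /log_ratio subrr mulr0.
by rewrite Rintegral_cst// mul0r.
Qed.

Lemma gain_leE m m' : mass m -> mass m' ->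
  (gain m <= gain m') = (KL p0 (mixture m') <= KL p0 (mixture m))%E.
Proof.
move=> mm mm'; apply: etrans (ler_sub_EFin (\int[mu]_x kl_integrand m0 x) _ _) _.
by apply: (congr2 (fun a b : \bar R => (a <= b)%E)); apply: esym; exact: KL_gain.
Qed.

End with_reference.

Lemma KL_min_exists m0 : mass m0 -> (KL p0 (mixture m0) < +oo)%E ->
  exists m, [/\ mass m, (KL p0 (mixture m) < +oo)%E &
    forall m', mass m' -> (KL p0 (mixture m) <= KL p0 (mixture m'))%E].
Proof.
move=> mm0 KL0; have [m mm m_max] := gain_max mm0 KL0; exists m; split.
- exact: mm.
- by rewrite (KL_gain mm0 KL0 mm) ltry.
- by move=> m' mm'; rewrite -(gain_leE mm0 KL0 mm' mm); exact: m_max.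
Qed.

Lemma KL_min_unique m1 m2 : mass m1 -> (KL p0 (mixture m1) < +oo)%E ->
  (forall m, mass m -> (KL p0 (mixture m1) <= KL p0 (mixture m))%E) ->
  mass m2 -> (KL p0 (mixture m2) <= KL p0 (mixture m1))%E ->
  forall A, measurable A ->
  unit_prob R (skorokhod Theta m2 @^-1` A) = unit_prob R (skorokhod Theta m1 @^-1` A).
Proof.
move=> mm1 KL1 min1 mm2 KL21.
have max1 m : mass m -> gain m1 m <= gain m1 m1.
  by move=> mm; rewrite (gain_leE mm1 KL1 mm mm1); exact: min1.
have max2 m : mass m -> gain m1 m <= gain m1 m2.
  move=> mm; apply: le_trans (max1 m mm) _.
  by rewrite (gain_leE mm1 KL1 mm1 mm2).
apply: (mixture_identifiable Theta_compact Theta_nonempty sigma_gt0 D0 ThetaD mm2 mm1).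
exact: (gain_max_mixture mm1 KL1 mm2 mm1 max2 max1).
Qed.

End kullback_leibler.

(** * Consistency *)

(** Plays the role of a subsequence along which A holds. *)
Lemma ultrafilter_within (A : set nat) : ~ (\forall N \near \oo, ~ A N) ->
  exists U : set_system nat, [/\ UltraFilter U, \oo `<=` U & U A].
Proof.
move=> nA; have PF : ProperFilter (within A \oo).
  split; last exact: within_filter.
  by move=> /= H; apply: nA; apply: filterS H => N; exact.
have [U [UU AU]] := ultraFilterLemma PF.
exists U; split => //; last by apply: AU; exact: nearW.
by move=> B oB; apply: AU; rewrite /within/=; apply: filterS oB => N.
Qed.

Lemma cvge_ge0_0 (R : realType) (u : nat -> \bar R) : (forall N, 0 <= u N)%E ->
  (forall e : R, 0 < e -> \forall N \near \oo, (u N <= e%:E)%E) -> u @ \oo --> 0%E.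
Proof.
move=> u0 ue; apply/fine_cvgP; split.
  apply: filterS (ue 1 ltr01) => N uN.
  by rewrite ge0_fin_numE// (le_lt_trans uN)// ltry.
apply/cvgrPdist_le => e e0; apply: filterS (ue e e0) => N uN.
rewrite sub0r normrN ger0_norm ?fine_ge0//= -lee_fin fineK//.
by rewrite ge0_fin_numE// (le_lt_trans uN)// ltry.
Qed.

Lemma mass_system_exists (R : realType) n (Theta : set 'rV[R]_n) :
  compact Theta -> Theta !=set0 -> exists m, mass_system Theta m.
Proof.
move=> Theta_compact Theta_nonempty; have [t Tt] := Theta_nonempty.
have GT : supported_on Theta (\d_t : probability 'rV[R]_n R).
  by transitivity (\1_Theta t : R)%:E => //; rewrite indicE mem_set.
have [m mm _] := supported_representation Theta_compact Theta_nonempty GT.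
by exists m.
Qed.

Lemma ae_foralln d (T : measurableType d) (R : realType) (mu : {measure set T -> \bar R})
    (Q : nat -> T -> Prop) :
  (forall k, {ae mu, forall x, Q k x}) -> {ae mu, forall x, forall k, Q k x}.
Proof.
move=> muQ; apply: negligibleS (negligible_bigcup muQ) => x /= /existsNP[k nQ].
by exists k.
Qed.

Section consistency.
Context (R : realType) (d : nat).
Local Notation E := 'rV[R]_d.
Context (Theta : set E) (Theta_compact : compact Theta) (Theta_nonempty : Theta !=set0).
Context (sigma : R) (sigma_gt0 : 0 < sigma).
Context (D : R) (D0 : 0 <= D).
Hypothesis ThetaD : forall t, Theta t -> forall i, `|t ord0 i| <= D.
Context (p0 : E -> R) (p0_density : is_density p0).
Local Notation mass := (mass_system Theta).
Local Notation mixture := (@mixture R d Theta sigma).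

Lemma skorokhod_law_KL_minimizer m (mm : mass m) :
  (forall m', mass m' -> (KL p0 (mixture m) <= KL p0 (mixture m'))%E) ->
  is_KL_minimizer Theta sigma p0 (skorokhod_law Theta_compact Theta_nonempty mm).
Proof.
move=> mmin; split; first exact: supported_on_skorokhod_law.
move=> _ [G' G'T <-].
have [m' mm' Gm'] := supported_representation Theta_compact Theta_nonempty G'T.
rewrite (gaussian_mixture_skorokhod_law Theta_compact Theta_nonempty sigma_gt0 mm).
rewrite (gaussian_mixtureE Theta_compact Theta_nonempty sigma_gt0 mm' Gm').
exact: mmin.
Qed.

Context (m0 : seq bool -> R) (mm0 : mass m0) (KL0 : (KL p0 (mixture m0) < +oo)%E).
Hypothesis KL_min : forall m, mass m -> (KL p0 (mixture m0) <= KL p0 (mixture m))%E.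
Local Notation Gsigma := (skorokhod_law Theta_compact Theta_nonempty mm0).

Lemma NPMLE_consistent d' (T : measurableType d') (P : probability T R)
    (Y : nat -> {RV P >-> E}) (Ghat : nat -> T -> probability E R) :
  iid_from p0 Y ->
  (forall n w, is_NPMLE Theta sigma (fun i : 'I_n => Y i w) (Ghat n w)) ->
  forall r : R, 1 <= r ->
  {ae P, forall w, (fun n => wasserstein Theta r (Ghat n w) Gsigma) @ \oo --> 0%E}.
Proof.
move=> iidY npmle r r1; have [net mnet net_dense] := mass_net mm0.
(* The estimator depends on the sample, so the law of large numbers is applied to fixed functions
   instead. Net elements and integer radii are countably many, which keeps the event almost sure. *)
have slln : {ae P, forall w, forall j M, forall e : R, 0 < e ->
    \forall N \near \oo, \sum_(i < N) envelope Theta sigma D m0 (net j) M (Y i w) <=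
    N%:R * (\int[lebesgue_rV R d]_x (p0 x * envelope Theta sigma D m0 (net j) M x) + e)}.
  apply: ae_foralln => j; apply: ae_foralln => M.
  have [i1 i2] := integrable_envelope Theta_compact Theta_nonempty sigma_gt0 D0 ThetaD
    p0_density mm0 KL0 M (mnet j).
  apply: (iid_averages_le p0_density iidY _ _ i1 i2).
  - exact: measurable_envelope.
  - by move=> x; exact: envelope_ge0.
have Ghat_rep N w : exists m, mass m /\ forall A, measurable A ->
    Ghat N w A = unit_prob R (skorokhod Theta m @^-1` A).
  have [GT _] := npmle N w.
  by have [m mm Gm] := supported_representation Theta_compact Theta_nonempty GT; exists m.
apply: filterS slln => w slln.
pose ms N := projT1 (cid (Ghat_rep N w)).
have mms N : mass (ms N) by rewrite /ms; case: cid => ? [].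
have Gms N A : measurable A -> Ghat N w A = unit_prob R (skorokhod Theta (ms N) @^-1` A).
  by rewrite /ms; case: cid => m [mm Gm]; exact: Gm.
(* The minimizer is itself a competitor for the likelihood. *)
have opt N : 0 <= \sum_(i < N) log_ratio Theta sigma m0 (ms N) (Y i w).
  have [_ /(_ _ (supported_on_skorokhod_law Theta_compact Theta_nonempty mm0))] := npmle N w.
  rewrite (gaussian_mixtureE Theta_compact Theta_nonempty sigma_gt0 (mms N) (Gms N)).
  rewrite (gaussian_mixture_skorokhod_law Theta_compact Theta_nonempty sigma_gt0 mm0).
  by rewrite -subr_ge0 -sumrB.
apply: cvge_ge0_0 => [N|e e0]; first exact: poweR_ge0.
apply: contrapT => nW.
(* If the distance exceeds e infinitely often, U lives on such indices; yet the limit along U has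
   the law of the minimizer, so some index of U is close. *)
have [|U [UU oU Ubad]] := @ultrafilter_within
    [set N | ~ (wasserstein Theta r (Ghat N w) Gsigma <= e%:E)%E].
  by move=> H; apply: nW; apply: filterS H => N; exact: contrapT.
have PU : ProperFilter U by exact: ultra_proper.
have [m mm msm] := mass_system_compact UU mms.
have gm : 0 <= gain Theta sigma p0 m0 m.
  exact: (limit_gain_ge0 (y := fun i => Y i w) Theta_compact Theta_nonempty sigma_gt0 D0
    ThetaD p0_density mm0 KL0 mnet net_dense slln mms opt UU oU mm msm).
have KLm : (KL p0 (mixture m) <= KL p0 (mixture m0))%E.
  rewrite -(gain_leE Theta_compact Theta_nonempty sigma_gt0 D0 ThetaD p0_density mm0 KL0 mm0 mm).
  by rewrite gain_ref.
have mlaw := KL_min_unique Theta_compact Theta_nonempty sigma_gt0 D0 ThetaD p0_density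
  mm0 KL0 KL_min mm KLm.
have [k [dl dl0 kP]] := wasserstein_close Theta_compact Theta_nonempty D0 ThetaD r1 e0.
have [N [bad close]] := filter_ex (filterI Ubad (msm k dl dl0)).
apply: bad; apply: (kP _ _ (mms N) mm close _ _ (Gms N)) => A mA.
exact: (esym (mlaw A mA)).
Qed.

End consistency.

Theorem proposition2p1 (R : realType) (d : nat) (Theta : set 'rV[R]_d)
    (p0 : 'rV[R]_d -> R) (sigma : R)
    (Theta_compact : compact Theta) (Theta_nonempty : Theta !=set0)
    (p0_density : is_density p0) (sigma_gt0 : 0 < sigma) :
  exists Gsigma : probability 'rV[R]_d R,
    is_KL_minimizer Theta sigma p0 Gsigma /\
    ((KL p0 (gaussian_mixture Theta sigma Gsigma) < +oo)%E ->
      (forall G : probability 'rV[R]_d R,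
         is_KL_minimizer Theta sigma p0 G ->
         forall A, measurable A -> G A = Gsigma A) /\
      (forall (d' : measure_display) (T : measurableType d')
          (P : probability T R) (Y : nat -> {RV P >-> 'rV[R]_d})
          (Ghat : nat -> T -> probability 'rV[R]_d R),
         iid_from p0 Y ->
         (forall n w, is_NPMLE Theta sigma (fun i : 'I_n => Y i w) (Ghat n w)) ->
         forall r : R, 1 <= r ->
           {ae P, forall w,
             (fun n => wasserstein Theta r (Ghat n w) Gsigma) @ \oo --> 0%E})).
Proof.
have [D0 D0P] := Theta_bounded Theta_compact.
pose D := Num.max D0 0; have D_ge0 : 0 <= D by rewrite le_max lexx orbT.
have ThetaD t : Theta t -> forall i, `|t ord0 i| <= D.
  by move=> Tt i; rewrite le_max D0P.
have mixE m (mm : mass_system Theta m) :=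
  gaussian_mixture_skorokhod_law Theta_compact Theta_nonempty sigma_gt0 mm.
have [[m0 [mm0 KL0]]|KLoo] := pselect (exists m, mass_system Theta m /\
    (KL p0 (mixture Theta sigma m) < +oo)%E); last first.
  have [m mm] := mass_system_exists Theta_compact Theta_nonempty.
  have KLmoo m' : mass_system Theta m' -> KL p0 (mixture Theta sigma m') = +oo%E.
    move=> mm'; apply/eqP; rewrite -leye_eq leNgt; apply/negP => KL1.
    by apply: KLoo; exists m'.
  (* All divergences are +oo here: any law on Theta is a minimizer, and the finiteness premise of
     the second half is false. *)
  exists (skorokhod_law Theta_compact Theta_nonempty mm); split; last first.
    by rewrite mixE (KLmoo m mm) ltxx.
  apply: skorokhod_law_KL_minimizer; first exact: sigma_gt0.
  by move=> m' mm'; apply: (le_trans (leey _)); rewrite (KLmoo m' mm').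
have [m [mm KLm KLmin]] := KL_min_exists Theta_compact Theta_nonempty sigma_gt0 D_ge0 ThetaD
  p0_density mm0 KL0.
exists (skorokhod_law Theta_compact Theta_nonempty mm); split.
  by apply: skorokhod_law_KL_minimizer; [exact: sigma_gt0|exact: KLmin].
move=> _; split=> [G [GT Gmin] A mA|d' T P Y Ghat].
  have [m' mm' Gm'] := supported_representation Theta_compact Theta_nonempty GT.
  rewrite (Gm' A mA).
  apply: (KL_min_unique Theta_compact Theta_nonempty sigma_gt0 D_ge0 ThetaD p0_density mm KLm
    KLmin mm' _ mA).
  rewrite -(gaussian_mixtureE Theta_compact Theta_nonempty sigma_gt0 mm' Gm') -(mixE m mm).
  by apply: Gmin; exists (skorokhod_law Theta_compact Theta_nonempty mm) => //;
    exact: supported_on_skorokhod_law.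
exact: (NPMLE_consistent Theta_compact Theta_nonempty sigma_gt0 D_ge0 ThetaD p0_density mm
  KLm KLmin).
Qed.
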